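(* Let $n\ge 2$, let $p<0$, and let $\mu$ be a discrete measure on the unit sphere $S^{n-1}$ of $\mathbb{R}^n$. Then $\mu$ is the $L_p$ surface area measure of a polytope whose $L_p$ surface area measure does not have an essential subspace (that is, there is a polytope $P\subset\mathbb{R}^n$ containing the origin in its interior such that $S_p(P,\cdot)=\mu$ and $S_p(P,\cdot)$ has no essential subspace) if and only if $\mu$ does not have an essential subspace and $\mu$ is not concentrated on a closed hemisphere of $S^{n-1}$.
   Context: A discrete measure on $S^{n-1}$ is a finite sum $\sum_{k=1}^N \alpha_k\delta_{u_k}$ with $\alpha_k>0$ and $u_k\in S^{n-1}$, where $\delta_u$ is the unit point mass at $u$. A polytope in $\mathbb{R}^n$ is the convex hull of a finite set of points, having positive $n$-dimensional volume. A facet of a polytope is a face (lying on its boundary) of positive $(n-1)$-dimensional volume. For $p\in\mathbb{R}$ and a convex body $K$ (compact convex set with non-empty interior) in $\mathbb{R}^n$ containing the origin in its interior, the $L_p$ surface area measure $S_p(K,\cdot)$ is the Borel measure on $S^{n-1}$ given by $$S_p(K,\omega)=\int_{x\in\nu_K^{-1}(\omega)}(x\cdot\nu_K(x))^{1-p}\,d\mathcal{H}^{n-1}(x)$$ for Borel $\omega\subset S^{n-1}$, where $\nu_K:\partial'K\to S^{n-1}$ is the Gauss map, defined on the set $\partial'K$ of boundary points of $K$ with a unique outer unit normal, and $\mathcal{H}^{n-1}$ is $(n-1)$-dimensional Hausdorff measure. In particular, if $P$ is a polytope containing the origin in its interior with exactly $N$ facets, with outer unit normals $u_1,\dots,u_N$,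 where the facet with normal $u_k$ has area ($(n-1)$-dimensional volume) $a_k$ and distance $h_k$ from the origin, then $S_p(P,\cdot)=\sum_{k=1}^N h_k^{1-p}a_k\delta_{u_k}$. For a linear subspace $X\subset\mathbb{R}^n$ with $\dim X\ge1$, a closed hemisphere of $X\cap S^{n-1}$ is a set $\{x\in X\cap S^{n-1}: x\cdot v\ge 0\}$ with $v\in X$, $v\ne0$ (for $X=\mathbb{R}^n$ this is a closed hemisphere of $S^{n-1}$). A set is concentrated on a closed hemisphere if it is contained in it (so the empty set is concentrated on every closed hemisphere); a measure is concentrated on a closed hemisphere if its support is. A linear subspace $X$ with $0<\dim X<n$ is essential with respect to a Borel measure $\mu$ on $S^{n-1}$ if $X\cap\mathrm{supp}(\mu)$ is not concentrated on any closed hemisphere of $X\cap S^{n-1}$. The measure $\mu$ has no essential subspace if no such $X$ is essential with respect to $\mu$. *)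

(* Defs.v *)
From HB Require Import structures.
From mathcomp Require Import all_boot all_order all_algebra.
From mathcomp Require Import all_classical all_reals all_analysis.

Set Implicit Arguments.
Unset Strict Implicit.
Unset Printing Implicit Defensive.

Import Order.TTheory GRing.Theory Num.Theory.
Import numFieldNormedType.Exports.

Local Open Scope classical_set_scope.
Local Open Scope ring_scope.

Section Euclidean.
Context {R : realType} {n : nat}.
Implicit Types x y : 'rV[R]_n.

Definition dot x y : R := \sum_i x 0 i * y 0 i.

(* The norm [`|x|] of the library on ['rV[R]_n] is the maximum norm; it induces
   the same topology as [enorm]. *)
Definition enorm x : R := Num.sqrt (dot x x).

Definition sphere : set 'rV[R]_n := [set u | enorm u = 1].

Definition diam (A : set 'rV[R]_n) : \bar R :=
  ereal_sup [set d | exists x y, [/\ A x, A y & d = (enorm (x - y))%:E]].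

End Euclidean.

Arguments sphere : clear implicits.

(* R^n with its Borel sigma-algebra.  The Borel subsets of the sphere are the
   Borel subsets of R^n contained in it. *)
Definition borel (R : realType) (n : nat) :=
  g_sigma_algebraType (@open 'rV[R]_n).

Section Hausdorff.
Context {R : realType} {n : nat}.
Local Open Scope ereal_scope.

(* Volume omega_s of the unit ball of R^s, by omega_s = (2 pi / s) omega_(s-2). *)
Fixpoint ball_volume (s : nat) : R :=
  match s with
  | 0 => 1
  | 1 => 2
  | (s'.+2) as k => 2 * pi / k%:R * ball_volume s'
  end%R.

(* omega_s (diam U / 2)^s; [diam set0] is -oo, hence the case distinction. *)
Definition hausdorff_gauge (s : nat) (U : set 'rV[R]_n) : \bar R :=
  if U == set0 then 0 else (ball_volume s)%:E * (diam U * (2^-1)%:E) ^+ s.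

Definition delta_cover (delta : R) (A : set 'rV[R]_n) :=
  [set U : (set 'rV[R]_n)^nat |
    (forall k, diam (U k) <= delta%:E) /\ A `<=` \bigcup_k U k].

Definition hausdorff_delta (s : nat) (delta : R) (A : set 'rV[R]_n) : \bar R :=
  ereal_inf
    [set \sum_(k <oo) hausdorff_gauge s (U k) | U in delta_cover delta A].

(* s-dimensional Hausdorff outer measure, normalized to agree with Lebesgue
   measure on s-dimensional affine subspaces. *)
Definition hausdorff (s : nat) (A : set 'rV[R]_n) : \bar R :=
  ereal_sup [set hausdorff_delta s delta A | delta in [set d : R | (0 < d)%R]].

Lemma ball_volume_ge0 s : (0 <= ball_volume s)%R.
Proof.
have [k] := ubnP s; elim: k s => // k IH [|[|s]] //= sk.
by rewrite !mulr_ge0 ?invr_ge0 ?pi_ge0 ?IH// -ltnS ltnW.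
Qed.

Lemma hausdorff_gauge_ge0 s U : 0 <= hausdorff_gauge s U.
Proof.
rewrite /hausdorff_gauge; case: ifPn => // /set0P[x Ux].
rewrite mule_ge0 ?lee_fin ?ball_volume_ge0// expe_ge0// mule_ge0 ?lee_fin//.
apply: (@le_trans _ _ (enorm (x - x))%:E); first by rewrite lee_fin sqrtr_ge0.
by apply: ereal_sup_ubound; exists x, x.
Qed.

Lemma hausdorff_gauge0 s : hausdorff_gauge s set0 = 0.
Proof. by rewrite /hausdorff_gauge eqxx. Qed.

Let capped s delta (U : set 'rV[R]_n) : \bar R :=
  if diam U <= delta%:E then hausdorff_gauge s U else +oo.

Let capped_ge0 s delta U : 0 <= capped s delta U.
Proof. by rewrite /capped; case: ifP => // _; exact: hausdorff_gauge_ge0. Qed.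

Let discr := g_sigma_algebraType [set: set 'rV[R]_n].

Let hausdorff_deltaE s delta :
  hausdorff_delta s delta = @mu_ext _ discr R (capped s delta).
Proof.
apply/funext => A; apply/eqP; rewrite eq_le; apply/andP; split.
- apply: le_ereal_inf_tmp => _ [U [_ AU] <-].
  have [dU|/existsNP[k /negP dUk]] :=
      pselect (forall k, diam (U k) <= delta%:E).
    apply: ereal_inf_lbound; exists U; first by split.
    by apply: eq_eseriesr => k _; rewrite /capped dU.
  rewrite (@eseries_pinfty _ _ _ k) ?leey//.
  + by move=> i _; rewrite gt_eqF// (lt_le_trans _ (capped_ge0 _ _ _)).
  + by rewrite /capped (negbTE dUk).
- apply: le_ereal_inf_tmp => _ [U [dU AU] <-].
  apply: ereal_inf_lbound; exists U.
    by split => // i; exact: sub_sigma_algebra.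
  by apply: eq_eseriesr => k _; rewrite /capped dU.
Qed.

Let diam_set0 : diam (set0 : set 'rV[R]_n) = -oo.
Proof.
rewrite /diam (_ : [set d | _] = set0) ?ereal_sup0//.
by rewrite -subset0 => d [x [y []]].
Qed.

Let capped0 s delta : capped s delta set0 = 0.
Proof. by rewrite /capped diam_set0 leNye hausdorff_gauge0. Qed.

Lemma hausdorff_delta_ge0 s delta A : 0 <= hausdorff_delta s delta A.
Proof. by rewrite hausdorff_deltaE mu_ext_ge0. Qed.

Lemma hausdorff_delta_le s (delta : R) A : (0 < delta)%R ->
  hausdorff_delta s delta A <= hausdorff s A.
Proof. by move=> d0; apply: ereal_sup_ubound; exists delta. Qed.

Lemma hausdorff_ge0 s A : 0 <= hausdorff s A.
Proof.
by apply: (le_trans (hausdorff_delta_ge0 s 1 A)); exact: hausdorff_delta_le.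
Qed.

Lemma hausdorff0 s : hausdorff s set0 = 0.
Proof.
apply/eqP; rewrite eq_le hausdorff_ge0 andbT.
apply: ge_ereal_sup => _ [d _ <-].
by rewrite hausdorff_deltaE mu_ext0.
Qed.

Lemma le_hausdorff s : {homo @hausdorff s : A B / A `<=` B >-> A <= B}.
Proof.
move=> A B AB; apply: ge_ereal_sup => _ [d d0 <-].
apply: le_trans (hausdorff_delta_le s B d0).
by rewrite hausdorff_deltaE; exact: le_mu_ext.
Qed.

Lemma hausdorff_sigma_subadditive s : sigma_subadditive (@hausdorff s).
Proof.
move=> A; apply: ge_ereal_sup => _ [d d0 <-].
apply: (@le_trans _ _ (\sum_(k <oo) hausdorff_delta s d (A k))).
  by rewrite hausdorff_deltaE; exact: mu_ext_sigma_subadditive.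
apply: lee_nneseries => k _; first by move=> *; exact: hausdorff_delta_ge0.
exact: hausdorff_delta_le.
Qed.

HB.instance Definition _ s := isOuterMeasure.Build R 'rV[R]_n (@hausdorff s)
  (hausdorff0 s) (hausdorff_ge0 s) (@le_hausdorff s)
  (@hausdorff_sigma_subadditive s).

(* Its restriction to the Caratheodory-measurable sets, which include the Borel
   sets. *)
Definition hausdorff_measure (s : nat) :
    set (caratheodory_type (@hausdorff s)) -> \bar R := @hausdorff s.

HB.instance Definition _ s := isMeasure.Build _ _ _ (@hausdorff_measure s)
  (@caratheodory_measure0 _ _ (@hausdorff s))
  (@caratheodory_measure_ge0 _ _ (@hausdorff s))
  (@caratheodory_measure_sigma_additive _ _ (@hausdorff s)).

End Hausdorff.

Arguments hausdorff_measure {R n} s _.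

Section Polytopes.
Context {R : realType} {n : nat}.
Implicit Types (K P : set 'rV[R]_n) (x u : 'rV[R]_n).

Definition conv_hull (V : set 'rV[R]_n) : set 'rV[R]_n :=
  smallest (@convex_set R 'rV[R]_n) V.

(* n-dimensional volume is n-dimensional Hausdorff measure. *)
Definition polytope P :=
  (exists2 V, finite_set V & P = conv_hull V) /\ (0 < hausdorff_measure n P)%E.

Definition boundary K : set 'rV[R]_n := closure K `\` interior K.

Definition outer_unit_normal K x u :=
  sphere R n u /\ forall y, K y -> dot y u <= dot x u.

Definition regular_boundary K : set 'rV[R]_n :=
  [set x | boundary K x /\ exists! u, outer_unit_normal K x u].

(* Only meaningful on [regular_boundary K]. *)
Definition gauss_map K x : 'rV[R]_n := xget 0 [set u | outer_unit_normal K x u].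

Definition surface_area_measure (p : R) K (omega : set 'rV[R]_n) : \bar R :=
  (\int[hausdorff_measure n.-1]_(x in
      regular_boundary K `&` gauss_map K @^-1` omega)
     ((dot x (gauss_map K x)) `^ (1 - p))%:E)%E.

End Polytopes.

Section SphereMeasures.
Context {R : realType} {n : nat}.
Implicit Types (mu : set 'rV[R]_n -> \bar R) (X : {vspace 'rV[R]_n}).

Definition discrete_measure mu :=
  exists (N : nat) (alpha : 'I_N -> R) (u : 'I_N -> 'rV[R]_n),
    [/\ forall k, 0 < alpha k,
        forall k, sphere R n (u k) &
        forall omega : set (borel R n), measurable omega ->
          mu omega = (\sum_(k < N) (alpha k)%:E * \d_(u k : borel R n) omega)%E].

Definition measure_support mu : set 'rV[R]_n :=
  [set u | sphere R n u /\
    forall U, open U -> U u -> (0 < mu (U `&` sphere R n))%E].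

Definition closed_hemisphere X (v : 'rV[R]_n) : set 'rV[R]_n :=
  [set x | [/\ x \in X, sphere R n x & 0 <= dot x v]].

Definition concentrated_on_hemisphere X (A : set 'rV[R]_n) :=
  exists v, [/\ v \in X, v != 0 & A `<=` closed_hemisphere X v].

Definition essential mu X :=
  (0 < \dim X < n)%N /\
  ~ concentrated_on_hemisphere X ([set x | x \in X] `&` measure_support mu).

Definition no_essential_subspace mu := forall X, ~ essential mu X.

End SphereMeasures.

(* Main.v *)
Require Import Defs.
From HB Require Import structures.
From mathcomp Require Import all_boot all_order all_algebra.
From mathcomp Require Import all_classical all_reals all_analysis.
From mathcomp Require Import measurable_realfun.
From mathcomp Require Import zify ring lra.

Set Implicit Arguments.
Unset Strict Implicit.
Unset Printing Implicit Defensive.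

Import Order.TTheory GRing.Theory Num.Theory.
Import numFieldNormedType.Exports.

Local Open Scope classical_set_scope.
Local Open Scope ring_scope.

(** Necessity.  A polytope with the origin in its interior is the set of [x]
    with [dot x (u k) <= h k] for the normals [u k] of its facets and their
    distances [h k > 0] from the origin ([polytope_facets]).  The Gauss map is
    constant on facets, so the surface area measure is a sum of positive
    multiples of the Dirac masses at the [u k] ([surface_area_polyhedron]).  As
    the polytope is bounded, the [u k] do not lie in a closed hemisphere
    ([polytope_support]).  The condition on essential subspaces only involves
    the support.

    Sufficiency.  Let [mu] have the atoms [u k] with weights [alpha k], in
    dimension [n].  Since the [u k] are not in a closed hemisphere, every
    polyhedron with these normals is bounded.  For positive support numbers [h]
    put [Phi h = \sum_k alpha k * h k `^ p].  As [p < 0], [Phi] is convex and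
    large when the origin is near the boundary, so among the translates of a
    body with interior points one minimises [Phi] ([Phi_translate_min]).  The
    minimal value times the power [- p / n] of the volume is invariant under
    dilations, and the body looked for is one that maximises this product.

    The maximum exists ([extremal_polytope]) because [mu] has no essential
    subspace.  Suppose that a polyhedron with normals [u k] has empty interior.
    The normals of the constraints that are active on all of it are then not
    contained in a closed hemisphere of their span: otherwise one could move
    away from these constraints and stay in the polyhedron.  Their span is
    therefore the whole space, and the polyhedron is a point
    ([nondegenerate_of_no_essential]).  Hence the bodies with more than one
    point, taken up to translation and dilation, have interior points and form
    a compact family, on which the product is upper semicontinuous.

    At a maximiser, shift the [k]-th facet outward by [t].  The volume grows at
    the rate [c] times the area of the facet, where [c] only depends on the
    normalisations of the two Hausdorff measures.  The convexity of [Phi] and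
    its criticality under translations at [h] bound the minimal value among the
    translates of the new body from below by
    [Phi h + p * t * (alpha k * h k `^ (p - 1))].  So the area of the [k]-th
    facet is proportional to [alpha k * h k `^ (p - 1)], with the same factor
    for all [k] ([euler_lagrange]), and since [n - p] is positive a dilation makes this
    factor equal to 1 ([minkowski_problem]).

    The volumes and areas are Hausdorff measures.  What has to be known about
    them is that Borel sets are measurable ([caratheodory_borel]), that cubes
    have positive and finite measure, and that the measure of a cylinder is
    proportional to its height and to the measure of its base
    ([hausdorff_cylinder]).  The last fact holds because, for a fixed height,
    both sides are translation-invariant measures of the base, and such measures
    are proportional on bounded open sets ([measure_ratio]). *)

(** * Euclidean geometry of row vectors *)

Lemma cvg_sumr {R : realType} {T I : Type} {F : set_system T} {FF : Filter F}
    (r : seq I) (P : pred I) (f : I -> T -> R) (l : I -> R) :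
  (forall i, P i -> f i x @[x --> F] --> l i) ->
  \sum_(i <- r | P i) f i x @[x --> F] --> \sum_(i <- r | P i) l i.
Proof. by move=> fl; apply: cvg_big => //; exact: add_continuous. Qed.

Lemma continuous_sumr {R : realType} {T : topologicalType} {I : Type}
    (r : seq I) (P : pred I) (f : I -> T -> R) (x : T) :
  (forall i, P i -> {for x, continuous (f i)}) ->
  {for x, continuous (fun y => \sum_(i <- r | P i) f i y)}.
Proof. exact: cvg_sumr. Qed.

Section EuclideanTheory.
Context {R : realType} {n : nat}.
Implicit Types x y z u : 'rV[R]_n.

Lemma dotC x y : dot x y = dot y x.
Proof. by apply: eq_bigr => i _; rewrite mulrC. Qed.

Lemma dotDl x y z : dot (x + y) z = dot x z + dot y z.
Proof. by rewrite -big_split; apply: eq_bigr => i _; rewrite mxE mulrDl. Qed.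

Lemma dotZl a x y : dot (a *: x) y = a * dot x y.
Proof. by rewrite mulr_sumr; apply: eq_bigr => i _; rewrite mxE mulrA. Qed.

Lemma dotDr x y z : dot z (x + y) = dot z x + dot z y.
Proof. by rewrite !(dotC z) dotDl. Qed.

Lemma dotZr a x y : dot x (a *: y) = a * dot x y.
Proof. by rewrite !(dotC x) dotZl. Qed.

Lemma dotNl x y : dot (- x) y = - dot x y.
Proof. by rewrite -scaleN1r dotZl mulN1r. Qed.

Lemma dotNr x y : dot x (- y) = - dot x y.
Proof. by rewrite !(dotC x) dotNl. Qed.

Lemma dotBl x y z : dot (x - y) z = dot x z - dot y z.
Proof. by rewrite dotDl dotNl. Qed.

Lemma dot0l x : dot 0 x = 0.
Proof. by rewrite -(scale0r 0) dotZl mul0r. Qed.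

Lemma dot0r x : dot x 0 = 0.
Proof. by rewrite dotC dot0l. Qed.

Definition dotE := (dotDl, dotDr, dotNl, dotNr, dotZl, dotZr, dot0l, dot0r).

Lemma dot_suml (I : Type) (r : seq I) (P : pred I) (F : I -> 'rV[R]_n) y :
  dot (\sum_(i <- r | P i) F i) y = \sum_(i <- r | P i) dot (F i) y.
Proof.
elim/big_rec2: _ => [|i a b _ <-]; first by rewrite dot0l.
by rewrite dotDl.
Qed.

Lemma dot_ge0 x : 0 <= dot x x.
Proof. by apply: sumr_ge0 => i _; rewrite -expr2 sqr_ge0. Qed.

Lemma dot_eq0 x : (dot x x == 0) = (x == 0).
Proof.
apply/idP/eqP => [|->]; last by rewrite dot0l.
rewrite psumr_eq0; last by move=> i _; rewrite -expr2 sqr_ge0.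
move=> /allP xx; apply/rowP => i; have := xx i (mem_index_enum i).
by rewrite mxE /= mulf_eq0 orbb => /eqP.
Qed.

Lemma dot_gt0 x : x != 0 -> 0 < dot x x.
Proof. by move=> x0; rewrite lt_neqAle dot_ge0 andbT eq_sym dot_eq0. Qed.

Lemma enorm_ge0 x : 0 <= enorm x. Proof. exact: sqrtr_ge0. Qed.

Lemma enorm_sqr x : enorm x ^+ 2 = dot x x.
Proof. by rewrite sqr_sqrtr// dot_ge0. Qed.

Lemma enorm0 : enorm (0 : 'rV[R]_n) = 0.
Proof. by rewrite /enorm dot0l sqrtr0. Qed.

Lemma enorm_eq0 x : (enorm x == 0) = (x == 0).
Proof. by rewrite -sqrf_eq0 enorm_sqr dot_eq0. Qed.

Lemma enorm_gt0 x : x != 0 -> 0 < enorm x.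
Proof. by move=> x0; rewrite lt_neqAle enorm_ge0 andbT eq_sym enorm_eq0. Qed.

Lemma enormZ a x : enorm (a *: x) = `|a| * enorm x.
Proof.
by rewrite /enorm !dotE mulrA -expr2 sqrtrM ?sqr_ge0// sqrtr_sqr.
Qed.

Lemma enormN x : enorm (- x) = enorm x.
Proof. by rewrite /enorm !dotE opprK. Qed.

Lemma enormB x y : enorm (x - y) = enorm (y - x).
Proof. by rewrite -enormN opprB. Qed.

Lemma dot_le_enorm x y : dot x y <= enorm x * enorm y.
Proof.
have [->|x0] := eqVneq x 0; first by rewrite dot0l enorm0 mul0r.
have [->|y0] := eqVneq y 0; first by rewrite dot0r enorm0 mulr0.
have := dot_ge0 (enorm y *: x - enorm x *: y).
rewrite !dotE -!enorm_sqr (dotC y x).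
have := enorm_gt0 x0; have := enorm_gt0 y0.
set a := enorm x; set b := enorm y; set c := dot x y => b0 a0 h.
have : 0 <= (a * b) * (a * b - c) by nra.
by rewrite pmulr_rge0 ?mulr_gt0// subr_ge0.
Qed.

Lemma norm_dot_le x y : `|dot x y| <= enorm x * enorm y.
Proof. by rewrite ler_norml dot_le_enorm lerNl -dotNl -(enormN x) dot_le_enorm. Qed.

Lemma enormD x y : enorm (x + y) <= enorm x + enorm y.
Proof.
rewrite -(@ler_pXn2r _ 2%N)// ?nnegrE ?addr_ge0 ?enorm_ge0//.
rewrite enorm_sqr !dotE -!enorm_sqr (dotC y x).
by have := dot_le_enorm x y; nra.
Qed.

Lemma enorm_triangle z x y : enorm (x - y) <= enorm (x - z) + enorm (z - y).
Proof. by rewrite -[x - y](subrKA z) enormD. Qed.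

Lemma norm_le_enorm x : `|x| <= enorm x.
Proof.
rewrite /Num.norm/= mx_normrE; apply: bigmax_le => [|[i j] _/=].
  exact: enorm_ge0.
rewrite ord1 -(@ler_pXn2r _ 2%N)// ?nnegrE ?enorm_ge0//.
rewrite enorm_sqr real_normK ?num_real// /dot (bigD1 j)//= -expr2 lerDl.
by apply: sumr_ge0 => k _; rewrite -expr2 sqr_ge0.
Qed.

Lemma coord_le_norm x i : `|x 0 i| <= `|x|.
Proof.
by rewrite [leRHS]/Num.norm/= mx_normrE; apply: (le_bigmax _ _ (0, i)).
Qed.

Lemma norm_le_coord x (c : R) : 0 <= c -> (forall i, `|x 0 i| <= c) -> `|x| <= c.
Proof.
move=> c0 xc; rewrite /Num.norm/= mx_normrE; apply: bigmax_le => // -[i j] _/=.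
by rewrite ord1.
Qed.

Lemma enorm_le_norm x : enorm x <= n%:R * `|x|.
Proof.
rewrite -(@ler_pXn2r _ 2%N)// ?nnegrE ?enorm_ge0 ?mulr_ge0//.
rewrite enorm_sqr; apply: (@le_trans _ _ (\sum_(i < n) `|x| ^+ 2)).
  apply: ler_sum => i _; rewrite -expr2 -[leLHS]real_normK ?num_real//.
  by rewrite ler_pXn2r// ?nnegrE// coord_le_norm.
rewrite sumr_const card_ord exprMn -[leLHS]mulr_natl ler_wpM2r ?sqr_ge0//.
by rewrite -natrX ler_nat; case: (n) => // m; rewrite expnS leq_pmulr// expn1.
Qed.

Lemma coord_le_enorm x i : `|x 0 i| <= enorm x.
Proof. exact: le_trans (coord_le_norm _ _) (norm_le_enorm _). Qed.

Lemma dot_continuous u : continuous (dot^~ u : 'rV[R]_n -> R).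
Proof.
move=> x; apply: continuous_sumr => i _.
apply: (@continuousM R _ (fun x : 'rV[R]_n => x 0 i) (cst (u 0 i))).
  exact: (@coord_continuous R 1 n 0 i).
exact: cst_continuous.
Qed.

Lemma closed_dot_le u (c : R) : closed [set x | dot x u <= c].
Proof.
rewrite (_ : [set x | _] = dot^~ u @^-1` [set t | t <= c])//.
by apply: preimage_closed (@closed_le _ _) => x _; exact: dot_continuous.
Qed.

Lemma open_dot_lt u (c : R) : open [set x | dot x u < c].
Proof.
rewrite (_ : [set x | _] = dot^~ u @^-1` [set t | t < c])//.
by apply: open_comp (@open_lt _ _) => x _; exact: dot_continuous.
Qed.

Lemma enorm_continuous : continuous (@enorm R n).
Proof.
move=> x; apply: (@continuous_comp _ _ _ (fun x => dot x x) Num.sqrt).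
  apply: continuous_sumr => i _.
  by apply: (@continuousM R _ (fun x : 'rV[R]_n => x 0 i) (fun x => x 0 i));
    exact: (@coord_continuous R 1 n 0 i).
exact: sqrt_continuous.
Qed.

Lemma closed_enorm_le (c : R) : closed [set x : 'rV[R]_n | enorm x <= c].
Proof.
rewrite (_ : [set x | _] = @enorm R n @^-1` [set t | t <= c])//.
by apply: preimage_closed (@closed_le _ _) => x _; exact: enorm_continuous.
Qed.

Lemma nbhs_enorm x (A : set 'rV[R]_n) :
  nbhs x A <-> exists2 e, 0 < e & forall y, enorm (y - x) < e -> A y.
Proof.
split=> [/nbhs_ballP[e /= e0 xA]|[e e0 xA]].
  exists e => // y yx; apply: xA; rewrite -ball_normE /=.
  by rewrite (le_lt_trans (norm_le_enorm _))// enormB.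
apply/nbhs_ballP; exists (e / n.+1%:R); first by rewrite /= divr_gt0.
move=> y; rewrite -ball_normE /= distrC ltr_pdivlMr// => yx; apply: xA.
rewrite (le_lt_trans (enorm_le_norm _))// (le_lt_trans _ yx)// mulrC.
by rewrite ler_wpM2l// ler_nat.
Qed.

Lemma compact_enorm (A : set 'rV[R]_n) (c : R) :
  closed A -> (forall x, A x -> enorm x <= c) -> compact A.
Proof.
move=> clA bA; apply: bounded_closed_compact => //.
exists c; split; first exact: num_real.
move=> d cd x Ax; apply: le_trans (norm_le_enorm x) _.
by apply: le_trans (bA x Ax) _; exact: ltW.
Qed.

End EuclideanTheory.

(** * Hausdorff measure: Lipschitz images and Borel sets *)

Section HausdorffTheory.
Context {R : realType}.
Local Open Scope ereal_scope.

Lemma diam_ge {n} (U : set 'rV[R]_n) x y :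
  U x -> U y -> (enorm (x - y))%:E <= diam U.
Proof. by move=> Ux Uy; apply: ereal_sup_ubound; exists x, y. Qed.

Lemma diam_le {n} (U : set 'rV[R]_n) (c : \bar R) :
  (forall x y, U x -> U y -> (enorm (x - y))%:E <= c) -> diam U <= c.
Proof. by move=> Uc; apply: ge_ereal_sup => _ [x [y [Ux Uy ->]]]; exact: Uc. Qed.

Lemma le_diam {n} (U V : set 'rV[R]_n) : U `<=` V -> diam U <= diam V.
Proof. by move=> UV; apply: diam_le => x y /UV Vx /UV Vy; exact: diam_ge. Qed.

Lemma diam_ge0 {n} (U : set 'rV[R]_n) : U !=set0 -> 0 <= diam U.
Proof.
by case=> x Ux; apply: le_trans (diam_ge Ux Ux); rewrite lee_fin enorm_ge0.
Qed.

Lemma diam0 {n} : diam (set0 : set 'rV[R]_n) = -oo.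
Proof. by apply/eqP; rewrite -leeNy_eq; apply: diam_le. Qed.

Lemma gaugeE {n} s (U : set 'rV[R]_n) (D : R) : U !=set0 -> diam U = D%:E ->
  hausdorff_gauge s U = (ball_volume s * (D / 2) ^+ s)%:E.
Proof.
move=> /set0P U0 UD; rewrite /hausdorff_gauge (negbTE U0) UD.
by rewrite -EFinM -EFin_expe -EFinM.
Qed.

Lemma diam_fin {n} (U : set 'rV[R]_n) (D : R) : U !=set0 -> diam U <= D%:E ->
  exists d, [/\ diam U = d%:E, (0 <= d)%R & (d <= D)%R].
Proof.
move=> U0 UD; have d0 := diam_ge0 U0.
have /fineK dE : diam U \is a fin_num.
  by rewrite ge0_fin_numE// (le_lt_trans UD)// ltry.
by exists (fine (diam U)); rewrite -!lee_fin dE.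
Qed.

Lemma gauge_le {n} s (U : set 'rV[R]_n) (D : R) : (0 <= D)%R ->
  diam U <= D%:E -> hausdorff_gauge s U <= (ball_volume s * (D / 2) ^+ s)%:E.
Proof.
move=> D0 UD; have [->|/set0P U0] := eqVneq U set0.
  rewrite hausdorff_gauge0 lee_fin mulr_ge0 ?ball_volume_ge0//.
  by rewrite exprn_ge0// divr_ge0.
have [d [dE d0 dD]] := diam_fin U0 UD.
rewrite (gaugeE _ U0 dE) lee_fin ler_wpM2l ?ball_volume_ge0//.
by rewrite lerXn2r ?nnegrE ?divr_ge0// ler_pM2r.
Qed.

Lemma le_gauge {n} s (U V : set 'rV[R]_n) (D : R) : diam V <= D%:E ->
  U `<=` V -> hausdorff_gauge s U <= hausdorff_gauge s V.
Proof.
move=> VD UV; have [->|/set0P U0] := eqVneq U set0.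
  by rewrite hausdorff_gauge0 hausdorff_gauge_ge0.
have V0 : V !=set0 by case: U0 => x /UV; exists x.
have [d [dE d0 dD]] := diam_fin V0 VD.
by rewrite (gaugeE _ V0 dE); apply: gauge_le => //; rewrite -dE le_diam.
Qed.

Lemma hausdorff_delta_le_cover {n} s (d : R) (A : set 'rV[R]_n)
    (U : (set 'rV[R]_n)^nat) :
  (forall k, diam (U k) <= d%:E) -> A `<=` \bigcup_k U k ->
  hausdorff_delta s d A <= \sum_(k <oo) hausdorff_gauge s (U k).
Proof. by move=> Ud AU; apply: ereal_inf_lbound; exists U. Qed.

Lemma hausdorff_delta_anti {n} s (d e : R) (A : set 'rV[R]_n) : (d <= e)%R ->
  hausdorff_delta s e A <= hausdorff_delta s d A.
Proof.
move=> de; apply: le_ereal_inf_tmp => _ [U [Ud AU] <-].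
by apply: hausdorff_delta_le_cover => // k; rewrite (le_trans (Ud k))// lee_fin.
Qed.

Lemma diam_image {a b} (f : 'rV[R]_a -> 'rV[R]_b) (L D : R) U :
  (0 < L)%R -> (forall x y, U x -> U y -> (enorm (f x - f y) <= L * enorm (x - y))%R) ->
  diam U <= D%:E -> diam (f @` U) <= (L * D)%:E.
Proof.
move=> L0 fL UD; apply: diam_le => _ _ [x Ux <-] [y Uy <-].
rewrite lee_fin (le_trans (fL _ _ Ux Uy))// ler_pM2l//.
by rewrite -lee_fin (le_trans (diam_ge Ux Uy)).
Qed.

(** The images of the pieces of a covering of [A] cover [f @` A], and their
    diameters grow by the factor [L] at most. *)
Lemma hausdorff_lipschitz {a b} s (f : 'rV[R]_a -> 'rV[R]_b) (L : R) A :
  (0 < L)%R ->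
  (forall x y, A x -> A y -> (enorm (f x - f y) <= L * enorm (x - y))%R) ->
  hausdorff s (f @` A) <= (L ^+ s)%:E * hausdorff s A.
Proof.
move=> L0 fL; apply: ge_ereal_sup => _ [d /= d0 <-].
have Ls : (0 < L ^+ s)%R by rewrite exprn_gt0.
rewrite -lee_pdivrMl//.
apply: le_trans (hausdorff_delta_le s A (divr_gt0 d0 L0)).
apply: le_ereal_inf_tmp => _ [U [Ud AU] <-].
rewrite lee_pdivrMl// -nneseriesZl; last by move=> *; exact: hausdorff_gauge_ge0.
have AUd k : diam (U k `&` A) <= (d / L)%:E.
  by apply: le_trans (Ud k); apply: le_diam => x [].
apply: le_trans (_ : _ <= \sum_(k <oo) hausdorff_gauge s (f @` (U k `&` A))) _.
  apply: hausdorff_delta_le_cover => [k|_ [x Ax <-]].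
    rewrite -[d in d%:E](divfK (lt0r_neq0 L0)) mulrC.
    by apply: diam_image => // x y [_ Ax] [_ Ay]; exact: fL.
  by have [k _ Ukx] := AU _ Ax; exists k => //; exists x.
apply: lee_nneseries => [*|k _]; first exact: hausdorff_gauge_ge0.
have [->|/set0P U0] := eqVneq (U k `&` A) set0.
  rewrite image_set0 hausdorff_gauge0; apply: mule_ge0.
    by rewrite lee_fin ltW.
  exact: hausdorff_gauge_ge0.
apply: le_trans (_ : _ <= (L ^+ s)%:E * hausdorff_gauge s (U k `&` A)) _; last first.
  by rewrite lee_pmul2l//; apply: le_gauge (Ud k) _ => x [].
have [D [DE D0 _]] := diam_fin U0 (AUd k).
rewrite (gaugeE _ U0 DE) -EFinM mulrCA -exprMn mulrA.
apply: gauge_le; first by rewrite mulr_ge0// ltW.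
by apply: diam_image; rewrite ?DE// => x y [_ Ax] [_ Ay]; exact: fL.
Qed.

(** A set of diameter less than [e] cannot meet both [A] and [B], so a fine
    covering of the union splits into coverings of its two parts. *)
Lemma hausdorff_separated {n} s (A B : set 'rV[R]_n) (e : R) : (0 < e)%R ->
  (forall x y, A x -> B y -> (e <= enorm (x - y))%R) ->
  hausdorff s A + hausdorff s B <= hausdorff s (A `|` B).
Proof.
move=> e0 ABe.
suff H (d1 d2 : R) : (0 < d1)%R -> (0 < d2)%R ->
    hausdorff_delta s d1 A + hausdorff_delta s d2 B <= hausdorff s (A `|` B).
  have [->|Hfin] := eqVneq (hausdorff s (A `|` B)) +oo; first exact: leey.
  have ffin (C : set 'rV[R]_n) : C `<=` A `|` B -> hausdorff s C \is a fin_num.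
    move=> CAB; rewrite ge0_fin_numE ?hausdorff_ge0//.
    by rewrite (le_lt_trans (le_hausdorff s CAB))// ltey.
  have fB := ffin B (@subsetUr _ _ _).
  rewrite -leeBrDr//; apply: ge_ereal_sup => _ [d1 /= d10 <-].
  have fdA : hausdorff_delta s d1 A \is a fin_num.
    rewrite ge0_fin_numE ?hausdorff_delta_ge0// (le_lt_trans (hausdorff_delta_le s A d10))//.
    by rewrite -ge0_fin_numE ?hausdorff_ge0// ffin//; exact: subsetUl.
  rewrite leeBrDr// addeC -leeBrDr//; apply: ge_ereal_sup => _ [d2 /= d20 <-].
  by rewrite leeBrDr// addeC H.
move=> d10 d20; pose d := Num.min (Num.min d1 d2) (e / 2)%R.
have d0 : (0 < d)%R by rewrite !lt_min d10 d20 divr_gt0.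
apply: le_trans (hausdorff_delta_le s _ d0).
apply: (@le_trans _ _ (hausdorff_delta s d A + hausdorff_delta s d B)).
  by apply: leeD; apply: hausdorff_delta_anti; rewrite !ge_min lexx ?orbT.
apply: le_ereal_inf_tmp => _ [U [Ud ABU] <-].
pose UA k := if pselect (U k `&` A !=set0) is left _ then U k else set0.
pose UB k := if pselect (U k `&` A !=set0) is left _ then set0 else U k.
apply: (@le_trans _ _ (\sum_(k <oo) hausdorff_gauge s (UA k) +
                       \sum_(k <oo) hausdorff_gauge s (UB k))).
  apply: leeD; apply: hausdorff_delta_le_cover.
  - by move=> k; rewrite /UA; case: pselect => // _; rewrite diam0 leNye.
  - move=> x Ax; have [k _ Ukx] := ABU _ (or_introl Ax); exists k => //.
    by rewrite /UA; case: pselect => // -[]; exists x.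
  - by move=> k; rewrite /UB; case: pselect => // _; rewrite diam0 leNye.
  - move=> x Bx; have [k _ Ukx] := ABU _ (or_intror Bx); exists k => //.
    rewrite /UB; case: pselect => // -[y [Uky Ay]].
    have := le_trans (diam_ge Uky Ukx) (Ud k); rewrite lee_fin => yxd.
    have := le_trans (ABe _ _ Ay Bx) yxd; rewrite /d leNgt => /negP[].
    by rewrite gt_min ltr_pdivrMr// ltr_pMr// ltr1n orbT.
rewrite -nneseriesD; [|by move=> *; exact: hausdorff_gauge_ge0..].
apply: lee_nneseries => [k _ _|k _]; first by rewrite adde_ge0// hausdorff_gauge_ge0.
by rewrite /UA /UB; case: pselect => _; rewrite hausdorff_gauge0 ?adde0 ?add0e.
Qed.

End HausdorffTheory.

Section Caratheodory.
Context {R : realType} {n : nat}.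
Local Open Scope ereal_scope.
Variable s : nat.
Implicit Types A B X : set 'rV[R]_n.

Section Sublevel.
Variables (f : 'rV[R]_n -> R) (c : R) (X : set 'rV[R]_n).
Hypothesis f_lip : forall x y, (`|f x - f y| <= enorm (x - y))%R.
Hypothesis X_fin : hausdorff s X < +oo.

Let phi (t : R) := hausdorff s (X `&` [set x | (f x < t)%R]).

Let fin A : A `<=` X -> hausdorff s A \is a fin_num.
Proof.
move=> AX; rewrite ge0_fin_numE ?hausdorff_ge0//.
exact: le_lt_trans (le_hausdorff s AX) X_fin.
Qed.

Let phi_fin t : phi t \is a fin_num.
Proof. by apply: fin => x []. Qed.

Let r (t : R) := fine (phi t).

Let separated (t t' : R) A B : (t < t')%R -> A `<=` X -> B `<=` X ->
  (forall x, A x -> (f x < t)%R) -> (forall x, B x -> (t' <= f x)%R) ->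
  hausdorff s A + hausdorff s B <= hausdorff s (A `|` B).
Proof.
move=> tt' AX BX At Bt; apply: (@hausdorff_separated _ _ _ _ _ (t' - t)%R).
  by rewrite subr_gt0.
move=> x y /At xt /Bt yt; apply: le_trans (f_lip x y).
by rewrite ler0_norm; lra.
Qed.

Let r_homo : {homo r : t t' / (t <= t')%R}.
Proof.
move=> t t' tt'; apply: fine_le; rewrite ?phi_fin//.
by apply: le_hausdorff => x [Xx /= xt]; split=> //=; exact: lt_le_trans tt'.
Qed.

Let sup_r : has_sup [set r t | t in [set t | t < c]%R].
Proof.
split; first by exists (r (c - 1)); exists (c - 1)%R => //=; rewrite ltrBlDr ltrDl.
exists (r c) => _ [t /= tc <-]; exact/r_homo/ltW.
Qed.

Let shell t t' := X `&` [set x | (t <= f x < t')%R].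

(** The shell from [t2] to [t3] is at positive distance from the part below
    [t1]; summed over consecutive levels, these bounds telescope. *)
Let shell_step (t1 t2 t3 : R) : (t1 < t2)%R -> (t2 <= t3)%R ->
  hausdorff s (shell t2 t3) <= (r t3 - r t1)%:E.
Proof.
move=> t12 t23; rewrite EFinB !fineK ?phi_fin// leeBrDr ?phi_fin// addeC.
have := @separated t1 t2 (X `&` [set x | (f x < t1)%R]) (shell t2 t3) t12.
move=> /(_ _ _ _ _)/le_trans; apply=> //; try by move=> x [].
  by move=> x [_ /andP[]].
apply: le_hausdorff => x [[Xx /= xt]|[Xx /andP[_ xt]]]; split=> //=.
by apply: lt_trans xt _; exact: lt_le_trans t23.
Qed.

Let shell_small (e : R) : (0 < e)%R ->
  exists2 t, (t < c)%R & hausdorff s (shell t c) <= e%:E.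
Proof.
(* With [r t0] within [e / 4] of the supremum [L] the telescoped sum, at most
   [2 * (L - r t0)], does not exceed [e]. *)
move=> e0; have [_ [t0 /= t0c <-] rt0] := sup_adherent (divr_gt0 e0 (ltr0Sn R 3)) sup_r.
set L := sup _ in rt0; pose t j : R := (c - (c - t0) / j.+1%:R)%R.
have ct0 : (0 < c - t0)%R by rewrite subr_gt0.
have t_lt j : (t j < t j.+1)%R.
  rewrite /t ltrD2l ltrN2 ltr_pM2l// ltf_pV2 ?posrE// ltr_nat//.
have tc j : (t j < c)%R by rewrite /t ltrBlDr ltrDl divr_gt0.
have rL j : (r (t j) <= L)%R.
  by apply: (sup_upper_bound sup_r); apply: (@imageP _ _ r); exact: tc.
exists (t 1%N) => //.
have -> : shell (t 1%N) c = \bigcup_j shell (t j.+1) (t j.+2).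
  apply/seteqP; split=> [x [Xx /andP[tx xc]]|x [j _ [Xx /andP[tx xc]]]]; last first.
    split=> //; apply/andP; split; last exact: lt_trans xc (tc _).
    apply: le_trans tx; elim: j {xc} => // j IH; apply: le_trans IH _; exact/ltW/t_lt.
  have xc0 : (0 < c - f x)%R by rewrite subr_gt0.
  have : exists j, (f x < t j)%R.
    have := archi_boundP (ltW (divr_gt0 ct0 xc0)); set j := Num.bound _ => jx.
    exists j; rewrite /t ltrBrDl -ltrBrDr ltr_pdivrMr// mulrC -ltr_pdivrMr//.
    by rewrite (lt_le_trans jx)// ler_nat.
  move=> /ex_minnP[[|[|j]] xj jmin].
  - by have := lt_trans (t_lt 0%N) (le_lt_trans tx xj); rewrite ltxx.
  - by have := le_lt_trans tx xj; rewrite ltxx.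
  - exists j => //; split=> //; apply/andP; split=> //.
    by rewrite leNgt; apply/negP => /jmin; rewrite ltnn.
apply: le_trans (hausdorff_sigma_subadditive s _) _.
apply: lime_le; first by apply: is_cvg_nneseries => *; exact: hausdorff_ge0.
near=> m; apply: (@le_trans _ _ (r (t m.+1) + r (t m) - r (t 1%N) - r (t 0%N))%:E).
  elim: (m) => [|k IH].
    by rewrite big_geq// lee_fin; lra.
  rewrite big_nat_recr//=; apply: le_trans (leeD IH (shell_step (t_lt k) (ltW (t_lt k.+1)))) _.
  by rewrite -EFinD lee_fin; lra.
rewrite lee_fin; have := rL m.+1; have := rL m.
have : (r (t 0%N) <= r (t 1%N))%R by apply/r_homo/ltW.
have -> : t 0%N = t0 by rewrite /t divr1; ring.
by lra.
Unshelve. all: by end_near. Qed.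

Lemma caratheodory_split_sublevel :
  hausdorff s (X `&` [set x | (f x < c)%R]) +
  hausdorff s (X `&` ~` [set x | (f x < c)%R]) <= hausdorff s X.
Proof.
apply/lee_addgt0Pr => e e0; have [t tc te] := shell_small e0.
apply: (@le_trans _ _ (phi t + hausdorff s (shell t c) +
    hausdorff s (X `&` ~` [set x | (f x < c)%R]))).
  apply: leeD => //; apply: le_trans (outer_measureU2 _ _ _).
  apply: le_hausdorff => x [Xx /= xc]; have [xt|xt] := ltP (f x) t; [left|right] => //.
  by split=> //=; rewrite xt.
rewrite addeAC; apply: leeD => //.
apply: le_trans (_ : _ <= hausdorff s ((X `&` [set x | (f x < t)%R]) `|`
    (X `&` ~` [set x | (f x < c)%R]))) _; last by apply: le_hausdorff => x [[]|[]].
apply: (@separated t c) => //; try by move=> x [].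
by move=> x [_ /negP]; rewrite -leNgt.
Qed.

End Sublevel.

(** Carathéodory's criterion, for sublevel sets of 1-Lipschitz functions: the
    part of the test set just below the level has small measure. *)
Lemma caratheodory_sublevel (f : 'rV[R]_n -> R) (c : R) :
  (forall x y, (`|f x - f y| <= enorm (x - y))%R) ->
  measurable ([set x | (f x < c)%R] : set (caratheodory_type (@hausdorff R n s))).
Proof.
move=> f_lip; apply: le_caratheodory_measurable => X /=.
have [Xfin|] := ltP (hausdorff s X) +oo; first exact: caratheodory_split_sublevel.
by rewrite leye_eq => /eqP ->; rewrite leey.
Qed.

(** An open set is a sublevel set of minus the distance to its complement. *)
Lemma caratheodory_open (U : set 'rV[R]_n) : open U ->
  measurable (U : set (caratheodory_type (@hausdorff R n s))).
Proof.
move=> oU; have [->|/setTPn[z nUz]] := eqVneq U setT; first exact: measurableT.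
pose D x := [set enorm (x - y) | y in ~` U].
have D_inf x : has_inf (D x).
  split; first by exists (enorm (x - z)), z.
  by exists 0%R => _ [y _ <-]; exact: enorm_ge0.
have D_le x y : (inf (D x) <= inf (D y) + enorm (x - y))%R.
  rewrite -lerBlDr; apply: lb_le_inf; first by exists (enorm (y - z)), z.
  move=> _ [w Uw <-]; rewrite lerBlDr.
  apply: le_trans (_ : enorm (x - w) <= _)%R; last first.
    by rewrite [leRHS]addrC; exact: enorm_triangle.
  by apply: ge_inf; [case: (D_inf x)|exists w].
rewrite (_ : U = [set x | (- inf (D x) < 0)%R]).
  apply: caratheodory_sublevel => x y; rewrite ler_norml.
  have := D_le x y; have := D_le y x; rewrite (enormB y x) => h1 h2.
  by apply/andP; split; lra.
apply/seteqP; split=> x /=; rewrite oppr_lt0.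
  move=> Ux; have /nbhs_enorm[e e0 xU] : nbhs x U by exact: open_nbhs_nbhs.
  apply: lt_le_trans e0 _; apply: lb_le_inf; first by exists (enorm (x - z)), z.
  move=> _ [y nUy <-]; rewrite leNgt; apply/negP => yx; apply: nUy; apply: xU.
  by rewrite enormB.
move=> D0; apply: contrapT => nUx; move: D0; rewrite ltNge => /negP; apply.
by apply: ge_inf; [case: (D_inf x)|exists x => //; rewrite subrr enorm0].
Qed.

Lemma caratheodory_borel (A : set (borel R n)) : measurable A ->
  measurable (A : set (caratheodory_type (@hausdorff R n s))).
Proof.
move=> mA.
apply: (@smallest_sub _ (sigma_algebra [set: 'rV[R]_n]) open
  (@measurable _ (caratheodory_type (@hausdorff R n s)))) mA.
  exact: sigma_algebra_measurable.
exact: caratheodory_open.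
Qed.

End Caratheodory.

(** * Hausdorff measure is positive and finite on cubes *)

Section RowCons.
Context {R : realType} {d : nat}.
Implicit Types (t : R) (y : 'rV[R]_d) (x : 'rV[R]_d.+1).

Definition row_cons t y : 'rV[R]_d.+1 :=
  \row_i (if unlift ord0 i is Some j then y 0 j else t).

Definition row_tail x : 'rV[R]_d := \row_j x 0 (lift ord0 j).

Lemma row_cons0 t y : row_cons t y 0 ord0 = t.
Proof. by rewrite mxE unlift_none. Qed.

Lemma row_consS t y j : row_cons t y 0 (lift ord0 j) = y 0 j.
Proof. by rewrite mxE liftK. Qed.

Lemma row_tailE t y : row_tail (row_cons t y) = y.
Proof. by apply/rowP => j; rewrite mxE row_consS. Qed.

Lemma row_consE x : row_cons (x 0 ord0) (row_tail x) = x.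
Proof.
apply/rowP => i; have [j ->|->] := unliftP ord0 i; last by rewrite row_cons0.
by rewrite row_consS mxE.
Qed.

Lemma dot_row_cons t y t' y' :
  dot (row_cons t y) (row_cons t' y') = t * t' + dot y y'.
Proof.
rewrite /dot big_ord_recl !row_cons0; congr (_ + _).
by apply: eq_bigr => j _; rewrite !row_consS.
Qed.

Lemma row_consB t y t' y' :
  row_cons t y - row_cons t' y' = row_cons (t - t') (y - y').
Proof.
apply/rowP => i; have [j ->|->] := unliftP ord0 i.
  by rewrite !mxE !liftK !mxE.
by rewrite !mxE !unlift_none.
Qed.

Lemma enorm_row_tail x x' : enorm (row_tail x - row_tail x') <= enorm (x - x').
Proof.
rewrite -(row_consE x) -(row_consE x') row_consB !row_tailE.
rewrite -(@ler_pXn2r _ 2%N)// ?nnegrE ?enorm_ge0// !enorm_sqr dot_row_cons.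
by rewrite lerDr -expr2 sqr_ge0.
Qed.

Lemma enorm_row_cons t y y' :
  enorm (row_cons t y - row_cons t y') = enorm (y - y').
Proof. by rewrite /enorm row_consB dot_row_cons subrr mul0r add0r. Qed.

Lemma row_tail_continuous : continuous row_tail.
Proof.
move=> x A /nbhs_enorm[e e0 xA]; apply/nbhs_enorm; exists e => // y yx.
by apply: xA; exact: le_lt_trans (enorm_row_tail _ _) yx.
Qed.

End RowCons.

Definition unit_cube (R : realType) (s : nat) : set 'rV[R]_s :=
  [set x | forall i, 0 <= x 0 i <= 1].
Arguments unit_cube : clear implicits.

Section CubePositive.
Context {R : realType}.
Local Open Scope ereal_scope.

(** Slice along the first coordinate: each slice of the cube is covered by the
    slices of the covering sets, so integrating the inequality in dimension
    [s] over that coordinate gives the one in dimension [s.+1].  A set whose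
    coordinates vary by at most [d k] projects into an interval of length
    [2 * d k] around any of its points. *)
Lemma unit_cube_cover s (U : (set 'rV[R]_s)^nat) (d : R^nat) :
  (forall k, 0 <= d k)%R ->
  (forall k x y, U k x -> U k y -> forall i, (`|x 0 i - y 0 i| <= d k)%R) ->
  unit_cube R s `<=` \bigcup_k U k ->
  1 <= \sum_(k <oo) (if U k == set0 then 0 else ((2 * d k) ^+ s)%:E).
Proof.
elim: s U => [|s IH] U d0 Ud cU.
  have [k _ Uk] : (\bigcup_k U k) 0%R by apply: cU => -[].
  apply: le_trans (nneseries_lim_ge k.+1 _) => [|m _ _]; last by case: ifP.
  rewrite big_nat_recr//= ifF; last by apply/eqP => Uk0; rewrite Uk0 in Uk.
  rewrite expr0 leeDr//; apply: sume_ge0 => m _; by case: ifP.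
pose V k t := [set y | U k (row_cons t y)].
have [p pU] : exists p : nat -> 'rV[R]_s.+1, forall k, U k !=set0 -> U k (p k).
  have : forall k, exists x, U k !=set0 -> U k x.
    move=> k; have [[x Ux]|nU] := pselect (U k !=set0); first by exists x.
    by exists 0%R.
  by move=> /(@choice _ _ (fun k x => U k !=set0 -> U k x))[p pU]; exists p.
pose I k : set (measurableTypeR R) := `[(p k 0 ord0 - d k)%R, (p k 0 ord0 + d k)%R]%classic.
pose c k := (if U k == set0 then 0 else (2 * d k) ^+ s)%R.
have c0 k : (0 <= c k)%R by rewrite /c; case: ifP => // _; rewrite exprn_ge0// mulr_ge0.
pose f k (t : measurableTypeR R) := (c k)%:E * (\1_(I k) t)%:E.
have f0 k t : 0 <= f k t by rewrite mule_ge0// lee_fin// indicE.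
have mI k : measurable (I k) by exact: measurable_itv.
pose D : set (measurableTypeR R) := `[0%R, 1%R]%classic.
have mD : measurable D by exact: measurable_itv.
have mf k : measurable_fun D (f k).
  apply/measurable_funeM/measurable_EFinP; exact: measurable_indic.
have f1 t : D t -> 1 <= \sum_(k <oo) f k t.
  rewrite /D /= in_itv/= => t01.
  have Vd k x y : V k t x -> V k t y -> forall i, (`|x 0 i - y 0 i| <= d k)%R.
    by move=> Ux Uy i; have := Ud k _ _ Ux Uy (lift ord0 i); rewrite !row_consS.
  have cV : unit_cube R s `<=` \bigcup_k V k t.
    move=> y cy; have [|k _ Uk] := cU (row_cons t y); last by exists k.
    move=> i; have [j ->|->] := unliftP ord0 i; last by rewrite row_cons0.
    by rewrite row_consS.
  apply: le_trans (IH (V ^~ t) d0 Vd cV) _.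
  apply: lee_nneseries => [k _ _|k _].
    by case: ifP => // _; rewrite lee_fin exprn_ge0// mulr_ge0.
  have [_|/set0P[y Vy]] := eqVneq (V k t) set0; first exact: f0.
  have Uk0 : U k !=set0 by exists (row_cons t y).
  rewrite /f /c ifF; last by apply/negbTE/set0P.
  have It : I k t.
    rewrite /I /= in_itv/= -ler_distl.
    by have := Ud k _ _ Vy (pU k Uk0) ord0; rewrite row_cons0.
  by rewrite indicE (mem_set It) mule1.
have -> : 1 = \int[lebesgue_measure]_(x in D) (cst 1 x) :> \bar R.
  rewrite integral_cst// mul1e.
  have := @lebesgue_measure_itv R `[0%R, 1%R].
  by rewrite /= lte_fin ltr01 -EFinD subr0.
apply: (@le_trans _ _ (\int[lebesgue_measure]_(x in D)
    \sum_(k <oo) f k x)).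
  apply: ge0_le_integral => //.
  exact: ge0_emeasurable_sum.
rewrite integral_nneseries//; apply: lee_nneseries => [k _ _|k _].
  by apply: integral_ge0.
have mIk : measurable_fun D (fun x => (\1_(I k) x : R)%:E).
  by apply/measurable_EFinP; exact: measurable_indic.
rewrite /f ge0_integralZl_EFin//.
rewrite integral_indic//; have [Uk|Uk] := eqVneq (U k) set0.
  by rewrite /c Uk eqxx mul0e.
rewrite /c (negbTE Uk) exprSr EFinM; apply: lee_wpmul2l.
  by rewrite lee_fin exprn_ge0// mulr_ge0.
apply: (@le_trans _ _ (lebesgue_measure (I k))).
  by apply: le_measure; rewrite ?inE//; exact: measurableI.
have -> := @lebesgue_measure_itv R `[(p k 0 ord0 - d k)%R, (p k 0 ord0 + d k)%R].
rewrite /=; case: ifP => _; last by rewrite lee_fin mulr_ge0.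
by rewrite -EFinD lee_fin; lra.
Qed.

Lemma ball_volume_gt0 s : (0 < ball_volume s :> R)%R.
Proof.
have [k] := ubnP s; elim: k s => // k IH [|[|s]] //= sk.
by rewrite !mulr_gt0 ?invr_gt0 ?pi_gt0 ?IH// -ltnS ltnW.
Qed.

Lemma hausdorff_unit_cube_gt0 s : 0 < hausdorff s (unit_cube R s).
Proof.
(* The gauge of a set of diameter [d] is [(2 * d) ^+ s] times this constant. *)
apply: (@lt_le_trans _ _ (ball_volume s / 4 ^+ s)%:E).
  by rewrite lte_fin divr_gt0 ?ball_volume_gt0// exprn_gt0.
apply: le_trans (hausdorff_delta_le s _ ltr01).
apply: le_ereal_inf_tmp => _ [U [Ud cU] <-].
pose d k := if U k == set0 then 0%R else fine (diam (U k)).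
have dE k : U k !=set0 -> diam (U k) = (d k)%:E.
  move=> Uk; have [D [DE _ _]] := diam_fin Uk (Ud k).
  by rewrite /d ifF ?DE//; apply/negbTE/set0P.
have d0 k : (0 <= d k)%R.
  have [Uk|/set0P Uk] := eqVneq (U k) set0; first by rewrite /d Uk eqxx.
  by rewrite -lee_fin -dE// diam_ge0.
have b0 : (0 < ball_volume s / 4 ^+ s :> R)%R.
  by rewrite divr_gt0 ?ball_volume_gt0// exprn_gt0.
rewrite -[leLHS]mule1.
apply: le_trans (_ : _ <= (ball_volume s / 4 ^+ s)%:E *
    \sum_(k <oo) (if U k == set0 then 0 else ((2 * d k) ^+ s)%:E)) _.
  rewrite lee_pmul2l//; apply: unit_cube_cover => // k x y Ux Uy i.
  rewrite -lee_fin -dE; last by exists x.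
  apply: le_trans (diam_ge Ux Uy); rewrite lee_fin.
  by have := coord_le_enorm (x - y) i; rewrite !mxE.
rewrite -nneseriesZl; last first.
  by move=> k _; case: ifP => // _; rewrite lee_fin exprn_ge0// mulr_ge0.
apply: lee_nneseries => [k _ _|k _].
  apply: mule_ge0; first by rewrite lee_fin ltW.
  by case: ifP => // _; rewrite lee_fin exprn_ge0// mulr_ge0.
have [->|/set0P Uk] := eqVneq (U k) set0.
  by rewrite hausdorff_gauge0 mule0.
rewrite (gaugeE _ Uk (dE k Uk)) -EFinM lee_fin -mulrA ler_pM2l ?ball_volume_gt0//.
have -> : (d k / 2 = 4^-1 * (2 * d k))%R by field.
by rewrite [leRHS]exprMn exprVn.
Qed.

End CubePositive.

Section HausdorffSimilarity.
Context {R : realType}.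
Local Open Scope ereal_scope.

(** The inverse of [f] on the image is Lipschitz with the inverse ratio. *)
Lemma hausdorff_similarity {a b} s (f : 'rV[R]_a -> 'rV[R]_b) (L : R) A :
  (0 < L)%R ->
  (forall x y, A x -> A y -> enorm (f x - f y) = (L * enorm (x - y))%R) ->
  hausdorff s (f @` A) = (L ^+ s)%:E * hausdorff s A.
Proof.
move=> L0 fL; apply/eqP; rewrite eq_le; apply/andP; split.
  by apply: hausdorff_lipschitz => // x y Ax Ay; rewrite fL.
pose g y := xget 0%R [set x | A x /\ f x = y].
have gf x : A x -> g (f x) = x.
  move=> Ax; rewrite /g; case: xgetP => [z _ [Az fzx]|/(_ x)[]//].
  apply/eqP; rewrite -subr_eq0 -enorm_eq0; apply/eqP.
  apply: (@mulfI _ L); first by rewrite gt_eqF.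
  by rewrite -fL// fzx subrr enorm0 mulr0.
have {1}-> : A = g @` (f @` A).
  apply/seteqP; split=> [x Ax|_ [_ [x Ax <-] <-]]; last by rewrite gf.
  by exists (f x); [exists x|rewrite gf].
have Ls : (0 < L ^+ s)%R by rewrite exprn_gt0.
rewrite -lee_pdivlMl// -exprVn; apply: hausdorff_lipschitz; first by rewrite invr_gt0.
move=> _ _ [x Ax <-] [y Ay <-]; rewrite !gf// fL// mulrA mulVf ?mul1r//.
by rewrite gt_eqF.
Qed.

Lemma hausdorff_isometry {a b} s (f : 'rV[R]_a -> 'rV[R]_b) A :
  (forall x y, A x -> A y -> enorm (f x - f y) = enorm (x - y)) ->
  hausdorff s (f @` A) = hausdorff s A.
Proof.
move=> fA; rewrite (@hausdorff_similarity _ _ _ _ 1%R)//.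
  by rewrite expr1n mul1e.
by move=> x y Ax Ay; rewrite mul1r fA.
Qed.

Lemma hausdorff_translate {n} s (v : 'rV[R]_n) A :
  hausdorff s [set (x + v)%R | x in A] = hausdorff s A.
Proof. by apply: hausdorff_isometry => x y _ _; rewrite opprD addrACA subrr addr0. Qed.

Lemma hausdorff_scale {n} s (L : R) (A : set 'rV[R]_n) : (0 < L)%R ->
  hausdorff s [set L *: x | x in A] = (L ^+ s)%:E * hausdorff s A.
Proof.
move=> L0; apply: hausdorff_similarity => // x y _ _.
by rewrite -scalerBr enormZ gtr0_norm.
Qed.

Lemma hausdorff_gt0 {s} (A : set 'rV[R]_s) (z : 'rV[R]_s) (r : R) : (0 < r)%R ->
  (forall x : 'rV[R]_s, (forall i, `|x 0 i - z 0 i| <= r)%R -> A x) ->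
  0 < hausdorff s A.
Proof.
move=> r0 zA; rewrite lt_neqAle hausdorff_ge0 andbT; apply/eqP => A0.
have := hausdorff_unit_cube_gt0 (R := R) s; rewrite ltNge => /negP; apply.
apply: (@le_trans _ _ (hausdorff s
    [set r^-1 *: x | x in [set x - z | x in A]]%R)).
  apply: le_hausdorff => x cx.
  exists (r *: x)%R; last by rewrite scalerA mulVf ?scale1r// gt_eqF.
  exists (r *: x + z)%R; last by rewrite addrK.
  apply: zA => i; rewrite !mxE addrK normrM gtr0_norm// ler_piMr ?(ltW r0)//.
  by have /andP[x0 x1] := cx i; rewrite ger0_norm.
by rewrite hausdorff_scale ?invr_gt0// hausdorff_translate -A0 mule0.
Qed.

Lemma enorm_le_coord {n} (x : 'rV[R]_n) (c : R) : (0 <= c)%R ->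
  (forall i, `|x 0 i| <= c)%R -> (enorm x <= n%:R * c)%R.
Proof.
move=> c0 xc; apply: le_trans (enorm_le_norm x) _.
by rewrite ler_wpM2l//; exact: norm_le_coord.
Qed.

(** Cutting the cube into [m ^ s] cubes of diameter at most [s / m] gives a
    covering whose total gauge is bounded independently of [m]. *)
Lemma hausdorff_unit_cube_fin s : hausdorff s (unit_cube R s) < +oo.
Proof.
apply: (@le_lt_trans _ _ (ball_volume s * (s%:R / 2) ^+ s)%:E); last exact: ltry.
apply: ge_ereal_sup => _ [e /= e0 <-].
pose m := (Num.bound (s%:R / e)).+1.
have m0 : (0 < m%:R :> R)%R by rewrite ltr0n.
have sm : (s%:R / m%:R <= e :> R)%R.
  rewrite ler_pdivrMr// mulrC -ler_pdivrMr//.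
  apply: le_trans (ltW (archi_boundP _)) _; first by rewrite divr_ge0// ltW.
  by rewrite ler_nat.
pose T : finType := {ffun 'I_s -> 'I_m}.
pose Q (f : T) : set 'rV[R]_s :=
  [set x | forall i, ((f i)%:R / m%:R <= x 0 i <= (f i).+1%:R / m%:R)%R].
have Qd f : diam (Q f) <= (s%:R / m%:R)%:E.
  apply: diam_le => x y Qx Qy; rewrite lee_fin.
  apply: enorm_le_coord; first by rewrite invr_ge0.
  move=> i; rewrite !mxE ler_norml; have /andP[x1 x2] := Qx i; have /andP[y1 y2] := Qy i.
  have E : ((f i).+1%:R / m%:R = (f i)%:R / m%:R + m%:R^-1 :> R)%R.
    by rewrite -natr1 mulrDl mul1r.
  by rewrite E in x2 y2; apply/andP; split; lra.
pose U k := if (k < size (enum T))%N then Q (nth [ffun=> ord0] (enum T) k) else set0.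
apply: le_trans (@hausdorff_delta_le_cover _ _ _ _ _ U _ _) _.
- move=> k; rewrite /U; case: ifP => _; last by rewrite diam0 leNye.
  by apply: le_trans (Qd _) _; rewrite lee_fin.
- move=> x cx.
  pose f : T := [ffun i => inord (minn (Num.truncn (m%:R * x 0 i)%R) m.-1)].
  exists (index f (enum T)) => //.
  rewrite /U index_mem mem_enum/= nth_index ?mem_enum// => i.
  rewrite /f ffunE inordK; last by rewrite ltnS geq_minr.
  have /andP[x0 x1] := cx i.
  have mx0 : (0 <= m%:R * x 0 i)%R by rewrite mulr_ge0.
  have /andP[t1 t2] := truncn_itv mx0.
  rewrite ler_pdivrMr// ler_pdivlMr// !(mulrC (x _ i)); apply/andP; split.
    by apply: le_trans t1; rewrite ler_nat geq_minl.
  have [_|_] := leqP (Num.truncn (m%:R * x 0 i)%R) m.-1; first exact: ltW.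
  by rewrite /m/= ler_piMr.
rewrite (nneseries_split 0 (size (enum T))); last by move=> *; exact: hausdorff_gauge_ge0.
rewrite add0n eseries0 ?adde0; last first.
  by move=> k mk _; rewrite /U ltnNge mk/= hausdorff_gauge0.
apply: (@le_trans _ _ (\sum_(0 <= k < size (enum T))
    (ball_volume s * (s%:R / m%:R / 2) ^+ s)%:E)).
  apply: lee_sum => k _; rewrite /U; case: ifP => _; last first.
    rewrite hausdorff_gauge0 lee_fin mulr_ge0 ?ball_volume_ge0// exprn_ge0//.
  by apply: gauge_le => //; rewrite divr_ge0.
rewrite sumEFin lee_fin sumr_const_nat subn0 -cardT card_ffun !card_ord.
rewrite -[leLHS]mulr_natl natrX mulrCA ler_wpM2l ?ball_volume_ge0// -exprMn.
by rewrite le_eqVlt; apply/orP; left; apply/eqP; congr (_ ^+ _)%R; field; lra.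
Qed.

Lemma hausdorff_bounded {s} (A : set 'rV[R]_s) (M : R) :
  (forall x, A x -> forall i, `|x 0 i| <= M)%R -> hausdorff s A < +oo.
Proof.
move=> AM; have [N [N0 MN]] : exists N : R, (0 < N)%R /\ (M <= N)%R.
  by exists (`|M| + 1)%R; split; [have := normr_ge0 M; lra|rewrite (le_trans (ler_norm M))// lerDl].
apply: (@le_lt_trans _ _ (hausdorff s
    [set x + (const_mx (- N) : 'rV_s) | x in [set (2 * N) *: x | x in unit_cube R s]])%R).
  apply: le_hausdorff => x Ax; exists (x + const_mx N)%R; last first.
    by apply/rowP => i; rewrite !mxE addrK.
  exists ((2 * N)^-1 *: (x + const_mx N))%R; last first.
    by rewrite scalerA mulfV ?scale1r// gt_eqF// mulr_gt0.
  move=> i; rewrite !mxE; have := AM x Ax i; rewrite ler_norml => /andP[x1 x2].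
  rewrite mulr_ge0 ?invr_ge0 ?mulr_ge0 ?(ltW N0)//=; last by lra.
  by rewrite mulrC ler_pdivrMr ?mul1r ?mulr_gt0//; lra.
rewrite hausdorff_translate hausdorff_scale ?mulr_gt0//.
by rewrite lte_mul_pinfty// ?hausdorff_unit_cube_fin// lee_fin exprn_ge0// mulr_ge0// ltW.
Qed.

End HausdorffSimilarity.

(** * Translation-invariant measures on open sets *)

Section DyadicCubes.
Context {R : realType} {d : nat}.
Implicit Types (x : 'rV[R]_d) (z : 'rV[int]_d) (j : nat).

(** [dyadic_cube j z] is the half-open cube of side [2 ^- j] with corner
    [2 ^- j *: z]. *)
Definition grid j x : 'rV[int]_d := \row_i Num.floor (2 ^+ j * x 0 i).

Definition dyadic_cube j z : set 'rV[R]_d := grid j @^-1` [set z].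

Lemma floor_eq (a : R) (k : int) : (Num.floor a = k) <-> (k%:~R <= a < k%:~R + 1).
Proof.
split=> [<-|]; first by rewrite floor_le_tmp -(intrD _ _ 1) floorD1_gt.
by move=> h; apply: floor_def; rewrite intrD.
Qed.

Lemma dyadic_cubeP j z x : dyadic_cube j z x <->
  forall i, (z 0 i)%:~R <= 2 ^+ j * x 0 i < (z 0 i)%:~R + 1.
Proof.
split=> [<- i|h]; first by apply/floor_eq; rewrite mxE.
by apply/rowP => i; rewrite mxE; apply/floor_eq.
Qed.

Lemma measurable_dyadic_cube j z : measurable (dyadic_cube j z : set (borel R d)).
Proof.
have p0 : 0 < 2 ^+ j :> R by rewrite exprn_gt0.
rewrite (_ : dyadic_cube j z = \bigcap_(i in [set: 'I_d])
    ([set x | (z 0 i)%:~R / 2 ^+ j <= x 0 i] `&`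
     [set x | x 0 i < ((z 0 i)%:~R + 1) / 2 ^+ j])); last first.
  apply/seteqP; split=> [x /dyadic_cubeP h i _|x h].
    have /andP[h1 h2] := h i.
    by split=> /=; [rewrite ler_pdivrMr|rewrite ltr_pdivlMr]; rewrite // mulrC.
  apply/dyadic_cubeP => i; have [/= h1 h2] := h i I.
  by rewrite mulrC -ler_pdivrMr// -ltr_pdivlMr// h1 h2.
have c (i : 'I_d) : continuous (fun x : 'rV[R]_d => x 0 i) by exact: coord_continuous.
apply: fin_bigcap_measurable => // i _; apply: measurableI.
  rewrite -[X in measurable X]setCK; apply: measurableC; apply: sub_sigma_algebra.
  rewrite (_ : ~` _ = (fun x : 'rV[R]_d => x 0 i) @^-1` [set t | t < (z 0 i)%:~R / 2 ^+ j]).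
    by apply: open_comp (@open_lt _ _) => x _; exact: c.
  apply/seteqP; split=> x /=; first by move=> /negP; rewrite -ltNge.
  by rewrite ltNge => /negP.
apply: sub_sigma_algebra.
by apply: (open_comp _ (@open_lt _ (((z 0 i)%:~R + 1) / 2 ^+ j))) => x _; exact: c.
Qed.

Lemma trivIset_dyadic_cube j (D : set 'rV[int]_d) : trivIset D (dyadic_cube j).
Proof. by move=> z z' _ _ [x [<- <-]]. Qed.

Lemma finite_int_box (a b : int) :
  finite_set [set z : 'rV[int]_d | forall i, a <= z 0 i <= b].
Proof.
pose N := `|b - a|%N.+1.
apply: (@sub_finite_set _ _ [set (\row_i (a + (f i)%:Z)) | f in [set: {ffun 'I_d -> 'I_N}]]).
  move=> z zab; exists [ffun i => inord `|(z 0%R i - a)%R|%N] => //.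
  apply/rowP => i; have /andP[za zb] := zab i.
  rewrite mxE ffunE inordK.
    by rewrite gez0_abs ?subr_ge0// addrC subrK.
  rewrite ltnS -lez_nat !gez0_abs ?subr_ge0 ?lerD2r//.
  exact: le_trans zb.
by apply: finite_image; exact: finite_finset.
Qed.

Lemma grid_mono j x y : grid j.+1 x = grid j.+1 y -> grid j x = grid j y.
Proof.
move=> xy; apply/rowP => i; rewrite !mxE.
have half a : Num.floor (a : R) = (Num.floor (2 * a) %/ 2)%Z.
  apply/floor_eq; have /floor_eq := erefl (Num.floor (2 * a)).
  set f := Num.floor _; have := divz_eq f 2.
  have := @modz_ge0 f 2 isT; have := @ltz_mod f 2 isT.
  set q := (f %/ 2)%Z; set r := (f %% 2)%Z => r2 r0 -> .
  rewrite intrD intrM => /andP[h1 h2].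
  have r0' : 0 <= r%:~R :> R by rewrite ler0z.
  have r1' : r%:~R <= 1 :> R by rewrite lerz1 -ltzD1.
  by apply/andP; split; lra.
move/rowP: xy => /(_ i); rewrite !mxE exprS -!mulrA => xy.
by rewrite half xy -half.
Qed.

Lemma grid_dist j x y : grid j x = grid j y -> enorm (x - y) <= d%:R * (2 ^- j).
Proof.
move=> xy; apply: enorm_le_coord; first by rewrite invr_ge0 exprn_ge0.
have p0 : 0 < 2 ^+ j :> R by rewrite exprn_gt0.
have xc : dyadic_cube j (grid j x) x by [].
have yc : dyadic_cube j (grid j x) y by rewrite xy.
move=> i; move/dyadic_cubeP : xc => /(_ i)/andP[x1 x2].
move/dyadic_cubeP : yc => /(_ i)/andP[y1 y2].
rewrite !mxE -(ler_pM2l p0) mulfV ?gt_eqF// -{1}(gtr0_norm p0) -normrM mulrBr.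
by rewrite ler_norml; apply/andP; split; lra.
Qed.

End DyadicCubes.

Section TranslationInvariant.
Context {R : realType} {d : nat}.
Local Open Scope ereal_scope.

Definition translation_invariant (m : set (borel R d) -> \bar R) :=
  forall (v : 'rV[R]_d) (A : set (borel R d)), measurable A ->
    m ((fun x => (x + v)%R) @^-1` A) = m A.

Notation unit_box := (@dyadic_cube R d 0 0).

Section OneMeasure.
Variable m : {measure set (borel R d) -> \bar R}.
Hypothesis m_inv : translation_invariant m.
Hypothesis m_fin : m unit_box < +oo.

Lemma measure_dyadic_cube j z : m (dyadic_cube j z) = m (dyadic_cube j 0).
Proof.
have p0 : (0 < 2 ^+ j :> R)%R by rewrite exprn_gt0.
pose v : 'rV[R]_d := (\row_i - ((z 0 i)%:~R / 2 ^+ j))%R.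
rewrite -(m_inv v (measurable_dyadic_cube j 0)); congr (m _).
apply/seteqP; split=> x /dyadic_cubeP h; apply/dyadic_cubeP => i; have := h i;
  rewrite !mxE mulrDr mulrN mulrCA mulfV ?gt_eqF// mulr1;
  by move=> /andP[h1 h2]; apply/andP; split; lra.
Qed.

Lemma measure_dyadic_union j (Z : set 'rV[int]_d) : finite_set Z ->
  m (\bigcup_(z in Z) dyadic_cube j z) =
  (size (finmap.enum_fset (fset_set Z)))%:R%:E * m (dyadic_cube j 0).
Proof.
move=> finZ; rewrite measure_fin_bigcup//; last 2 first.
- exact: trivIset_dyadic_cube.
- by move=> z _; exact: measurable_dyadic_cube.
rewrite (eq_fsbigr (fun=> m (dyadic_cube j 0))); last first.
  by move=> z _; exact: measure_dyadic_cube.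
rewrite fsbig_finite//= big_const_seq count_predT.
elim: (size _) => [|n IH]; first by rewrite mul0e.
by rewrite iterS IH -natr1 EFinD ge0_muleDl// mul1e addeC.
Qed.

Lemma unit_box_split j : unit_box = \bigcup_(z in [set z : 'rV[int]_d |
  forall i, (0 <= z 0%R i <= 2 ^+ j - 1)%R]) dyadic_cube j z.
Proof.
have p0 : (0 < 2 ^+ j :> R)%R by rewrite exprn_gt0.
apply/seteqP; split=> [x /dyadic_cubeP h|x [z /= zj /dyadic_cubeP h]].
  exists (grid j x) => //= i; rewrite mxE; have := h i.
  rewrite !mxE expr0 mul1r add0r => /andP[x0 x1].
  rewrite floor_ge0 (mulr_ge0 (ltW p0) x0)/=.
  rewrite -ltzD1 subrK floor_lt_int// rmorphXn/=.
  by rewrite gtr_pMr.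
apply/dyadic_cubeP => i; have /andP[z0 z1] := zj i; have /andP[x0 x1] := h i.
rewrite !mxE expr0 mul1r add0r; apply/andP; split.
  by rewrite -(pmulr_rge0 _ p0); apply: le_trans x0; rewrite ler0z.
rewrite -(ltr_pM2l p0) mulr1; apply: lt_le_trans x1 _.
have : ((z 0 i + 1)%:~R <= (2 ^+ j)%:~R :> R)%R by rewrite ler_int -lerBrDr.
by rewrite intrD rmorphXn.
Qed.

End OneMeasure.
End TranslationInvariant.

Section MeasureRatio.
Context {R : realType} {d : nat}.
Local Open Scope ereal_scope.
Notation unit_box := (@dyadic_cube R d 0 0).

(** An open set is the increasing union of the dyadic cubes of a given size that
    it contains; by translation invariance its measure is the limit of the
    number of these cubes times the measure of one of them. *)
Lemma measure_ratio (m1 m2 : {measure set (borel R d) -> \bar R})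
    (U : set 'rV[R]_d) (M : R) :
  translation_invariant m1 -> translation_invariant m2 ->
  m1 unit_box < +oo -> m2 unit_box < +oo ->
  open U -> (forall x, U x -> forall i, `|x 0 i| <= M)%R ->
  m1 U * m2 unit_box = m2 U * m1 unit_box.
Proof.
move=> inv1 inv2 fin1 fin2 oU UM.
pose Z j := [set z | exists2 x : 'rV[R]_d, grid j x = z & dyadic_cube j z `<=` U].
have finZ j : finite_set (Z j).
  apply: sub_finite_set (finite_int_box (Num.floor (2 ^+ j * - M)%R) (Num.floor (2 ^+ j * M)%R)).
  move=> z [x <- xU] i; rewrite mxE.
  have p0 : (0 < 2 ^+ j :> R)%R by rewrite exprn_gt0.
  have := UM x (xU x erefl) i; rewrite ler_norml => /andP[x1 x2].
  by rewrite !le_floor// ler_pM2l.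
pose V j : set 'rV[R]_d := \bigcup_(z in Z j) dyadic_cube j z.
have VP j x : V j x <-> dyadic_cube j (grid j x) `<=` U.
  split=> [[z [y _ zU] xz]|xU]; first by rewrite (xz : grid j x = z).
  by exists (grid j x) => //; exists x.
have VU : \bigcup_j V j = U.
  apply/seteqP; split=> [x [j _ /VP]|x Ux]; first exact.
  have /nbhs_enorm[e e0 xU] : nbhs x U by exact: open_nbhs_nbhs.
  pose j := Num.bound (d%:R / e)%R.
  exists j => //; apply/VP => y yx; apply: xU.
  apply: le_lt_trans (grid_dist yx) _.
  have p0 : (0 < 2 ^+ j :> R)%R by rewrite exprn_gt0.
  rewrite ltr_pdivrMr// mulrC -ltr_pdivrMr//.
  apply: lt_trans (archi_boundP _) _; first by rewrite divr_ge0// ltW.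
  by rewrite -natrX ltr_nat ltn_expl.
have mV j : measurable (V j : set (borel R d)).
  by apply: fin_bigcup_measurable => // z _; exact: measurable_dyadic_cube.
have mU : measurable (\bigcup_j V j : set (borel R d)).
  by rewrite VU; exact: sub_sigma_algebra.
have homoV : {homo V : n m / (n <= m)%N >-> (n <= m)%O}.
  apply: homo_leq => [A|B A C AB BC|j]; [by []|exact: le_trans BC|].
  apply/subsetPset => x /VP xU; apply/VP => y yx; apply: xU; exact: grid_mono.
have H (m m' : {measure set (borel R d) -> \bar R}) : m' unit_box < +oo ->
    (fun j => m (V j) * m' unit_box) @ \oo --> m U * m' unit_box.
  move=> fin; apply: cvgeZr; first by rewrite ge0_fin_numE.
  by rewrite -VU; exact: nondecreasing_cvg_mu.
have E : (fun j => m1 (V j) * m2 unit_box) = (fun j => m2 (V j) * m1 unit_box).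
  apply/funext => j; rewrite /V !measure_dyadic_union//.
  rewrite (unit_box_split (R := R) (d := d) j).
  rewrite !measure_dyadic_union//; try exact: finite_int_box.
  by rewrite muleACA [RHS]muleACA (muleC (m1 _)).
have H1 := H m1 m2 fin2; have := H m2 m1 fin1; rewrite -E => H2.
exact: cvg_unique H1 H2.
Qed.

End MeasureRatio.

Section Prism.
Context {R : realType}.
Local Open Scope ereal_scope.

Lemma measurable_preimage_continuous {n d} (f : 'rV[R]_n -> 'rV[R]_d)
    (A : set (borel R d)) : continuous f -> measurable A ->
  measurable (f @^-1` A : set (borel R n)).
Proof.
move=> cf mA.
apply: (@smallest_sub _ (sigma_algebra [set: 'rV[R]_d]) open
  [set B | measurable (f @^-1` B : set (borel R n))]) mA; last first.
  by move=> U oU; apply: sub_sigma_algebra; apply: open_comp oU => x _; exact: cf.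
split=> [|B mB|F mF] /=.
- by rewrite preimage_set0; exact: measurable0.
- by rewrite setTD preimage_setC; exact: measurableC.
- by rewrite preimage_bigcup; apply: bigcupT_measurable => k; exact: mF.
Qed.

(** Push-forward by the projection [f] turns the measure of a prism with
    variable base into a measure of its base. *)
Lemma hausdorff_sliceE {n d} s (S : set 'rV[R]_n) (f : 'rV[R]_n -> 'rV[R]_d) :
  measurable (S : set (borel R n)) -> continuous f ->
  exists m : {measure set (borel R d) -> \bar R},
    forall A, m A = hausdorff s (S `&` f @^-1` A).
Proof.
move=> mS cf; pose m (A : set (borel R d)) := hausdorff s (S `&` f @^-1` A).
have mSf (A : set (borel R d)) : measurable A ->
    measurable (S `&` f @^-1` A : set (caratheodory_type (@hausdorff R n s))).
  move=> mA; apply: caratheodory_borel; apply: measurableI => //.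
  exact: measurable_preimage_continuous.
have m0 : m set0 = 0 by rewrite /m preimage_set0 setI0 hausdorff0.
have m_ge0 A : 0 <= m A by exact: hausdorff_ge0.
have m_sa : semi_sigma_additive m.
  move=> F mF tF mUF; rewrite /m preimage_bigcup setI_bigcupr.
  apply: (@measure_semi_sigma_additive _ _ _ (@hausdorff_measure R n s)).
  - by move=> k; exact: mSf.
  - move/trivIsetP : tF => tF; apply/trivIsetP => i j _ _ ij.
    apply/seteqP; split=> // x [[_ xi] [_ xj]].
    by have : (F i `&` F j) (f x) by []; rewrite (tF i j I I ij).
  - by rewrite -setI_bigcupr -preimage_bigcup; exact: mSf.
pose M : {measure set (borel R d) -> \bar R} :=
  HB.pack m (isMeasure.Build _ _ _ m m0 m_ge0 m_sa).
by exists M.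
Qed.

(** Half-open in the first coordinate, so that prisms stack without overlap. *)
Definition prism {d} (B : set 'rV[R]_d) (a t : R) : set 'rV[R]_d.+1 :=
  [set x : 'rV[R]_d.+1 | (a < x 0%R ord0 <= a + t)%R /\ B (row_tail x)].

Lemma measurable_strip {n} i (a b : R) :
  measurable ([set x : 'rV[R]_n | (a < x 0%R i <= b)%R] : set (borel R n)).
Proof.
have c : continuous (fun x : 'rV[R]_n => x 0%R i) by exact: coord_continuous.
rewrite (_ : [set x | _] = (fun x : 'rV[R]_n => x 0%R i) @^-1` [set t | (a < t)%R] `\`
   (fun x : 'rV[R]_n => x 0%R i) @^-1` [set t | (b < t)%R]).
  apply: measurableD; apply: sub_sigma_algebra.
    by apply: open_comp (@open_gt _ _) => x _; exact: c.
  by apply: open_comp (@open_gt _ _) => x _; exact: c.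
apply/seteqP; split=> x /=.
  by move=> /andP[-> xb]; split=> //; rewrite ltNge xb.
by move=> [-> /negP]; rewrite -leNgt => ->.
Qed.

Lemma measurable_prism {d} (B : set 'rV[R]_d) a t : measurable (B : set (borel R d)) ->
  measurable (prism B a t : set (borel R d.+1)).
Proof.
move=> mB; apply: measurableI; first exact: measurable_strip.
by apply: measurable_preimage_continuous => //; exact: row_tail_continuous.
Qed.

Lemma row_cons_add {d} t (y : 'rV[R]_d) (x : 'rV[R]_d.+1) :
  row_tail (x + row_cons t y) = (row_tail x + y)%R /\
  (x + row_cons t y)%R 0%R ord0 = (x 0%R ord0 + t)%R.
Proof.
split; last by rewrite mxE row_cons0.
by apply/rowP => j; rewrite !mxE liftK.
Qed.

Lemma hausdorff_prism_translate {d} s (B : set 'rV[R]_d) a t :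
  hausdorff s (prism B a t) = hausdorff s (prism B 0 t).
Proof.
rewrite -(hausdorff_translate s (row_cons a 0) (prism B 0 t)).
congr (hausdorff s _); apply/seteqP; split=> [x [xa xB]|_ [x [xa xB] <-]].
  exists (x + row_cons (- a) 0)%R; last first.
    rewrite -addrA (_ : row_cons (- a) 0 + _ = 0)%R ?addr0//.
    apply/rowP => i; rewrite !mxE; case: unlift => [j|]; rewrite ?mxE ?addr0//.
    by rewrite addNr.
  have [E1 E2] := row_cons_add (- a) 0 x; split; last by rewrite E1 addr0.
  by rewrite E2; move/andP : xa => [? ?]; apply/andP; split; lra.
have [E1 E2] := row_cons_add a 0 x; split; last by rewrite E1 addr0.
by rewrite E2; move/andP : xa => [? ?]; apply/andP; split; lra.
Qed.

Lemma hausdorff_prism_mul {d} s (B : set 'rV[R]_d) (t : R) k : (0 <= t)%R ->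
  measurable (B : set (borel R d)) ->
  hausdorff s (prism B 0 (k%:R * t)) = k%:R%:E * hausdorff s (prism B 0 t).
Proof.
move=> t0 mB; elim: k => [|k IH].
  rewrite mul0r mul0e (_ : prism _ _ _ = set0) ?hausdorff0//.
  apply/seteqP; split=> // x [/andP[x0]]; rewrite add0r => x1.
  by have := lt_le_trans x0 x1; rewrite ltxx.
rewrite -natr1 EFinD ge0_muleDl// mul1e -IH -(hausdorff_prism_translate s B (k%:R * t) t).
rewrite -(@measureU _ _ _ (@hausdorff_measure R d.+1 s)); last 3 first.
- by apply: caratheodory_borel; exact: measurable_prism.
- by apply: caratheodory_borel; exact: measurable_prism.
- apply/seteqP; split=> // x [[/andP[_]]]; rewrite add0r => x1 _ [/andP[x2 _] _].
  by have := lt_le_trans x2 x1; rewrite ltxx.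
congr (hausdorff s _).
have kt0 : (0 <= k%:R * t)%R by rewrite mulr_ge0.
apply/seteqP; split=> [x [/andP[x0 x1] xB]|x [[/andP[x0 x1] xB]|[/andP[x0 x1] xB]]].
- have [xk|xk] := leP (x 0%R ord0) (k%:R * t)%R; [left|right]; split=> //; apply/andP; split;
    lra.
- by split=> //; apply/andP; split; lra.
- by split=> //; apply/andP; split; lra.
Qed.

(** Both sides define translation-invariant measures of the base, hence they
    agree up to a constant factor; it does not depend on the height because
    prisms can be stacked. *)
Lemma hausdorff_prism d : exists2 c : R, (0 < c)%R &
  forall (B : set 'rV[R]_d) (M : R), open B ->
    (forall x, B x -> forall i, `|x 0 i| <= M)%R ->
  forall a m, hausdorff d.+1 (prism B a m.+1%:R^-1) =
    (c / m.+1%:R)%:E * hausdorff d B.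
Proof.
have mT : measurable (setT : set (borel R d)) by [].
have [m1 m1E] := @hausdorff_sliceE d d d setT id mT (fun x => @cvg_id _ _).
have [m2 m2E] := @hausdorff_sliceE d.+1 d d.+1 _ row_tail
  (measurable_strip ord0 0%R 1%R) row_tail_continuous.
have m1H A : m1 A = hausdorff d A by rewrite m1E setTI.
have m2H A : m2 A = hausdorff d.+1 (prism A 0 1).
  by rewrite m2E; congr (hausdorff _ _); rewrite /prism add0r.
have inv1 : translation_invariant m1.
  move=> v A _; rewrite !m1H -(hausdorff_translate d (- v) A); congr (hausdorff d _).
  apply/seteqP; split=> [x Axv|_ [x Ax <-]]; last by rewrite /= subrK.
  by exists (x + v)%R => //; rewrite addrK.
have inv2 : translation_invariant m2.
  move=> v A _; rewrite !m2H -(hausdorff_translate d.+1 (row_cons 0 (- v)) (prism A 0 1)).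
  congr (hausdorff _ _); apply/seteqP; split=> [x [xa xB]|_ [x [xa xB] <-]].
    exists (x + row_cons 0 v)%R; last first.
      rewrite -addrA (_ : row_cons 0 v + _ = 0)%R ?addr0//.
      apply/rowP => i; rewrite !mxE; case: unlift => [j|]; rewrite ?mxE ?addr0//.
      by rewrite addrN.
    by have [E1 E2] := row_cons_add 0%R v x; split; rewrite ?E1 ?E2 ?addr0.
  by have [E1 E2] := row_cons_add 0%R (- v)%R x; split; rewrite ?E1 ?E2 ?addr0//= ?subrK.
pose Q := @dyadic_cube R d 0 0.
have QP x : Q x <-> forall i, (0 <= x 0%R i < 1)%R.
  split=> [/dyadic_cubeP h i|h]; last apply/dyadic_cubeP => i; have := h i;
  by rewrite mxE expr0 mul1r add0r.
have fin1 : m1 Q < +oo.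
  rewrite m1H; apply: (@hausdorff_bounded _ _ _ 1%R) => x /QP h i.
  by have /andP[x0 x1] := h i; rewrite ger0_norm// ltW.
have fin2 : m2 Q < +oo.
  rewrite m2H; apply: (@hausdorff_bounded _ _ _ 1%R) => x [/andP[x0 x1] /QP h] i.
  have [j ->|->] := unliftP ord0 i.
    by have := h j; rewrite mxE => /andP[y0 y1]; rewrite ger0_norm// ltW.
  by rewrite add0r in x1; rewrite ger0_norm// ltW.
have quarter (t : R) : (`|t - 2^-1| <= 4^-1)%R -> (0 < t < 1)%R.
  by rewrite ler_norml => /andP[? ?]; apply/andP; split; lra.
have pos1 : 0 < m1 Q.
  rewrite m1H; apply: (@hausdorff_gt0 _ _ _ (const_mx 2^-1) 4^-1)%R => // x h.
  apply/QP => i; have := h i; rewrite mxE => /quarter/andP[x0 ->].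
  by rewrite ltW.
have pos2 : 0 < m2 Q.
  rewrite m2H; apply: (@hausdorff_gt0 _ _ _ (const_mx 2^-1) 4^-1)%R => // x h.
  split.
    by have := h ord0; rewrite mxE => /quarter/andP[-> x1]; rewrite add0r ltW.
  apply/QP => i; have := h (lift ord0 i); rewrite !mxE => /quarter/andP[x0 ->].
  by rewrite ltW.
have f1 : m1 Q \is a fin_num by rewrite ge0_fin_numE.
have f2 : m2 Q \is a fin_num by rewrite ge0_fin_numE.
pose c := (fine (m2 Q) / fine (m1 Q))%R.
have q1 : (0 < fine (m1 Q))%R by rewrite fine_gt0// pos1 fin1.
have q2 : (0 < fine (m2 Q))%R by rewrite fine_gt0// pos2 fin2.
exists c; first by rewrite divr_gt0.
move=> B M oB BM a m.
have mB : measurable (B : set (borel R d)) by exact: sub_sigma_algebra.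
have := measure_ratio inv1 inv2 fin1 fin2 oB BM; rewrite -/Q (m1H B) (m2H B) => ratio.
have b1 : hausdorff d B \is a fin_num.
  by rewrite ge0_fin_numE ?hausdorff_ge0//; exact: hausdorff_bounded BM.
have n0 : (0 < m.+1%:R :> R)%R by rewrite ltr0n.
have := @hausdorff_prism_mul d d.+1 B m.+1%:R^-1 m.+1 _ mB.
rewrite mulfV ?gt_eqF// => /(_ (ltW _)); rewrite invr_gt0 n0 => /(_ isT) stack.
rewrite hausdorff_prism_translate; move: ratio; rewrite stack.
rewrite -(fineK f1) -(fineK f2) -(fineK b1).
case: (hausdorff d.+1 (prism B 0 m.+1%:R^-1)) (hausdorff_ge0 (R := R) d.+1 (prism B 0 m.+1%:R^-1)).
- move=> r _; rewrite -!EFinM => -[E]; congr _%:E; rewrite /c.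
  have E2 : (r = fine (hausdorff d B) * fine (m2 Q) / (m.+1%:R * fine (m1 Q)))%R.
    have mq0 : (m.+1%:R * fine (m1 Q) != 0)%R by rewrite mulf_neq0// gt_eqF.
    by apply: (mulIf mq0); rewrite divfK// E; ring.
  by rewrite E2; field; rewrite !gt_eqF.
- move=> _; rewrite gt0_muley ?lte_fin// gt0_mulye ?lte_fin//.
- by [].
Qed.

End Prism.

(** * Cylinders over sections by hyperplanes *)

Lemma isometry_continuous {R : realType} {m n} (f : 'rV[R]_m -> 'rV[R]_n) :
  (forall x y, enorm (f x - f y) = enorm (x - y)) -> continuous f.
Proof.
move=> fiso x A /nbhs_enorm[e e0 fxA]; apply/nbhs_enorm; exists e => // y yx.
by apply: fxA; rewrite fiso.
Qed.

Lemma open_isometry_preimage {R : realType} {m n} (f : 'rV[R]_m -> 'rV[R]_n)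
    (O : set 'rV[R]_n) :
  (forall x y, enorm (f x - f y) = enorm (x - y)) -> open O -> open (f @^-1` O).
Proof.
by move=> fiso; apply: open_comp => x _; exact: isometry_continuous.
Qed.

Section Cylinders.
Context {R : realType} {d : nat}.
Implicit Types (x y u w : 'rV[R]_d.+1).

Lemma dot_row_cons1 x : dot x (row_cons 1 0) = x 0 ord0.
Proof. by rewrite -{1}(row_consE x) dot_row_cons mulr1 dot0r addr0. Qed.

(** A Householder reflection exchanges [u] with the first basis vector. *)
Lemma reflection u : dot u u = 1 -> exists T : 'rV[R]_d.+1 -> 'rV[R]_d.+1,
  [/\ forall x y, enorm (T x - T y) = enorm (x - y), involutive T,
      forall x, (T x) 0 ord0 = dot x u, T u = row_cons 1 0 &
      forall x y c, T (x - c *: y) = T x - c *: T y].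
Proof.
move=> u1; pose e : 'rV[R]_d.+1 := row_cons 1 0.
have [w wE] : exists w, w = u - e by exists (u - e).
have ee : dot e e = 1 by rewrite dot_row_cons mulr1 dot0l addr0.
have [w0|w0] := eqVneq w 0.
  have ue : u = e by apply/eqP; rewrite -subr_eq0 -wE; apply/eqP.
  by exists id; split=> // x; rewrite -dot_row_cons1 ue.
have ww : dot w w != 0 by rewrite dot_eq0.
have wwE : dot w w = 2 - 2 * dot u e.
  by rewrite wE !dotE u1 ee (dotC e u); ring.
have ewE : dot e w = - (dot w w / 2) by rewrite wwE wE !dotE ee (dotC e u); field.
have uwE : dot u w = dot w w / 2 by rewrite wwE wE !dotE u1; field.
pose T x := x - (2 * dot x w / dot w w) *: w.
have TT x y : dot (T x) (T y) = dot x y.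
  by rewrite /T !dotE (dotC y w); field.
have TL x y c : T (x - c *: y) = T x - c *: T y.
  by apply/rowP => i; rewrite /T !dotE !mxE; field.
exists T; split=> //.
- move=> x y; have -> : T x - T y = T (x - y).
    by have := TL x y 1; rewrite !scale1r.
  by rewrite /enorm TT.
- move=> x; rewrite {1}/T; apply/rowP => i.
  by rewrite /T !dotE !mxE; field.
- move=> x; rewrite -dot_row_cons1 -/e /T !dotE (dotC w e) ewE.
  have -> : dot x u = dot x e + dot x w by rewrite wE !dotE; ring.
  by field.
- rewrite /T uwE (_ : 2 * _ / _ = 1); last by field.
  by rewrite scale1r wE opprB addrC subrK.
Qed.

Definition section u (a : R) (O : set 'rV[R]_d.+1) : set 'rV[R]_d.+1 :=
  [set x | dot x u = a /\ O x].

(** The section at level [a], swept along [u] from level [b] to level [b + t];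
    half-open like [prism]. *)
Definition cylinder u (a b t : R) (O : set 'rV[R]_d.+1) : set 'rV[R]_d.+1 :=
  [set x | b < dot x u <= b + t /\ O (x - (dot x u - a) *: u)].

(** In coordinates in which [u] is the first basis vector, sections are slices
    and cylinders are prisms. *)
Lemma section_isometry u a O : dot u u = 1 ->
  exists T : 'rV[R]_d.+1 -> 'rV[R]_d.+1, exists B : set 'rV[R]_d,
  [/\ forall x y, enorm (T x - T y) = enorm (x - y), T 0 = 0,
      section u a O = T @` (row_cons a @` B),
      forall b t, cylinder u a b t O = T @` prism B b t &
      B = [set y | O (T (row_cons a y))]].
Proof.
move=> u1; have [T [Tiso TK T0 Tu TL]] := reflection u1.
pose B := [set y | O (T (row_cons a y))].
have Tcons x c : T (row_cons c (row_tail (T x))) = x - (dot x u - c) *: u.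
  rewrite -[RHS]TK TL Tu; congr T; apply/rowP => i.
  have [j ->|->] := unliftP ord0 i; rewrite !mxE ?liftK ?unlift_none ?mxE.
    by rewrite mulr0 subr0.
  by rewrite T0; ring.
have dotT c (y : 'rV[R]_d) : dot (T (row_cons c y)) u = c by rewrite -T0 TK row_cons0.
exists T, B; split=> //.
- by have := TL 0 0 1; rewrite !scale1r !subrr.
- apply/seteqP; split=> [x [xa xO]|_ [_ [y yB <-] <-]]; last by split; rewrite ?dotT.
  have E := Tcons x a; rewrite xa subrr scale0r subr0 in E.
  by exists (row_cons a (row_tail (T x))) => //; exists (row_tail (T x)) => //=; rewrite /B /= E.
- move=> b t; apply/seteqP; split=> [x [xb xO]|_ [z [zb zB] <-]].
    exists (T x); last by rewrite TK.
    by split; [rewrite T0|rewrite /B /= Tcons].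
  have zu : dot (T z) u = z 0 ord0 by rewrite -T0 TK.
  by split; rewrite zu// -zu -Tcons TK.
Qed.

Lemma hausdorff_section s u a O : dot u u = 1 -> exists B : set 'rV[R]_d,
  [/\ hausdorff s (section u a O) = hausdorff s B,
      forall b t, hausdorff d.+1 (cylinder u a b t O) = hausdorff d.+1 (prism B b t),
      open O -> open B &
      forall M, (forall x, section u a O x -> enorm x <= M) ->
        forall y : 'rV[R]_d, B y -> forall i, `|y 0 i| <= M].
Proof.
move=> u1; have [T [B [Tiso T0 secE cylE BE]]] := section_isometry a O u1.
exists B; split.
- rewrite secE hausdorff_isometry; last by move=> x y _ _; rewrite Tiso.
  by rewrite hausdorff_isometry// => x y _ _; rewrite enorm_row_cons.
- by move=> b t; rewrite cylE hausdorff_isometry// => x y _ _; rewrite Tiso.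
- move=> oO; rewrite BE; apply: (open_isometry_preimage (f := T \o row_cons a)) oO => x y /=.
  by rewrite Tiso enorm_row_cons.
- move=> M secM y By i.
  have xsec : section u a O (T (row_cons a y)).
    by rewrite secE; exists (row_cons a y) => //; exists y.
  apply: le_trans (secM _ xsec); rewrite -(row_consS a) -[T _]subr0 -T0 Tiso subr0.
  exact: coord_le_enorm.
Qed.

(** The form in which Fubini's theorem enters: the same constant [c] serves all
    directions, bases and levels. *)
Lemma hausdorff_cylinder : exists2 c : R, 0 < c &
  forall u O (M a b : R) m, dot u u = 1 -> open O ->
    (forall x, section u a O x -> enorm x <= M) ->
  hausdorff d.+1 (cylinder u a b m.+1%:R^-1 O) =
    ((c / m.+1%:R)%:E * hausdorff d (section u a O))%E.
Proof.
have [c c0 H] := @hausdorff_prism R d; exists c => // u O M a b m u1 oO secM.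
have [B [-> -> /(_ oO) oB /(_ M secM) BM]] := hausdorff_section d a O u1.
exact: H oB BM b m.
Qed.

Lemma hausdorff_section_fin u a O (M : R) : dot u u = 1 ->
  (forall x, section u a O x -> enorm x <= M) ->
  (hausdorff d (section u a O) < +oo)%E.
Proof.
move=> u1 secM; have [B [-> _ _ /(_ M secM) BM]] := hausdorff_section d a O u1.
exact: hausdorff_bounded BM.
Qed.

Lemma hausdorff_section_gt0 u a O x : dot u u = 1 -> open O ->
  section u a O x -> (0 < hausdorff d (section u a O))%E.
Proof.
move=> u1 oO xO; have [T [B [Tiso T0 secE _ BE]]] := section_isometry a O u1.
rewrite secE hausdorff_isometry; last by move=> y z _ _; rewrite Tiso.
rewrite hausdorff_isometry; last by move=> y z _ _; rewrite enorm_row_cons.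
have oB : open B.
  rewrite BE; apply: (open_isometry_preimage (f := T \o row_cons a)) oO => y z /=.
  by rewrite Tiso enorm_row_cons.
move: xO; rewrite secE => -[_ [y By _] _].
have /nbhs_ballP[e /= e0 yB] : nbhs y B by exact: open_nbhs_nbhs.
apply: (@hausdorff_gt0 _ _ B y (e / 2)); first by rewrite divr_gt0.
move=> z zy; apply: yB; rewrite -ball_normE /= distrC.
apply: (@le_lt_trans _ _ (e / 2)); last by lra.
by apply: norm_le_coord => [|i]; [rewrite ltW// divr_gt0|have := zy i; rewrite !mxE].
Qed.

(** Infinitely many disjoint translates of the flat fit into a bounded piece of
    the hyperplane. *)
Lemma hausdorff_flat_null u v (a b M : R) : dot u u = 1 -> dot v v = 1 ->
  v != u -> v != - u ->
  hausdorff d [set x | [/\ dot x u = a, dot x v = b & enorm x <= M]] = 0%E.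
Proof.
move=> u1 v1 vu vNu; set F := [set x | _].
have [w wE] : exists w, w = v - dot u v *: u by exists (v - dot u v *: u).
have wu : dot w u = 0 by rewrite wE !dotE u1 (dotC v u); ring.
have wv : dot w v = 1 - dot u v ^+ 2 by rewrite wE !dotE v1; ring.
have wv0 : dot w v != 0.
  rewrite wv; apply/negP => /eqP uv.
  have : (1 - dot u v) * (1 + dot u v) = 0 by rewrite -uv; ring.
  move/eqP; rewrite mulf_eq0 => /orP[|] /eqP uv1.
    move/eqP: vu; apply; apply/eqP; rewrite -subr_eq0 -dot_eq0 !dotE u1 v1 (dotC v u).
    by apply/eqP; lra.
  move/eqP: vNu; apply; apply/eqP; rewrite -subr_eq0 -dot_eq0 !dotE u1 v1 (dotC v u).
  by apply/eqP; lra.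
pose G i := [set x + i.+1%:R^-1 *: w | x in F].
pose C := section u a [set x | enorm x <= M + enorm w].
have GC i : G i `<=` C.
  move=> _ [x [xu xv xM] <-]; split; first by rewrite !dotE xu wu mulr0 addr0.
  rewrite /=; apply: le_trans (enormD _ _) _; apply: lerD => //.
  rewrite enormZ ger0_norm ?invr_ge0// ler_piMl ?enorm_ge0//.
  by rewrite invf_le1// ler1n.
have Cfin : (hausdorff d C < +oo)%E.
  by apply: (@hausdorff_section_fin _ _ _ (M + enorm w)) => // x [].
have mF : measurable (F : set (borel R d.+1)).
  have closedF (y : 'rV[R]_d.+1) (c : R) : measurable ([set x | dot x y <= c] : set (borel R d.+1)).
    rewrite -[X in measurable X]setCK; apply: measurableC; apply: sub_sigma_algebra.
    exact/closed_openC/closed_dot_le.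
  rewrite (_ : F = ([set x | dot x u <= a] `&` [set x | dot x (- u) <= - a]) `&`
    ([set x | dot x v <= b] `&` [set x | dot x (- v) <= - b]) `&` [set x | enorm x <= M]).
    apply: measurableI; first by apply: measurableI; apply: measurableI; exact: closedF.
    rewrite -[X in measurable X]setCK; apply: measurableC; apply: sub_sigma_algebra.
    exact/closed_openC/closed_enorm_le.
  apply/seteqP; split=> [x [xu xv xM]|x [[[/= h1 h2] [h3 h4]] h5]].
    by rewrite /= !dotNr xu xv.
  rewrite !dotNr !lerN2 in h2 h4.
  by split=> //; apply/eqP; rewrite eq_le ?h1 ?h2 ?h3 ?h4.
have mG i : measurable (G i : set (borel R d.+1)).
  rewrite (_ : G i = (fun x => x - i.+1%:R^-1 *: w) @^-1` F).
    apply: measurable_preimage_continuous => //; apply: isometry_continuous => x y.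
    by rewrite opprB addrA subrK.
  apply/seteqP; split=> [_ [x Fx <-]|x Fx]; first by rewrite /= addrK.
  by exists (x - i.+1%:R^-1 *: w) => //; rewrite subrK.
have tG : trivIset setT G.
  move=> i j _ _ [z [[x [_ xv _] <-] [y [_ yv _] E]]].
  have : dot (x + i.+1%:R^-1 *: w) v = dot (y + j.+1%:R^-1 *: w) v by rewrite E.
  rewrite !dotE xv yv => /addrI/(mulIf wv0)/invr_inj/eqP.
  by rewrite eqr_nat eqSS => /eqP.
have HG i : hausdorff d (G i) = hausdorff d F by exact: hausdorff_translate.
have Ffin : hausdorff d F \is a fin_num.
  rewrite ge0_fin_numE ?hausdorff_ge0// -(HG 0%N).
  exact: le_lt_trans (le_hausdorff d (GC 0%N)) Cfin.
have Cfin' : hausdorff d C \is a fin_num by rewrite ge0_fin_numE ?hausdorff_ge0.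
have bound k : (k%:R%:E * hausdorff d F <= hausdorff d C)%E.
  apply: le_trans (_ : _ <= hausdorff d (\big[setU/set0]_(i < k) G i))%E _; last first.
    apply: le_hausdorff; elim/big_ind: _ => //.
    by move=> A B AC BC x [/AC|/BC].
  have mG' i : measurable (G i : set (caratheodory_type (@hausdorff R d.+1 d))).
    exact: caratheodory_borel.
  have E := @measure_bigsetU _ _ _ (@hausdorff_measure R d.+1 d) G mG' tG k.
  rewrite -[leRHS]/(hausdorff_measure d _) [leRHS]E.
  rewrite (eq_bigr (fun=> (fine (hausdorff d F))%:E)); last first.
    by move=> i _; rewrite fineK//; exact: HG.
  by rewrite sumEFin sumr_const card_ord -[X in (_ <= X%:E)%E]mulr_natl EFinM fineK.
apply/eqP; rewrite eq_le hausdorff_ge0 andbT.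
rewrite -(fineK Ffin) lee_fin leNgt; apply/negP => F0.
have := bound (Num.bound (fine (hausdorff d C) / fine (hausdorff d F))).
rewrite -(fineK Ffin) -(fineK Cfin') -EFinM lee_fin leNgt => /negP; apply.
rewrite -ltr_pdivrMr//; apply: archi_boundP.
by rewrite divr_ge0// ?fine_ge0 ?hausdorff_ge0// ltW.
Qed.

End Cylinders.

(** * Polytopes: vertices and facets *)

Section Polyhedra.
Context {R : realType} {n : nat}.
Implicit Types (x y z w : 'rV[R]_n) (C V : set 'rV[R]_n).

Lemma convexP C : convex_set C <->
  forall x y t, C x -> C y -> 0 <= t <= 1 -> C (t *: x + (1 - t) *: y).
Proof.
split=> [cC x y t Cx Cy /andP[t0 t1]|cC x y t /set_mem Cx /set_mem Cy].
  by have := cC x y (Itv01 t0 t1) (mem_set Cx) (mem_set Cy) => /set_mem.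
by apply: mem_set; apply: cC => //; apply/andP; split; [exact: ge0|exact: le1].
Qed.

Lemma convex_conv_hull V : convex_set (conv_hull V).
Proof.
apply/convexP => x y t Vx Vy t01 C [cC VC].
by move/convexP: (cC); apply=> //; [exact: Vx|exact: Vy].
Qed.

Lemma sub_conv_hull V : V `<=` conv_hull V.
Proof. exact: sub_gen_smallest. Qed.

Lemma conv_hull_min V C : convex_set C -> V `<=` C -> conv_hull V `<=` C.
Proof. exact: smallest_sub. Qed.

Lemma convex_dot_le (y : 'rV[R]_n) (c : R) : convex_set [set x | dot x y <= c].
Proof.
apply/convexP => x z t /= xc zc /andP[t0 t1]; rewrite !dotE.
have := ler_wpM2l t0 xc; have : 0 <= 1 - t by rewrite subr_ge0.
by move=> /ler_wpM2l/(_ _ _ zc); lra.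
Qed.

Lemma convex_sum C : convex_set C ->
  forall N (v : 'I_N -> 'rV[R]_n) (l : 'I_N -> R), (forall k, C (v k)) ->
  (forall k, 0 <= l k) -> \sum_k l k = 1 -> C (\sum_k l k *: v k).
Proof.
move=> cC; elim=> [|N IH] v l Cv l0 l1.
  by move: l1; rewrite big_ord0 => /esym/eqP; rewrite oner_eq0.
rewrite big_ord_recr /=; set m := l ord_max.
have lE : \sum_(k < N) l (widen_ord (leqnSn N) k) = 1 - m.
  by rewrite -l1 big_ord_recr addrK.
have [m1|m1] := eqVneq m 1.
  rewrite big1 ?add0r ?m1 ?scale1r// => k _.
  have : \sum_(k < N) l (widen_ord (leqnSn N) k) == 0 by rewrite lE m1 subrr.
  rewrite psumr_eq0// => /allP/(_ k (mem_index_enum _)) /eqP ->.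
  by rewrite scale0r.
have m_le1 : m <= 1.
  by rewrite -subr_ge0 -lE; apply: sumr_ge0.
have m_lt1 : 0 < 1 - m by rewrite subr_gt0 lt_neqAle m1.
have := IH (v \o widen_ord (leqnSn N)) (fun k => l (widen_ord (leqnSn N) k) / (1 - m)).
move=> /(_ (fun k => Cv _)) /(_ (fun k => divr_ge0 (l0 _) (ltW m_lt1))).
rewrite -mulr_suml lE divff ?gt_eqF// => /(_ erefl) Cs.
move/convexP: cC => /(_ _ _ m (Cv ord_max) Cs) /(_ _)/wrap[]; first by rewrite l0.
rewrite addrC scaler_sumr; congr (C (_ + _)); apply: eq_bigr => k _ /=.
by rewrite scalerA mulrC divfK// gt_eqF.
Qed.

Definition polyhedron {N} (v : 'I_N -> 'rV[R]_n) (b : 'I_N -> R) : set 'rV[R]_n :=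
  [set x | forall k, dot x (v k) <= b k].

Definition facet_interior {N} (v : 'I_N -> 'rV[R]_n) (b : 'I_N -> R) k : set 'rV[R]_n :=
  [set x | dot x (v k) = b k /\ forall j, j != k -> dot x (v j) < b j].

Section Vertices.
Variables (N : nat) (v : 'I_N -> 'rV[R]_n) (b : 'I_N -> R) (M : R).
Hypothesis bounded : forall x, polyhedron v b x -> enorm x <= M.

Let active x := [set k | dot x (v k) == b k]%SET.

(** Extreme points, described by the constraints active at them. *)
Let vertex : set 'rV[R]_n := [set x | polyhedron v b x /\
  forall w, (forall k, k \in active x -> dot w (v k) = 0) -> w = 0].

Let finite_vertex : finite_set vertex.
Proof.
pose g (S : {set 'I_N}) := xget 0 [set x | vertex x /\ active x = S].
apply: (@sub_finite_set _ _ (g @` [set: {set 'I_N}])); last first.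
  by apply: finite_image; exact: finite_finset.
move=> x vx; exists (active x) => //; rewrite /g.
case: xgetP => [y _ [[_ vy] yx]|/(_ x)[]//].
apply/eqP; rewrite -subr_eq0; apply/eqP/vy => k.
rewrite yx => kx; have : k \in active y by rewrite yx.
by move: kx; rewrite !inE => /eqP xk /eqP yk; rewrite dotBl xk yk subrr.
Qed.

(** A bounded polyhedron is left along every line; the first constraint that
    stops the motion becomes active. *)
Let hit x w : polyhedron v b x -> w != 0 ->
  (forall k, k \in active x -> dot w (v k) = 0) ->
  exists t, [/\ 0 < t, polyhedron v b (x + t *: w) &
    active x \proper active (x + t *: w)]%SET.
Proof.
move=> xP w0 wx.
have [k0 k0w] : exists k, 0 < dot w (v k).
  apply: contrapT => nk.
  have wk k : dot w (v k) <= 0 by rewrite leNgt; apply/negP => kw; apply: nk; exists k.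
  have xw s : 0 <= s -> polyhedron v b (x + s *: w).
    move=> s0 k; rewrite !dotE; apply: le_trans (xP k).
    by rewrite gerDl; apply: mulr_ge0_le0.
  have w_gt0 := enorm_gt0 w0.
  pose s := (M + enorm x + 1) / enorm w.
  have M0 : 0 <= M by apply: le_trans (bounded xP); exact: enorm_ge0.
  have s0 : 0 <= s by rewrite divr_ge0 ?addr_ge0 ?enorm_ge0.
  have := bounded (xw s s0); have := enormD (x + s *: w) (- x).
  rewrite [x + _]addrC addrK enormN enormZ ger0_norm// /s divfK ?gt_eqF//.
  by lra.
pose F k := (b k - dot x (v k)) / dot w (v k).
have [i iw imin] := @arg_minP _ _ _ k0 (fun k => 0 < dot w (v k)) F k0w.
have Fi : 0 < F i.
  rewrite divr_gt0// subr_gt0 lt_neqAle xP andbT; apply/negP => xi.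
  by move: iw; rewrite wx ?ltxx// inE.
exists (F i); split=> //.
  move=> k; rewrite !dotE; have [kw|kw] := ltP 0 (dot w (v k)).
    by rewrite -lerBrDl -ler_pdivlMr// imin.
  apply: le_trans (xP k); rewrite gerDl; apply: mulr_ge0_le0 => //; exact: ltW.
apply/properP; split.
  apply/fintype.subsetP => k kx; rewrite inE !dotE wx// mulr0 addr0.
  by move: kx; rewrite inE.
exists i.
  by rewrite inE dotDl dotZl divfK ?(lt0r_neq0 iw)// addrC subrK.
by rewrite inE; apply/negP => xi; move: iw; rewrite wx ?ltxx// inE.
Qed.

(** A point that is not a vertex can be moved in two opposite directions until
    new constraints become active. *)
Lemma polyhedron_conv_hull : exists2 V, finite_set V & polyhedron v b = conv_hull V.
Proof.
exists vertex => //; apply/seteqP; split; last first.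
  apply: conv_hull_min => [|x []//]; apply/convexP => x y t xP yP t01 k.
  by have /convexP := @convex_dot_le (v k) (b k); apply=> //; [exact: xP|exact: yP].
suff H m x : (#|~: active x| < m)%N -> polyhedron v b x -> conv_hull vertex x.
  by move=> x; exact: H (ltnSn _).
elim: m x => // m IH x; rewrite ltnS => xm xP.
have [vx|nvx] := pselect (vertex x); first exact: sub_conv_hull.
have [w [w0 wx]] : exists w, w != 0 /\ forall k, k \in active x -> dot w (v k) = 0.
  apply: contrapT => nw; apply: nvx; split=> // w wx.
  by apply/eqP/negP => /negP w0; apply: nw; exists w.
have [t [t0 tP tx]] := hit xP w0 wx.
have [|k kx|s [s0 sP sx]] := @hit x (- w) xP; first by rewrite oppr_eq0.
  by rewrite dotNl wx ?oppr0.
have step y : active x \proper active y -> (#|~: active y| < m)%N.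
  move=> /proper_card xy; apply: leq_trans xm.
  by have := cardsC (active x); have := cardsC (active y); lia.
have tH := IH _ (step _ tx) tP; have sH := IH _ (step _ sx) sP.
have ts0 : 0 < t + s by rewrite addr_gt0.
have := (convexP _).1 (@convex_conv_hull vertex) _ _ (s / (t + s)) tH sH.
have -> : s / (t + s) *: (x + t *: w) + (1 - s / (t + s)) *: (x + s *: - w) = x.
  by apply/rowP => i; rewrite !mxE; field; rewrite gt_eqF.
apply; rewrite divr_ge0 ?(ltW ts0) ?(ltW s0)//=.
by rewrite ler_pdivrMr// mul1r lerDr ltW.
Qed.

End Vertices.

(** The hull is the image of a simplex under barycentric combination. *)
Lemma compact_conv_hull V : finite_set V -> compact (conv_hull V).
Proof.
move=> /finite_seqP[s ->]; set N := size s; pose v (k : 'I_N) := s`_k.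
pose S : set 'rV[R]_N := [set l | (forall k, 0 <= l 0 k) /\ \sum_k l 0 k = 1].
pose f (l : 'rV[R]_N) := \sum_k l 0 k *: v k.
have fS : conv_hull [set` s] = f @` S.
  apply/seteqP; split.
    apply: conv_hull_min; last first.
      move=> x /= xs; have xN : (index x s < N)%N by rewrite index_mem.
      exists (delta_mx 0 (Ordinal xN)).
        split=> [k|]; first by rewrite mxE.
        rewrite (bigD1 (Ordinal xN))//= mxE !eqxx big1 ?addr0// => k kx.
        by rewrite mxE eqxx (negbTE kx).
      rewrite /f (bigD1 (Ordinal xN))//= mxE !eqxx scale1r big1 ?addr0.
        by rewrite /v nth_index.
      by move=> k kx; rewrite mxE eqxx (negbTE kx) scale0r.
    apply/convexP => _ _ t [l [l0 l1] <-] [m [m0 m1] <-] /andP[t0 t1].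
    exists (t *: l + (1 - t) *: m).
      split=> [k|]; first by rewrite !mxE addr_ge0// mulr_ge0// subr_ge0.
      under eq_bigr do rewrite !mxE.
      by rewrite big_split/= -!mulr_sumr l1 m1; ring.
    rewrite /f !scaler_sumr -big_split/=; apply: eq_bigr => k _.
    by rewrite !mxE !scalerA -scalerDl.
  move=> _ [l [l0 l1] <-]; apply: convex_sum => //; first exact: convex_conv_hull.
  by move=> k; apply: sub_conv_hull; rewrite /= mem_nth.
rewrite fS; apply: continuous_compact.
  apply: continuous_subspaceT => l A /nbhs_enorm[e e0 lA].
  pose K := \sum_k enorm (v k) + 1.
  have K0 : 0 < K by rewrite ltr_wpDl// sumr_ge0// => k _; exact: enorm_ge0.
  apply/nbhs_enorm; exists (e / K); first by rewrite divr_gt0.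
  move=> m ml; apply: lA; rewrite /f -sumrB.
  apply: (@le_lt_trans _ _ (enorm (m - l) * \sum_k enorm (v k))).
    rewrite mulr_sumr; elim/big_ind2: _ => [|x a y c xa yc|k _]; first by rewrite enorm0.
      by apply: le_trans (enormD _ _) _; exact: lerD.
    rewrite -scalerBl enormZ ler_wpM2r ?enorm_ge0//.
    by have := coord_le_enorm (m - l) k; rewrite !mxE.
  apply: (@le_lt_trans _ _ (enorm (m - l) * K)); last by rewrite -ltr_pdivlMr.
  by rewrite ler_wpM2l ?enorm_ge0// lerDl.
apply: (@compact_enorm _ _ _ N%:R); last first.
  move=> l [l0 l1]; rewrite -[N%:R]mulr1; apply: enorm_le_coord => // k.
  by rewrite ger0_norm// -l1 (bigD1 k)//= lerDl sumr_ge0.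
have c (k : 'I_N) : continuous (fun l : 'rV[R]_N => l 0 k) by exact: coord_continuous.
rewrite (_ : S = (\bigcap_(k in setT) [set l : 'rV[R]_N | 0 <= l 0 k]) `&`
                 (fun l : 'rV[R]_N => \sum_k l 0 k) @^-1` [set 1]).
  apply: closedI.
    apply: closed_bigI => k _.
    by apply: (preimage_closed (f := fun l : 'rV[R]_N => l 0 k) _ (@closed_ge _ 0)) => l _; exact: c.
  apply: preimage_closed (@closed_eq _ 1) => l _.
  by apply: continuous_sumr => k _; exact: c.
by apply/seteqP; split=> l [l0 l1]; split=> // k; [move=> _|]; exact: l0.
Qed.

(** The hyperplane through the point of [C] nearest to [x]. *)
Lemma separation C x : compact C -> convex_set C -> C !=set0 -> ~ C x ->
  exists y, forall z, C z -> dot z y < dot x y.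
Proof.
move=> kC cC C0 nCx.
have [|z0 /set_mem Cz0 z0min] := @compact_EVT_min _ R (fun z => enorm (z - x)) C C0 kC.
  apply: continuous_subspaceT => z.
  apply: (@continuous_comp _ _ _ (fun z => z - x) (@enorm R n)); last exact: enorm_continuous.
  by apply: isometry_continuous => a b; rewrite opprB addrA subrK.
exists (x - z0) => z Cz.
have xz0 : 0 < dot (x - z0) (x - z0).
  by apply: dot_gt0; rewrite subr_eq0; apply/eqP => xz; apply: nCx; rewrite xz.
suff : dot (z - z0) (x - z0) <= 0.
  by move=> h; move: xz0 h; rewrite !(dotBl _ _ (x - z0)); lra.
rewrite leNgt; apply/negP; set a := dot _ _ => a0.
pose c := dot (z - z0) (z - z0).
have c0 : 0 <= c by exact: dot_ge0.
pose t := a / (a + c).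
have ac : 0 < a + c by rewrite ltr_pwDl.
have t0 : 0 < t by rewrite divr_gt0.
have t1 : t <= 1 by rewrite ler_pdivrMr// mul1r lerDl.
have Ct : C (t *: z + (1 - t) *: z0).
  by move/convexP: cC; apply=> //; rewrite (ltW t0).
have := z0min _ (mem_set Ct).
rewrite -(@ler_pXn2r _ 2%N)// ?nnegrE ?enorm_ge0// !enorm_sqr.
have -> : t *: z + (1 - t) *: z0 - x = t *: (z - z0) - (x - z0).
  by apply/rowP => i; rewrite !mxE; ring.
have -> : dot (z0 - x) (z0 - x) = dot (x - z0) (x - z0).
  by rewrite -opprB dotNl dotNr opprK.
have expand p q : dot (t *: p - q) (t *: p - q) = t * t * dot p p - 2 * t * dot p q + dot q q.
  by rewrite !dotE (dotC q p); ring.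
rewrite expand -/a -/c.
have tac : t * (a + c) = a by rewrite divfK ?gt_eqF.
by nra.
Qed.

End Polyhedra.

Section PolytopeFacets.
Context {R : realType} {n : nat}.
Implicit Types (x y z w : 'rV[R]_n) (C V : set 'rV[R]_n).

(** The vertices of the polar body of [conv_hull V] are the normals of a
    description of [conv_hull V] by inequalities, and those of a minimal such
    description define facets. *)
Lemma polytope_facets V : finite_set V -> interior (conv_hull V) 0 ->
  exists (N : nat) (u : 'I_N -> 'rV[R]_n) (h : 'I_N -> R),
  [/\ forall k, dot (u k) (u k) = 1, forall k, 0 < h k,
      conv_hull V = polyhedron u h & forall k, facet_interior u h k !=set0].
Proof.
move=> finV /nbhs_enorm[r r0 rV]; set P := conv_hull V in rV *.
have [s Vs] := (finite_seqP _).1 finV.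
pose v (k : 'I_(size s)) := s`_k.
have vV k : V (v k) by rewrite Vs /= mem_nth.
have PQ y : polyhedron v (fun=> 1) y -> forall x, P x -> dot x y <= 1.
  move=> yQ; apply: conv_hull_min; first exact: convex_dot_le.
  rewrite Vs => x /= xs; have xN : (index x s < size s)%N by rewrite index_mem.
  by have := yQ (Ordinal xN); rewrite /v /= nth_index// dotC.
have Qb y : polyhedron v (fun=> 1) y -> enorm y <= 2 / r.
  move=> yQ; have [->|y0] := eqVneq y 0; first by rewrite enorm0 divr_ge0// ltW.
  have ey0 := enorm_gt0 y0.
  have c0 : 0 < r / 2 / enorm y by rewrite !divr_gt0.
  have := PQ y yQ (r / 2 / enorm y *: y); rewrite dotZl -enorm_sqr expr2 mulrA divfK ?gt_eqF//.
  move=> H; rewrite ler_pdivlMr//.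
  have {H} : r / 2 * enorm y <= 1.
    apply: H; apply: rV; rewrite subr0 enormZ gtr0_norm// divfK ?gt_eqF//; lra.
  by lra.
have [W finW QW] := polyhedron_conv_hull Qb.
have [t Wt] := (finite_seqP _).1 finW.
pose w (i : 'I_(size t)) := t`_i.
pose rep (A : {set 'I_(size t)}) := `[< forall x, (forall i, i \in A -> dot x (w i) <= 1) -> P x >].
have Pw x : P x -> forall i, dot x (w i) <= 1.
  move=> Px i; apply: PQ => //; rewrite QW; apply: sub_conv_hull.
  by rewrite Wt /= mem_nth.
have repT : rep [set: _]%SET.
  apply/asboolP => x xw; apply: contrapT => nPx.
  have [] := @separation _ _ P x (compact_conv_hull finV) (@convex_conv_hull _ _ V) _ nPx.
    by exists 0; apply: rV; rewrite subrr enorm0.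
  move=> y yP.
  have P0 : P 0 by apply: rV; rewrite subrr enorm0.
  have xy0 : 0 < dot x y by have := yP _ P0; rewrite dot0l.
  have [c [c0 cP cx]] : exists c, [/\ 0 < c, forall z, P z -> c * dot z y <= 1 & 1 < c * dot x y].
    pose zmax := [set dot z y | z in P].
    have [z1 /set_mem Pz1 z1max] : exists2 c, c \in P & forall t, t \in P -> dot t y <= dot c y.
      apply: compact_EVT_max; [by exists 0|exact: compact_conv_hull|].
      by apply: continuous_subspaceT; exact: dot_continuous.
    pose m := (Num.max 0 (dot z1 y) + dot x y) / 2.
    have z1x := yP _ Pz1.
    have m0 : 0 < m by rewrite divr_gt0// ltr_wpDl// le_max lexx.
    have mx : m < dot x y.
      have : Num.max 0 (dot z1 y) < dot x y by rewrite gt_max xy0.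
      by rewrite /m; lra.
    exists m^-1; split; first by rewrite invr_gt0.
      move=> z Pz; rewrite mulrC ler_pdivrMr// mul1r.
      apply: le_trans (z1max _ (mem_set Pz)) _.
      have : dot z1 y <= Num.max 0 (dot z1 y) by rewrite le_max lexx orbT.
      have : Num.max 0 (dot z1 y) < dot x y by rewrite gt_max xy0.
      by rewrite /m; lra.
    by rewrite mulrC ltr_pdivlMr// mul1r.
  have : polyhedron v (fun=> 1) (c *: y).
    by move=> k; rewrite dotZl dotC; apply: cP; apply: sub_conv_hull.
  rewrite QW => Wcy; have : dot (c *: y) x <= 1.
    move: (c *: y) Wcy; apply: conv_hull_min; first exact: convex_dot_le.
    rewrite Wt => z /= zt; have zN : (index z t < size t)%N by rewrite index_mem.
    by have := xw (Ordinal zN) (finset.in_setT _); rewrite /w /= nth_index// dotC.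
  by rewrite dotZl dotC leNgt cx.
have [A /minsetP[/asboolP repA minA] _] := minset_exists repT.
(* By minimality some point violates the inequality of [w i] only; scaled down
   to satisfy it with equality, it satisfies the others strictly. *)
have wit i : i \in A -> exists y, dot y (w i) = 1 /\
    forall j, j \in A -> j != i -> dot y (w j) < 1.
  move=> iA; have : ~ rep (A :\ i)%SET.
    move=> /minA /(_ (subD1set _ _)) E.
    by move: iA; rewrite -E !inE eqxx.
  move=> nrep; have /existsNP[x /not_implyP[xA nPx]] := fun H => nrep (asboolT H).
  have xi : 1 < dot x (w i).
    rewrite ltNge; apply/negP => xi; apply: nPx; apply: repA => j jA.
    by have [->//|ji] := eqVneq j i; apply: xA; rewrite !inE ji.
  have xi0 : 0 < dot x (w i) by exact: lt_trans xi.
  exists ((dot x (w i))^-1 *: x); split; first by rewrite dotZl mulVf// gt_eqF.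
  move=> j jA ji; rewrite dotZl mulrC ltr_pdivrMr// mul1r.
  by apply: le_lt_trans xi; apply: xA; rewrite !inE ji.
have w0 i : i \in A -> 0 < enorm (w i).
  move=> /wit[y [y1 _]]; apply: enorm_gt0; apply/eqP => wi0.
  by move: y1; rewrite wi0 dot0r => /esym/eqP; rewrite oner_eq0.
pose wA (k : 'I_#|A|) := w (enum_val k).
have wA0 k : 0 < enorm (wA k) by apply: w0; exact: enum_valP.
exists #|A|, (fun k => (enorm (wA k))^-1 *: wA k), (fun k => (enorm (wA k))^-1).
have dotA x k : (dot x ((enorm (wA k))^-1 *: wA k) <= (enorm (wA k))^-1) = (dot x (wA k) <= 1).
  by rewrite dotZr -[leRHS]mulr1 ler_pM2l ?invr_gt0.
split.
- by move=> k; rewrite dotZl dotZr -enorm_sqr; field; rewrite gt_eqF.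
- by move=> k; rewrite invr_gt0.
- apply/seteqP; split=> [x Px k|x xw]; first by rewrite dotA; exact: Pw.
  apply: repA => i iA; have := xw (enum_rank_in iA i).
  by rewrite dotA /wA enum_rankK_in.
- move=> k; have [y [y1 yj]] := wit _ (enum_valP k).
  exists y; split; first by rewrite dotZr y1 mulr1.
  move=> j jk; rewrite dotZr -[ltRHS]mulr1 ltr_pM2l ?invr_gt0//.
  by apply: yj; [exact: enum_valP|rewrite (inj_eq enum_val_inj)].
Qed.

End PolytopeFacets.

(** * The surface area measure of a polytope given by its facets *)

Section SurfaceArea.
Context {R : realType} {n N : nat}.
Variables (u : 'I_N -> 'rV[R]_n) (h : 'I_N -> R).
Hypothesis u1 : forall k, dot (u k) (u k) = 1.
Implicit Types (x y z w : 'rV[R]_n).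
Notation P := (polyhedron u h).
Notation D := (facet_interior u h).

Lemma polyhedron_closed : closed P.
Proof.
rewrite (_ : P = \bigcap_(k in setT) [set x | dot x (u k) <= h k]).
  by apply: closed_bigI => k _; exact: closed_dot_le.
by apply/seteqP; split=> [x xP k _|x xP k]; [exact: xP|exact: (xP k I)].
Qed.

Lemma open_dot_lt_family (Q : pred 'I_N) (b : 'I_N -> R) :
  open [set x | forall k, Q k -> dot x (u k) < b k].
Proof.
rewrite openE => x xb.
apply: (@filter_forall _ _ (fun k => [set y | Q k -> dot y (u k) < b k]) _ (nbhs_filter x)) => k.
have [Qk|nQk] := boolP (Q k); last by apply: filterE => y.
have : nbhs x [set y | dot y (u k) < b k].
  by apply: open_nbhs_nbhs; split; [exact: open_dot_lt|exact: xb].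
by apply: filterS => y /= yb _.
Qed.

Lemma open_step (O : set 'rV[R]_n) x w : open O -> O x ->
  exists2 e, 0 < e & O (x + e *: w).
Proof.
move=> oO Ox; have /nbhs_enorm[r r0 xO] : nbhs x O by exact: open_nbhs_nbhs.
have w1 : 0 < enorm w + 1 by rewrite ltr_wpDl// enorm_ge0.
exists (r / 2 / (enorm w + 1)); first by rewrite !divr_gt0.
apply: xO; rewrite addrC addKr enormZ gtr0_norm ?divr_gt0//.
rewrite mulrAC ltr_pdivrMr//; have := enorm_ge0 w; nra.
Qed.

Lemma interior_polyhedron x : interior P x <-> forall k, dot x (u k) < h k.
Proof.
split=> [|xP].
  move=> /nbhs_enorm[e e0 xP] k.
  have : P (x + e / 2 *: u k).
    apply: xP; rewrite addrC addKr enormZ gtr0_norm ?divr_gt0// /enorm u1 sqrtr1; lra.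
  move=> /(_ k); rewrite !dotE u1; lra.
have oO := @open_dot_lt_family xpredT h.
have : [set y | forall k, xpredT k -> dot y (u k) < h k] `<=` P.
  by move=> y yP k; rewrite ltW// yP.
by rewrite (open_subsetE _ oO); apply => k _.
Qed.

Lemma outer_normal_facet x k : P x -> dot x (u k) = h k -> outer_unit_normal P x (u k).
Proof.
move=> Px xk; split; first by rewrite /sphere /= /enorm u1 sqrtr1.
by move=> y Py; rewrite xk.
Qed.

Lemma facet_interior_sub k : D k `<=` P.
Proof. by move=> x [xk xj] j; have [->|/xj/ltW//] := eqVneq j k; rewrite xk. Qed.

(** From a point in the relative interior of a facet one can move within the
    hyperplane of the facet in all directions, and inward; hence an outer normal
    there is a nonnegative multiple of [u k]. *)
Lemma unique_normal x k w : D k x -> outer_unit_normal P x w -> w = u k.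
Proof.
move=> Dx [/= w1 wP]; have [xk xj] := Dx.
have ww : dot w w = 1 by rewrite -enorm_sqr w1 expr1n.
have oO := @open_dot_lt_family [pred j | j != k] h.
have xO : [set x | forall j, [pred j | j != k] j -> dot x (u j) < h j] x by [].
have [z zE] : exists z, z = w - dot w (u k) *: u k by exists (w - dot w (u k) *: u k).
have zu : dot z (u k) = 0 by rewrite zE !dotE u1; ring.
have zw : dot z w = dot z z by rewrite {3}zE !dotE zu; ring.
have [e e0 /= eO] := open_step z oO xO.
have zz : dot z z = 0.
  apply/eqP; rewrite eq_le dot_ge0 andbT -zw.
  have : P (x + e *: z).
    move=> j; have [->|jk] := eqVneq j k; last exact/ltW/eO.
    by rewrite !dotE zu xk mulr0 addr0.
  by move=> /wP; rewrite !dotE gerDl pmulr_rle0.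
have wE : w = dot w (u k) *: u k.
  by apply/eqP; rewrite -subr_eq0 -zE -dot_eq0 zz.
have [e' e'0 /= eO'] := open_step (- u k) oO xO.
have wu : 0 <= dot w (u k).
  have : P (x + e' *: - u k).
    move=> j; have [->|jk] := eqVneq j k; last exact/ltW/eO'.
    by rewrite !dotE u1 xk; lra.
  by move=> /wP; rewrite !dotE gerDl pmulr_rle0// oppr_le0 dotC.
suff wu1 : dot w (u k) = 1 by move: wE; rewrite wu1 scale1r.
have : dot w (u k) ^+ 2 = 1.
  have : dot w w = dot w (dot w (u k) *: u k) by rewrite -wE.
  by rewrite ww dotZr -expr2.
by move/eqP; rewrite sqrf_eq1 => /orP[/eqP//|/eqP wN]; move: wu; rewrite wN; lra.
Qed.

Lemma gauss_mapE x k : D k x -> gauss_map P x = u k.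
Proof.
move=> Dx; rewrite /gauss_map; case: xgetP => [y _ yn|nn].
  exact: unique_normal Dx yn.
exfalso; apply: (nn (u k)); apply: outer_normal_facet; last by case: Dx.
exact: facet_interior_sub Dx.
Qed.

(** A point on two facets has two outer normals. *)
Lemma regular_boundaryE : injective u ->
  regular_boundary P = \bigcup_(k in setT) D k.
Proof.
move=> uI; apply/seteqP; split=> [x [[clP nintP] [w [wn wuniq]]]|x [k _ Dx]].
  have Px : P x by rewrite -(closure_id _).1// in clP; exact: polyhedron_closed.
  have [k xk] : exists k, dot x (u k) = h k.
    apply: contrapT => nk; apply: nintP; apply/interior_polyhedron => k.
    by rewrite lt_neqAle Px andbT; apply/eqP => xk; apply: nk; exists k.
  exists k => //; split=> // j jk; rewrite lt_neqAle Px andbT; apply/eqP => xj.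
  move/eqP: jk; apply; apply: uI.
  by rewrite -(wuniq _ (outer_normal_facet Px xj)) -(wuniq _ (outer_normal_facet Px xk)).
have Px := facet_interior_sub Dx; have [xk _] := Dx; split.
  split; first exact: subset_closure.
  by move/interior_polyhedron => /(_ k); rewrite xk ltxx.
exists (u k); split; first exact: outer_normal_facet.
by move=> w /(unique_normal Dx).
Qed.

Local Open Scope ereal_scope.

Lemma measurable_facet_interior s k :
  measurable (D k : set (caratheodory_type (@hausdorff R n s))).
Proof.
rewrite (_ : D k = ([set x | forall j, [pred j | j != k] j -> (dot x (u j) < h j)%R] `\`
   [set x | forall j, pred1 k j -> (dot x (u j) < h j)%R]) `&` ~` [set x | (dot x (- u k) < - h k)%R]).
  apply: measurableI; last first.
    by apply: measurableC; apply: caratheodory_open; exact: open_dot_lt.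
  by apply: measurableD; apply: caratheodory_open; exact: open_dot_lt_family.
apply/seteqP; split=> [x [xk xj]|x [[xj xk] xk']].
  split; last by rewrite /= dotNr xk ltxx.
  by split=> // /(_ k (eqxx _)); rewrite xk ltxx.
split=> //; apply/eqP; rewrite eq_le; apply/andP; split.
  by move/negP: xk'; rewrite /= dotNr ltrN2 -leNgt.
rewrite leNgt; apply/negP => xk1; apply: xk => j /eqP ->; exact: xk1.
Qed.

(** On the relative interior of the [k]-th facet the Gauss map is constantly
    [u k] and the integrand is [h k `^ (1 - p)]. *)
Lemma surface_area_polyhedron (p : R) (omega : set 'rV[R]_n) : injective u -> (forall k, 0 < h k)%R ->
  surface_area_measure p P omega =
  \sum_(k < N) (h k `^ (1 - p))%:E * hausdorff n.-1 (D k) * \d_(u k : borel R n) omega.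
Proof.
move=> uI h0; rewrite /surface_area_measure; set E := _ `&` _.
have tD : trivIset setT D.
  move=> i j _ _ [x [[xi xi'] [xj xj']]]; apply/eqP/negP => /negP ij.
  by have := xj' i ij; rewrite xi ltxx.
have EE : E = \bigcup_(k in [set k | omega (u k)]) D k.
  apply/seteqP; split=> [x []|x [k /= ok Dx]].
    rewrite regular_boundaryE// => -[k _ Dx]; rewrite /preimage /= (gauss_mapE Dx).
    by exists k.
  by split; [rewrite regular_boundaryE//; exists k|rewrite /preimage /= (gauss_mapE Dx)].
have mD k := measurable_facet_interior n.-1 k.
have mE : measurable (E : set (caratheodory_type (@hausdorff R n n.-1))).
  rewrite EE; apply: fin_bigcup_measurable => //; exact: finite_finset.
pose T := caratheodory_type (@hausdorff R n n.-1).
pose g k (x : T) := ((h k `^ (1 - p))%:E * (\1_(D k) x)%:E).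
have g0 k x : 0 <= g k x by rewrite mule_ge0// lee_fin ?powR_ge0// indicE.
transitivity (\int[@hausdorff_measure R n n.-1]_(x in E) \sum_(k < N) g k x).
  apply: eq_integral => x /set_mem; rewrite EE => -[k /= ok Dx].
  rewrite (gauss_mapE Dx) (bigD1 k)//= big1 ?adde0; last first.
    move=> j jk; rewrite /g indicE memNset ?mule0// => Dj.
    by move/eqP: jk; apply; apply: (tD j k) => //; exists x.
  by rewrite /g indicE mem_set// mule1; case: Dx => ->.
rewrite ge0_integral_sum//; last first.
  by move=> k; apply/measurable_funeM/measurable_EFinP; exact: measurable_indic.
apply: eq_bigr => k _.
rewrite ge0_integralZl_EFin; last 4 first.
- exact: mE.
- by move=> x _; rewrite lee_fin indicE.
- by apply/measurable_EFinP; exact: measurable_indic.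
- exact: powR_ge0.
rewrite integral_indic// -muleA; congr (_ * _).
rewrite diracE; have [ok|nok] := pselect (omega (u k)).
  rewrite mem_set// mule1; congr (hausdorff _ _); rewrite EE.
  by apply/seteqP; split=> [x []//|x Dx]; split=> //; exists k.
rewrite memNset// mule0 (_ : _ `&` _ = set0) ?measure0// EE.
apply/seteqP; split=> // x [Dk [j /= oj Dj]]; apply: nok.
by rewrite (tD k j I I)//; exists x.
Qed.

End SurfaceArea.

(** * The functional of the variational problem *)

Section Powers.
Context {R : realType}.
Implicit Types (p x y a b q : R).

Lemma powR_continuous p x : 0 < x -> {for x, continuous (fun t => t `^ p)}.
Proof.
move=> x0; apply: differentiable_continuous; apply/derivable1_diffP.
by apply: derivable_powR; rewrite in_itv/= x0.
Qed.

(** A negative power is convex; by homogeneity the tangent inequality is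
    [1 + p * (r - 1) <= expR (p * ln r)] for the ratio [r = x / y]. *)
Lemma powR_tangent p x y : p < 0 -> 0 < x -> 0 < y ->
  y `^ p + p * y `^ (p - 1) * (x - y) <= x `^ p.
Proof.
move=> p0 x0 y0; have xy0 : 0 < x / y by rewrite divr_gt0.
have -> : x `^ p = y `^ p * (x / y) `^ p.
  by rewrite -powRM ?ltW// mulrC divfK// gt_eqF.
have -> : y `^ (p - 1) = y `^ p / y.
  rewrite powRB; last by rewrite (gt_eqF y0) implybT.
  by rewrite powRr1// ltW.
have -> : y `^ p + p * (y `^ p / y) * (x - y) = y `^ p * (1 + p * (x / y - 1)).
  by field; rewrite gt_eqF.
rewrite ler_pM2l ?powR_gt0// /powR gt_eqF//.
apply: le_trans (expR_ge1Dx _); rewrite lerD2l ler_nM2l//.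
by have := @le_ln1Dx R (x / y - 1); rewrite (addrC 1) subrK; apply; lra.
Qed.

Lemma powR_neg_le p x y : p < 0 -> 0 < x -> x <= y -> y `^ p <= x `^ p.
Proof.
move=> p0 x0 xy; have y0 := lt_le_trans x0 xy.
have e : forall z, 0 < z -> z `^ p = (z `^ (- p))^-1 by move=> z z0; rewrite powRN invrK.
rewrite !e// lef_pV2 ?posrE ?powR_gt0//.
by apply: ge0_ler_powR; rewrite ?nnegrE ?oppr_ge0// ltW.
Qed.

Lemma powR_gt1 a q : 1 < a -> 0 < q -> 1 < a `^ q.
Proof.
move=> a1 q0; have a0 : 0 < a by exact: lt_trans a1.
by rewrite /powR (gt_eqF a0) expR_gt1 mulr_gt0// ln_gt0.
Qed.

(** The maximality inequality in logarithmic form, which separates the variation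
    of the volume from that of the functional. *)
Lemma powR_compare q a b v w : 0 < q -> 0 < a -> 0 < b -> 0 < v -> 0 < w ->
  a * w `^ q <= b * v `^ q -> q * (ln w - ln v) <= ln b - ln a.
Proof.
move=> q0 a0 b0 v0 w0 h.
have : ln (a * w `^ q) <= ln (b * v `^ q).
  by rewrite ler_ln// ?posrE mulr_gt0 ?powR_gt0.
by rewrite !lnM ?posrE ?powR_gt0// !ln_powR; lra.
Qed.

Lemma ln_sub_le x y : 0 < x -> 0 < y -> ln x - ln y <= x / y - 1.
Proof.
move=> x0 y0; rewrite -lnV ?posrE// -lnM ?posrE ?invr_gt0//.
have := @le_ln1Dx R (x / y - 1); rewrite (addrC 1) subrK; apply.
have : 0 < x / y by rewrite divr_gt0.
by lra.
Qed.

Lemma finite_family_min N (f : 'I_N -> R) : (forall k, 0 < f k) ->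
  exists2 e, 0 < e & forall k, e <= f k.
Proof.
move=> f0; exists (\big[Num.min/1]_k f k).
  by elim/big_ind: _ => // x y x0 y0; rewrite lt_min x0.
by move=> k; exact: bigmin_le.
Qed.

End Powers.

Section Functional.
Context {R : realType} {n N : nat}.
Variables (u : 'I_N -> 'rV[R]_n) (alpha : 'I_N -> R) (p : R).
Hypothesis u1 : forall k, dot (u k) (u k) = 1.
Hypothesis alpha0 : forall k, 0 < alpha k.
Hypothesis p0 : p < 0.
Hypothesis spanning : forall w, w != 0 -> exists k, 0 < dot w (u k).
Implicit Types (x y z w : 'rV[R]_n) (h : 'I_N -> R).

(** The support numbers of the body translated by [- x]. *)
Definition recenter h x : 'I_N -> R := fun k => h k - dot x (u k).

(** Twice the sum of the positive parts of the [dot x (u k)] is positive on the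
    unit sphere, hence bounded below there by a positive constant. *)
Lemma polyhedron_bounded : exists2 K, 0 < K & forall x (c : R), 0 <= c ->
  (forall k, dot x (u k) <= c) -> enorm x <= K * c.
Proof.
pose f x := \sum_k (`|dot x (u k)| + dot x (u k)).
have f_ge0 x k : 0 <= `|dot x (u k)| + dot x (u k).
  by have := ler_norm (- dot x (u k)); rewrite normrN; lra.
pose S : set 'rV[R]_n := [set x | enorm x = 1].
have [[z z0]|n0] := pselect (exists x : 'rV[R]_n, x != 0); last first.
  exists 1 => // x c c0 xc; have [->|x0] := eqVneq x 0; first by rewrite enorm0 mul1r.
  by exfalso; apply: n0; exists x.
have unit x : x != 0 -> S ((enorm x)^-1 *: x).
  move=> x0; have xe := enorm_gt0 x0.
  by rewrite /S /= enormZ ger0_norm ?invr_ge0 ?enorm_ge0// mulVf// gt_eqF.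
have [|||x1 /set_mem x1S x1min] := @compact_EVT_min _ R f S.
- by exists ((enorm z)^-1 *: z); exact: unit.
- apply: (@compact_enorm _ _ _ 1) => [|x ->//].
  rewrite (_ : S = @enorm R n @^-1` [set t | t = 1])//.
  by apply: preimage_closed (@closed_eq _ 1) => x _; exact: enorm_continuous.
- apply: continuous_subspaceT => x; apply: continuous_sumr => k _.
  apply: (@continuousD R R^o _ (fun x => `|dot x (u k)|) (dot^~ (u k))).
    apply: (@continuous_comp _ _ _ (dot^~ (u k)) (@Num.norm R R)).
      exact: dot_continuous.
    exact: norm_continuous.
  exact: dot_continuous.
have fx1 : 0 < f x1.
  have [|k xk] := spanning (w := x1); first by rewrite -enorm_eq0 x1S oner_eq0.
  rewrite /f (bigD1 k)//= ltr_pwDl ?sumr_ge0// gtr0_norm//; lra.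
exists (2 * N%:R / f x1 + 1); first by rewrite ltr_wpDl// divr_ge0 ?mulr_ge0// ltW.
move=> x c c0 xc; have [->|x0] := eqVneq x 0.
  by rewrite enorm0 mulr_ge0// addr_ge0// divr_ge0 ?mulr_ge0// ltW.
have xe := enorm_gt0 x0.
have fx : f x1 * enorm x <= f x.
  have := x1min _ (mem_set (unit x x0)).
  have -> : f ((enorm x)^-1 *: x) = (enorm x)^-1 * f x.
    rewrite /f mulr_sumr; apply: eq_bigr => k _.
    by rewrite dotZl normrM mulrDr ger0_norm ?invr_ge0 ?enorm_ge0.
  by rewrite mulrC ler_pdivlMr.
have fc : f x <= 2 * N%:R * c.
  apply: (@le_trans _ _ (\sum_(k < N) (2 * c))).
    apply: ler_sum => k _; have [k0|k0] := ler0P (dot x (u k)); last by have := xc k; lra.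
    by have := xc k; lra.
  by rewrite sumr_const card_ord -mulr_natl; lra.
rewrite mulrDl mul1r mulrAC -[leLHS]addr0 lerD//.
by rewrite ler_pdivlMr// mulrC; exact: le_trans fc.
Qed.

Lemma polyhedron_bounded_by h : exists M, forall x, polyhedron u h x -> enorm x <= M.
Proof.
have [K K0 HK] := polyhedron_bounded.
exists (K * \sum_k `|h k|) => x xP; apply: HK => [|k]; first exact: sumr_ge0.
apply: le_trans (xP k) _; apply: le_trans (ler_norm _) _.
by rewrite (bigD1 k)//= lerDl sumr_ge0.
Qed.

Definition volume h : R := fine (hausdorff n (polyhedron u h)).

Lemma hausdorff_polyhedron_fin h : hausdorff n (polyhedron u h) \is a fin_num.
Proof.
have [M HM] := polyhedron_bounded_by h.
rewrite ge0_fin_numE ?hausdorff_ge0//; apply: (@hausdorff_bounded _ _ _ M) => x xP i.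
exact: le_trans (coord_le_enorm x i) (HM x xP).
Qed.

Lemma volumeE h : (volume h)%:E = hausdorff n (polyhedron u h).
Proof. by rewrite fineK// hausdorff_polyhedron_fin. Qed.

Lemma volume_ge0 h : 0 <= volume h.
Proof. by rewrite fine_ge0// hausdorff_ge0. Qed.

Lemma le_volume h h' : polyhedron u h `<=` polyhedron u h' -> volume h <= volume h'.
Proof. by move=> hh'; rewrite -lee_fin !volumeE; exact: le_hausdorff. Qed.

Lemma polyhedron_mono h h' : (forall k, h k <= h' k) -> polyhedron u h `<=` polyhedron u h'.
Proof. by move=> hh' x xP k; exact: le_trans (xP k) (hh' k). Qed.

Lemma volume_recenter h x : volume (recenter h x) = volume h.
Proof.
rewrite /volume -(hausdorff_translate n (- x) (polyhedron u h)).
congr (fine (hausdorff n _)); apply/seteqP; split=> [y yP|_ [y yP <-] k].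
  by exists (y + x); [move=> k; rewrite dotDl -lerBrDr; exact: yP|rewrite addrK].
by rewrite dotBl lerD2r; exact: yP.
Qed.

Lemma volume_scale h (l : R) : 0 < l -> volume (fun k => l * h k) = l ^+ n * volume h.
Proof.
move=> l0; apply: EFin_inj; rewrite EFinM !volumeE -hausdorff_scale//.
congr (hausdorff n _); apply/seteqP; split=> [y yP|_ [y yP <-] k].
  exists (l^-1 *: y); last by rewrite scalerA mulfV ?scale1r// gt_eqF.
  by move=> k; rewrite dotZl mulrC ler_pdivrMr// mulrC; exact: yP.
by rewrite dotZl ler_pM2l.
Qed.

Lemma volume_gt0 h : (forall k, 0 < h k) -> 0 < volume h.
Proof.
move=> /finite_family_min[e e0 he]; rewrite fine_gt0//.
apply/andP; split; last first.
  by rewrite -ge0_fin_numE ?hausdorff_ge0// hausdorff_polyhedron_fin.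
apply: (@hausdorff_gt0 _ _ _ 0 (e / n.+1%:R)); first by rewrite divr_gt0.
move=> x xe k; apply: le_trans (he k); apply: le_trans (dot_le_enorm _ _) _.
rewrite [X in _ * X]/enorm u1 sqrtr1 mulr1.
apply: le_trans (enorm_le_coord (c := e / n.+1%:R) _ _) _.
- by rewrite divr_ge0// ltW.
- by move=> i; have := xe i; rewrite mxE subr0.
rewrite mulrC -mulrA ler_piMr ?(ltW e0)// mulrC ler_pdivrMr// mul1r ler_nat.
exact: leqnSn.
Qed.

(** The integral of the [p]-th power of the support numbers against the
    prescribed measure. *)
Definition Phi h : R := \sum_k alpha k * h k `^ p.

Lemma Phi_le h h' : (forall k, 0 < h k) -> (forall k, h k <= h' k) -> Phi h' <= Phi h.
Proof.
by move=> h0 hh'; apply: ler_sum => k _; rewrite ler_pM2l//; exact: powR_neg_le.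
Qed.

Lemma Phi_scale h (l : R) : 0 < l -> (forall k, 0 < h k) ->
  Phi (fun k => l * h k) = l `^ p * Phi h.
Proof.
move=> l0 h0; rewrite /Phi mulr_sumr; apply: eq_bigr => k _.
by rewrite powRM ?ltW// mulrCA.
Qed.

Lemma Phi_gt0 h : (0 < N)%N -> (forall k, 0 < h k) -> 0 < Phi h.
Proof.
move=> N0 h0; rewrite /Phi (bigD1 (Ordinal N0))//= ltr_pwDl//.
  by rewrite mulr_gt0 ?powR_gt0.
by apply: sumr_ge0 => k _; rewrite mulr_ge0 ?powR_ge0 ?ltW.
Qed.

Lemma Phi_tangent h h' : (forall k, 0 < h k) -> (forall k, 0 < h' k) ->
  Phi h + p * \sum_k alpha k * h k `^ (p - 1) * (h' k - h k) <= Phi h'.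
Proof.
move=> h0 h'0; rewrite /Phi mulr_sumr -big_split/=; apply: ler_sum => k _.
have H := powR_tangent p0 (h'0 k) (h0 k); rewrite -(ler_pM2l (alpha0 k)) in H.
by apply: le_trans H; rewrite le_eqVlt; apply/orP; left; apply/eqP; ring.
Qed.

(** [Phi] tends to infinity at the boundary of the polyhedron, hence is
    minimised over the translates in its interior. *)
Lemma Phi_translate_min h x0 : (forall k, 0 < recenter h x0 k) ->
  exists x, (forall k, 0 < recenter h x k) /\
    forall y, (forall k, 0 < recenter h y k) -> Phi (recenter h x) <= Phi (recenter h y).
Proof.
move=> x0P; set B := Phi (recenter h x0).
have [N0|N0] := posnP N.
  exists x0; split=> // y _; rewrite /B /Phi !big1//; move=> k _;
  by have := ltn_ord k; rewrite [X in (_ < X)%N]N0.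
have B0 : 0 < B by exact: Phi_gt0.
have [e e0 eP] := finite_family_min x0P.
have r0 k : 0 < (B / alpha k) `^ p^-1 by rewrite powR_gt0// divr_gt0.
have [r r0' rP] := finite_family_min r0.
pose c := Num.min e r; have c0 : 0 < c by rewrite lt_min e0.
pose C := polyhedron u (fun k => h k - c).
have CP x : C x <-> forall k, c <= recenter h x k.
  by split=> H k; have := H k; rewrite /recenter; lra.
have C0 : C x0 by apply/CP => k; apply: le_trans (eP k); rewrite ge_min lexx.
have Cpos x : C x -> forall k, 0 < recenter h x k.
  by move=> /CP H k; exact: lt_le_trans (H k).
have [M MC] := polyhedron_bounded_by (fun k => h k - c).
have [|||x /set_mem Cx xmin] := @compact_EVT_min _ R (fun x => Phi (recenter h x)) C.
- by exists x0.
- apply: (@compact_enorm _ _ _ M) => //; exact: polyhedron_closed.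
- apply: continuous_in_subspaceT => x /set_mem Cx; apply: continuous_sumr => k _.
  apply: (@continuousM R _ (cst (alpha k)) (fun x => recenter h x k `^ p)).
    exact: cst_continuous.
  apply: (@continuous_comp _ _ _ (fun x => recenter h x k) (fun t => t `^ p)).
    apply: (@continuousB R R^o _ (cst (h k)) (dot^~ (u k))).
      exact: cst_continuous.
    exact: dot_continuous.
  by apply: powR_continuous; exact: Cpos.
exists x; split; first exact: Cpos.
move=> y y0; have [Cy|nCy] := pselect (C y); first exact: xmin (mem_set Cy).
apply: le_trans (xmin _ (mem_set C0)) _; rewrite -/B.
have [k yk] : exists k, recenter h y k < c.
  apply: contrapT => ny; apply: nCy; apply/CP => k.
  by rewrite leNgt; apply/negP => yk; apply: ny; exists k.
rewrite /Phi (bigD1 k)//=; apply: ler_wpDr.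
  by apply: sumr_ge0 => j _; rewrite mulr_ge0 ?powR_ge0 ?ltW.
have -> : B = alpha k * ((B / alpha k) `^ p^-1) `^ p.
  rewrite -powRrM mulVf ?lt_eqF// powRr1 ?divr_ge0 ?ltW//.
  by rewrite mulrC divfK// gt_eqF.
rewrite ler_pM2l//; apply: powR_neg_le => //; apply: le_trans (rP k).
by rewrite ltW// (lt_le_trans yk)// ge_min lexx orbT.
Qed.

(** The first-order condition at a minimum over translations, obtained from
    the tangent inequality at the perturbed points. *)
Lemma Phi_min_critical h : (forall k, 0 < h k) ->
  (forall y, (forall k, 0 < recenter h y k) -> Phi h <= Phi (recenter h y)) ->
  forall w, \sum_k alpha k * h k `^ (p - 1) * dot w (u k) = 0.
Proof.
move=> h0 hmin.
suff H w : 0 <= \sum_k alpha k * h k `^ (p - 1) * dot w (u k).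
  move=> w; apply/eqP; rewrite eq_le H andbT.
  have := H (- w).
  rewrite (eq_bigr (fun k => - (alpha k * h k `^ (p - 1) * dot w (u k)))).
    by rewrite sumrN oppr_ge0.
  by move=> k _; rewrite dotNl mulrN.
have [e e0 eh] := finite_family_min h0.
have ew : 0 < enorm w + 1 by rewrite ltr_wpDl// enorm_ge0.
pose t (m : nat) := e / (enorm w + 1) / m.+1%:R.
have t0 m : 0 < t m by rewrite !divr_gt0.
have tw m k : t m * dot w (u k) < e.
  apply: (@le_lt_trans _ _ (t m * enorm w)).
    rewrite ler_pM2l//; apply: le_trans (dot_le_enorm _ _) _.
    by rewrite [X in _ * X]/enorm u1 sqrtr1 mulr1.
  have m1 : (1 : R) <= m.+1%:R by rewrite ler1n.
  have -> : t m * enorm w = e * (enorm w / ((enorm w + 1) * m.+1%:R)).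
    by rewrite /t; field; rewrite (gt_eqF ew) /=; lra.
  rewrite gtr_pMr// ltr_pdivrMr ?mulr_gt0 ?ltr0n// mul1r.
  by have := enorm_ge0 w; nra.
have st m k : 0 < recenter h (t m *: w) k.
  by rewrite /recenter dotZl subr_gt0; exact: lt_le_trans (tw m k) (eh k).
pose s m := \sum_k alpha k * recenter h (t m *: w) k `^ (p - 1) * dot w (u k).
have s0 m : 0 <= s m.
  have := le_trans (Phi_tangent (st m) h0) (hmin _ (st m)).
  have -> : \sum_k alpha k * recenter h (t m *: w) k `^ (p - 1) * (h k - recenter h (t m *: w) k)
      = t m * s m.
    by rewrite /s mulr_sumr; apply: eq_bigr => k _; rewrite {2}/recenter dotZl; ring.
  by rewrite gerDl nmulr_rle0// pmulr_rge0.
have t_cvg : t @ \oo --> (0 : R).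
  rewrite -[X in _ --> X](mulr0 (e / (enorm w + 1))).
  by apply: cvgM; [exact: cvg_cst|exact: cvg_harmonic].
have s_cvg : s @ \oo --> \sum_k alpha k * h k `^ (p - 1) * dot w (u k).
  apply: cvg_sumr => k _; apply: cvgM; last exact: cvg_cst.
  apply: cvgM; first exact: cvg_cst.
  have sh : (fun m => recenter h (t m *: w) k) @ \oo --> h k.
    rewrite -[X in _ --> X]subr0; apply: cvgB; first exact: cvg_cst.
    rewrite -(mul0r (dot w (u k))).
    under eq_fun do rewrite dotZl.
    by apply: cvgM => //; exact: cvg_cst.
  have pc := @powR_continuous R (p - 1) _ (h0 k).
  exact: (cvg_comp _ _ sh pc).
rewrite -(cvg_lim _ s_cvg)//; apply: limr_ge; first by apply/cvg_ex; eexists; exact: s_cvg.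
by near=> m.
Unshelve. all: by end_near. Qed.

End Functional.

(** * Existence of an extremal polytope *)

Lemma seq_argmax {R : realType} {T : eqType} (F : T -> R) (s : seq T) x :
  exists2 z, z \in x :: s & forall y, y \in x :: s -> F y <= F z.
Proof.
elim: s x => [|a s IH] x.
  by exists x; rewrite ?mem_head// => y; rewrite inE => /eqP ->.
have [z zs zmax] := IH a; have [xz|/ltW zx] := leP (F x) (F z).
  exists z; first by rewrite inE zs orbT.
  by move=> y; rewrite inE => /orP[/eqP ->//|/zmax].
exists x; first exact: mem_head.
by move=> y; rewrite inE => /orP[/eqP ->//|/zmax/le_trans]; apply.
Qed.

(** If no value were maximal, the open sets on which [F] is below one of its
    values would cover [K]; but the largest of the values in a finite subcover
    is attained at a point that none of its sets contains. *)
Lemma usc_attains_max {R : realType} {m} (K : set 'rV[R]_m) (F : 'rV[R]_m -> R) :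
  K !=set0 -> compact K ->
  (forall x c, K x -> F x < c -> nbhs x [set y | K y -> F y < c]) ->
  exists2 x, K x & forall y, K y -> F y <= F x.
Proof.
move=> K0; rewrite compact_cover => cK usc; apply: contrapT => nmax.
have above x : K x -> exists2 y, K y & F x < F y.
  move=> Kx; apply: contrapT => ny; apply: nmax; exists x => // y Ky.
  by rewrite leNgt; apply/negP => xy; apply: ny; exists y.
pose f y := interior [set x | K x -> F x < F y].
have [||D DK KD] := cK _ K f.
- by move=> y _; exact: open_interior.
- by move=> x Kx; have [y Ky xy] := above x Kx; exists y => //; exact: usc.
have [x0 Kx0] := K0; have [y0 y0D _] := KD _ Kx0.
have [z zD zmax] : exists2 z, z \in finmap.enum_fset D &
    forall y, y \in finmap.enum_fset D -> F y <= F z.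
  have : y0 \in finmap.enum_fset D by [].
  by case: (finmap.enum_fset D) => // a s _; exact: seq_argmax.
have /set_mem Kz := DK _ zD; have [y yD fyz] := KD _ Kz.
have := interior_subset fyz => /(_ Kz); rewrite ltNge => /negP; apply.
exact: zmax.
Qed.

Section Extremal.
Context {R : realType} {n N : nat}.
Variables (u : 'I_N -> 'rV[R]_n) (alpha : 'I_N -> R) (p : R).
Hypothesis n0 : (0 < n)%N.
Hypothesis u1 : forall k, dot (u k) (u k) = 1.
Hypothesis alpha0 : forall k, 0 < alpha k.
Hypothesis p0 : p < 0.
Hypothesis spanning : forall w, w != 0 -> exists k, 0 < dot w (u k).
Hypothesis nondegenerate : forall h x y, polyhedron u h x -> polyhedron u h y ->
  x != y -> exists z, forall k, 0 < recenter u h z k.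
Implicit Types (x y z w : 'rV[R]_n) (h : 'I_N -> R).
Notation recenter := (recenter u).
Notation Phi := (Phi alpha p).
Notation volume := (volume u).

Let q := - p / n%:R.

Let q0 : 0 < q.
Proof. by rewrite divr_gt0 ?oppr_gt0// ltr0n. Qed.

Let nq : n%:R * q = - p.
Proof. by rewrite mulrC divfK// pnatr_eq0 -lt0n. Qed.

(** Invariant under dilations by the choice of the exponent [q]. *)
Let J h := Phi h * volume h `^ q.

(** Both factors are monotone, so that bodies which agree up to a dilation by
    [l] have values of [J] within a factor close to 1 when [l] is. *)
Let J_compare h h' (l : R) : 1 < l -> (forall k, 0 < h k) ->
  (forall k, h k <= l * h' k) -> (forall k, h' k <= l * h k) ->
  J h' <= l `^ (- p) ^+ 2 * J h.
Proof.
move=> l1 h0 hh' h'h; have l0 : 0 < l := lt_trans ltr01 l1.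
have Phi_h' : Phi h' <= l `^ (- p) * Phi h.
  have -> : l `^ (- p) = (l^-1) `^ p by rewrite -powR_inv1 ?ltW// -powRrM mulN1r.
  rewrite -Phi_scale ?invr_gt0//; apply: Phi_le => // k.
    by rewrite mulr_gt0 ?invr_gt0.
  by rewrite mulrC ler_pdivrMr// mulrC.
have vol_h' : volume h' `^ q <= l `^ (- p) * volume h `^ q.
  have -> : l `^ (- p) = (l ^+ n) `^ q by rewrite -powR_mulrn ?ltW// -powRrM nq.
  rewrite -powRM ?exprn_ge0 ?volume_ge0 ?(ltW l0)//.
  apply: ge0_ler_powR; first exact: ltW q0.
  - by rewrite nnegrE volume_ge0.
  - by rewrite nnegrE mulr_ge0 ?volume_ge0// exprn_ge0// ltW.
  by rewrite -volume_scale//; apply: le_volume => //; exact: polyhedron_mono.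
rewrite expr2 /J mulrACA; apply: ler_pM => //; last exact: powR_ge0.
by apply: sumr_ge0 => k _; rewrite mulr_ge0 ?powR_ge0 ?ltW.
Qed.

Let J_scale h (l : R) : 0 < l -> (forall k, 0 < h k) -> J (fun k => l * h k) = J h.
Proof.
move=> l0 h0; rewrite /J (Phi_scale alpha p l0 h0) (volume_scale spanning h l0).
rewrite powRM ?exprn_ge0 ?volume_ge0 ?(ltW l0)//.
rewrite -powR_mulrn ?ltW// -powRrM nq mulrACA -powRD ?subrr; last first.
  by rewrite (gt_eqF l0) implybT.
by rewrite powRr0 mul1r.
Qed.

Let k0_exists : exists k0 : 'I_N, True.
Proof.
have [|k _] := spanning (w := const_mx 1); last by exists k.
apply/eqP => /rowP/(_ (Ordinal n0)); rewrite !mxE => /eqP; rewrite oner_eq0//.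
Qed.

(** Up to translation and scaling, the bodies with facet normals among the [u k]
    are circumscribed to finite configurations of points, one of which is the
    origin; these configurations form a compact set.  A configuration is a
    vector of length [N * n], whose [j]-th block is the [j]-th point. *)
Let point (v : 'rV[R]_(N * n)) (j : 'I_N) : 'rV[R]_n := \row_i v 0 (mxvec_index j i).

Let support_of v k : R := \big[Num.max/0]_(j < N) dot (point v j) (u k).

Let configurations (k0 : 'I_N) : set 'rV[R]_(N * n) :=
  [set v | `|v| = 1 /\ point v k0 = 0].

Let point_mem v j k : dot (point v j) (u k) <= support_of v k.
Proof. exact: (le_bigmax 0 (fun j => dot (point v j) (u k)) j). Qed.

Let compact_configurations k0 : compact (configurations k0).
Proof.
apply: (@compact_enorm _ _ _ (N * n)%:R) => [|v [v1 _]]; last first.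
  by have := enorm_le_norm v; rewrite v1 mulr1.
have c i : continuous (fun v : 'rV[R]_(N * n) => v 0 i) by exact: coord_continuous.
rewrite (_ : configurations k0 = (fun v : 'rV[R]_(N * n) => `|v|) @^-1` [set t | t = 1] `&`
    \bigcap_(i in setT) (fun v : 'rV[R]_(N * n) => v 0 (mxvec_index k0 i)) @^-1` [set t | t = 0]).
  apply: closedI.
    by apply: preimage_closed (@closed_eq _ 1) => v _; exact: norm_continuous.
  apply: closed_bigI => i _.
  by apply: preimage_closed (@closed_eq _ 0) => v _; exact: c.
apply/seteqP; split=> v [v1 v0]; split=> //.
  by move=> i _ /=; move/rowP: v0 => /(_ i); rewrite !mxE.
by apply/rowP => i; rewrite !mxE; exact: v0.
Qed.

Let configuration_interior k0 v : configurations k0 v ->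
  exists z, forall k, 0 < recenter (support_of v) z k.
Proof.
move=> [v1 v0].
have [j vj] : exists j, point v j != point v k0.
  apply: contrapT => nj; suff v00 : v = 0.
    by move: v1; rewrite v00 normr0 => /esym/eqP; rewrite oner_eq0.
  apply/rowP => i; case/mxvec_indexP: i => j i.
  have : point v j = point v k0.
    by apply/eqP/negP => /negP vj; apply: nj; exists j.
  by rewrite v0 => /rowP/(_ i); rewrite !mxE.
by apply: nondegenerate vj => k; exact: point_mem.
Qed.

Let support_of_near v (e : R) : 0 < e ->
  nbhs v [set v' | forall k, `|support_of v' k - support_of v k| <= e].
Proof.
move=> e0; apply/nbhs_enorm; exists (e / n.+1%:R); first by rewrite divr_gt0.
have close v1 v2 k : enorm (v1 - v2) < e / n.+1%:R -> support_of v1 k <= support_of v2 k + e.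
  move=> v12; apply: bigmax_le => [|j _].
    by rewrite addr_ge0 ?(ltW e0)//; exact: bigmax_ge_id.
  apply: le_trans (_ : _ <= dot (point v2 j) (u k) + e) _; last by rewrite lerD2r.
  rewrite -lerBlDl -dotBl; apply: le_trans (dot_le_enorm _ _) _.
  rewrite [X in _ * X]/enorm u1 sqrtr1 mulr1.
  apply: le_trans (enorm_le_coord (c := e / n.+1%:R) _ _) _.
  - by rewrite divr_ge0// ltW.
  - move=> i; rewrite !mxE; have := coord_le_enorm (v1 - v2) (mxvec_index j i).
    by rewrite !mxE => /le_trans; apply; exact: ltW.
  rewrite mulrC -mulrA ler_piMr ?(ltW e0)// mulrC ler_pdivrMr// mul1r ler_nat.
  exact: leqnSn.
move=> v' v'v k; rewrite ler_norml; apply/andP; split.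
  by have := close v v' k; rewrite enormB => /(_ v'v); lra.
by have := close v' v k v'v; lra.
Qed.

(** A body is determined up to translation and scaling by points at which its
    support function is attained in the directions [u k]. *)
Let configuration_of k0 h z : (forall k, 0 < recenter h z k) ->
  exists v s x (h' : 'I_N -> R), [/\ configurations k0 v, 0 < s,
    forall k, h' k <= h k, polyhedron u h `<=` polyhedron u h' &
    forall k, support_of v k = s * recenter h' x k].
Proof.
move=> z0.
have zP : polyhedron u h z by move=> k; have := z0 k; rewrite /recenter subr_gt0 => /ltW.
have [M HM] := polyhedron_bounded_by spanning h.
have cP : compact (polyhedron u h).
  by apply: (@compact_enorm _ _ _ M) => //; exact: polyhedron_closed.
have : forall j, exists x, polyhedron u h x /\
    forall y, polyhedron u h y -> dot y (u j) <= dot x (u j).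
  move=> j; have [||x /set_mem xP xmax] := compact_EVT_max _ cP (f := dot^~ (u j)).
  - by exists z.
  - by apply: continuous_subspaceT; exact: dot_continuous.
  by exists x; split=> // y yP; apply: xmax; exact: mem_set.
move=> /(@choice _ _ (fun j x => polyhedron u h x /\
    forall y, polyhedron u h y -> dot y (u j) <= dot x (u j)))[x xP].
pose v0 : 'rV[R]_(N * n) := mxvec (\matrix_j (x j - x k0)).
have v0E j i : v0 0 (mxvec_index j i) = (x j - x k0) 0 i by rewrite mxvecE mxE.
pose h' k := dot (x k) (u k).
have v00 : v0 != 0.
  apply/eqP => v00; have xj j : x j = x k0.
    apply/eqP; rewrite -subr_eq0; apply/eqP/rowP => i.
    by rewrite -v0E v00 !mxE.
  have single y : polyhedron u h y -> y = x k0.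
    move=> yP; apply/eqP; rewrite -subr_eq0; apply/negP => /negP yx.
    have [k] := spanning yx; rewrite dotBl subr_gt0 -(xj k) ltNge.
    by rewrite (xP k).2.
  have [e e0 ez] := finite_family_min z0.
  have ezP : polyhedron u h (z + e *: u k0).
    move=> k; rewrite !dotE; have := ez k; rewrite /recenter => ezk.
    have : dot (u k0) (u k) <= 1.
      apply: le_trans (dot_le_enorm _ _) _.
      by rewrite /enorm !u1 sqrtr1 mulr1.
    by move=> /(ler_wpM2l (ltW e0)); lra.
  have := single _ ezP; rewrite (single _ zP) => /eqP; rewrite -subr_eq0 addrC addKr.
  by rewrite scaler_eq0 gt_eqF//= -dot_eq0 u1 oner_eq0.
have s0 : 0 < `|v0|^-1 by rewrite invr_gt0 normr_gt0.
exists (`|v0|^-1 *: v0), `|v0|^-1, (x k0), h'.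
have pt j : point (`|v0|^-1 *: v0) j = `|v0|^-1 *: (x j - x k0).
  by apply/rowP => i; rewrite mxE [LHS]mxE v0E [RHS]mxE.
split=> //.
- split; last by rewrite pt subrr scaler0.
  by rewrite normrZ gtr0_norm// mulVf// normr_eq0.
- by move=> k; exact: (xP k).1.
- by move=> y yP k; exact: (xP k).2.
move=> k; apply/eqP; rewrite eq_le; apply/andP; split; last first.
  by have := point_mem (`|v0|^-1 *: v0) k k; rewrite pt dotZl dotBl.
apply: bigmax_le => [|j _].
  by rewrite mulr_ge0 ?(ltW s0)// subr_ge0; apply: (xP k).2; exact: (xP k0).1.
rewrite pt dotZl ler_pM2l// dotBl lerD2r; apply: (xP k).2; exact: (xP j).1.
Qed.

(** The minimal value of [J] among translates, as a function [F] of the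
    configuration, is upper semicontinuous: the minimising translation for one
    body is a competitor for all bodies near it.  A maximiser of [F] is extremal
    among all bodies, because passing from a body to the circumscribed one given
    by its configuration does not decrease [J]. *)
Lemma extremal_polytope : exists h, [/\ forall k, 0 < h k,
    forall y, (forall k, 0 < recenter h y k) -> Phi h <= Phi (recenter h y) &
    forall h' z, (forall k, 0 < recenter h' z k) -> exists y,
      (forall k, 0 < recenter h' y k) /\
      Phi (recenter h' y) * volume h' `^ q <= Phi h * volume h `^ q].
Proof.
have [k0 _] := k0_exists.
have N0 : (0 < N)%N by case: (N) k0 => [[]|].
have : forall v, exists x, configurations k0 v ->
    (forall k, 0 < recenter (support_of v) x k) /\
    forall y, (forall k, 0 < recenter (support_of v) y k) ->
      Phi (recenter (support_of v) x) <= Phi (recenter (support_of v) y).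
  move=> v; have [cv|ncv] := pselect (configurations k0 v); last by exists 0.
  have [z zv] := configuration_interior cv.
  by have [x [xv xmin]] := Phi_translate_min alpha0 p0 spanning zv; exists x.
move=> /(@choice _ _ (fun v x => configurations k0 v ->
    (forall k, 0 < recenter (support_of v) x k) /\
    forall y, (forall k, 0 < recenter (support_of v) y k) ->
      Phi (recenter (support_of v) x) <= Phi (recenter (support_of v) y)))[xi xiP].
pose F v := J (recenter (support_of v) (xi v)).
have bound h' z : (forall k, 0 < recenter h' z k) -> exists v y, [/\ configurations k0 v,
    forall k, 0 < recenter h' y k & Phi (recenter h' y) * volume h' `^ q <= F v].
  move=> /(configuration_of k0)[v [s [x [h'' [cv s0 h''h hh'' suppE]]]]].
  have [xi0 _] := xiP v cv; pose y := x + s^-1 *: xi v.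
  have E k : recenter (support_of v) (xi v) k = s * recenter h'' y k.
    rewrite /recenter suppE /recenter /y !dotE; field; exact: lt0r_neq0.
  have y0 k : 0 < recenter h'' y k by have := xi0 k; rewrite E pmulr_rgt0.
  have le_shift k : recenter h'' y k <= recenter h' y k by rewrite lerD2r.
  exists v, y; split; [exact: cv|move=> k; exact: lt_le_trans (y0 k) (le_shift k)|].
  have -> : F v = J (recenter h'' y).
    have -> : F v = J (fun k => s * recenter h'' y k).
      by rewrite /F; congr J; apply/funext.
    exact: J_scale.
  rewrite /J volume_recenter; apply: ler_pM.
  - by apply: sumr_ge0 => k _; rewrite mulr_ge0 ?powR_ge0 ?ltW.
  - exact: powR_ge0.
  - exact: Phi_le.
  - apply: ge0_ler_powR; [exact: ltW q0|by rewrite nnegrE volume_ge0..|].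
    exact: le_volume.
have usc v c : configurations k0 v -> F v < c ->
    nbhs v [set w | configurations k0 w -> F w < c].
  move=> cv Fc; have [a0 _] := xiP v cv; set a := recenter (support_of v) (xi v) in a0.
  have F0 : 0 < F v.
    by rewrite /F /J mulr_gt0 ?Phi_gt0 ?powR_gt0 ?volume_gt0.
  (* The factor [l `^ (- p) ^+ 2] of [J_compare] is the square root of
     [c / F v], hence less than [c / F v]. *)
  pose l := (c / F v) `^ (- p)^-1 `^ 4^-1.
  have cF1 : 1 < c / F v by rewrite ltr_pdivlMr// mul1r.
  have lE : l `^ (- p) ^+ 2 < c / F v.
    have -> : l `^ (- p) = (c / F v) `^ 4^-1.
      rewrite /l powRAC -(powRrM _ (- p)^-1) mulVf ?oppr_eq0 ?lt_eqF// powRr1//.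
      by rewrite ltW// (lt_trans ltr01).
    rewrite -powR_mulrn ?powR_ge0// -powRrM.
    rewrite -[ltRHS]powRr1; last by rewrite ltW// (lt_trans ltr01).
    by rewrite /powR gt_eqF ?(lt_trans ltr01)// ltr_expR ltr_pM2r ?ln_gt0//; lra.
  have l1 : 1 < l.
    by rewrite /l powR_gt1 ?invr_gt0// powR_gt1// invr_gt0 oppr_gt0.
  have l0 : 0 < l := lt_trans ltr01 l1.
  have [m m0 ma] := finite_family_min a0.
  have e0 : 0 < (1 - l^-1) * m by rewrite mulr_gt0// subr_gt0 invf_lt1.
  apply: filterS (support_of_near v e0) => w wv cw.
  pose b := recenter (support_of w) (xi v).
  have ab k : a k <= l * b k /\ b k <= l * a k.
    have [A AE] : exists A, A = a k by exists (a k).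
    have [B BE] : exists B, B = b k by exists (b k).
    have := wv k; have := ma k; rewrite -AE -BE ler_norml.
    have -> : support_of w k - support_of v k = B - A.
      by rewrite AE BE /a /b /recenter; ring.
    move=> mA /andP[h1 h2].
    have ll : l * l^-1 = 1 by rewrite mulfV// gt_eqF.
    have lm : (1 - l^-1) * m <= (1 - l^-1) * A.
      by rewrite ler_pM2l// subr_gt0 invf_lt1.
    have iA : A * l^-1 <= B by nra.
    split; first by rewrite -ler_pdivrMl// mulrC.
    have li : 1 - l^-1 <= l - 1.
      have : 0 <= (l - 1) * (1 - l^-1) by rewrite mulr_ge0// subr_ge0 ?invf_le1// ltW.
      by rewrite mulrBr mulr1 mulrBl ll; lra.
    have A0 : 0 < A by exact: lt_le_trans mA.
    have := ler_wpM2r (ltW A0) li; lra.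
  have b0 k : 0 < b k.
    by have := lt_le_trans (a0 k) (ab k).1; rewrite pmulr_rgt0.
  have [_ wmin] := xiP w cw.
  apply: (@le_lt_trans _ _ (J b)).
    rewrite /F /J !volume_recenter ler_wpM2r ?powR_ge0//; exact: wmin.
  apply: le_lt_trans (J_compare l1 a0 (fun k => (ab k).1) (fun k => (ab k).2)) _.
  by rewrite -ltr_pdivlMr.
have [|v cv vmax] := @usc_attains_max _ _ (configurations k0) F _ (@compact_configurations k0) usc.
  have [|v [_ [cv _ _]]] := bound (fun=> 1) 0; last by exists v.
  by move=> k; rewrite /recenter dot0l subr0.
have [xi0 ximin] := xiP v cv.
exists (recenter (support_of v) (xi v)); split=> //.
  have E y : recenter (recenter (support_of v) (xi v)) y = recenter (support_of v) (xi v + y).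
    by apply/funext => k; rewrite /recenter dotDl; ring.
  by move=> y; rewrite E => y0; exact: ximin.
move=> h' z /bound[w [y [cw y0 yF]]]; exists y; split; first exact: y0.
by apply: le_trans yF _; apply: le_trans (vmax w cw) _; rewrite /F /J.
Qed.

End Extremal.

(** * The Euler-Lagrange equations *)

Section EulerLagrange.
Context {R : realType} {d N : nat}.
Variables (u : 'I_N -> 'rV[R]_d.+1) (alpha : 'I_N -> R) (p : R).
Hypothesis u1 : forall k, dot (u k) (u k) = 1.
Hypothesis uI : injective u.
Hypothesis alpha0 : forall k, 0 < alpha k.
Hypothesis p0 : p < 0.
Hypothesis spanning : forall w, w != 0 -> exists k, 0 < dot w (u k).
Variable h : 'I_N -> R.
Hypothesis h0 : forall k, 0 < h k.
Implicit Types (x y z w : 'rV[R]_d.+1).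
Local Notation volume := (volume u).
Local Notation Phi := (Phi alpha p).
Local Notation recenter := (recenter u).

Let dot_u x k : `|dot x (u k)| <= enorm x.
Proof.
by apply: le_trans (norm_dot_le _ _) _; rewrite [X in _ * X]/enorm u1 sqrtr1 mulr1.
Qed.

Let dot_uu j k : `|dot (u j) (u k)| <= 1.
Proof. by apply: le_trans (dot_u _ _) _; rewrite /enorm u1 sqrtr1. Qed.

Definition bump k (t : R) : 'I_N -> R := fun j => if j == k then h j + t else h j.

(** The piece of the hyperplane of the [k]-th facet on which the other
    constraints hold up to [t]: a smaller piece than the facet for [t < 0], a
    larger one for [t > 0]. *)
Definition near_facet k (t : R) := section (u k) (h k)
  [set x | forall j, [pred j | j != k] j -> dot x (u j) < h j + t].

Let open_near k t :
  open [set x | forall j, [pred j | j != k] j -> dot x (u j) < h j + t].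
Proof. exact: open_dot_lt_family. Qed.

Let near_facetE k t : near_facet k t =
  facet_interior u (fun j => if j == k then h k else h j + t) k.
Proof.
apply/seteqP; split=> x [xk xj].
  by split=> [|j jk]; rewrite ?eqxx// (negbTE jk); exact: xj.
by rewrite eqxx in xk; split=> // j /= jk; have := xj j jk; rewrite (negbTE jk).
Qed.

Let near_facet0 k : near_facet k 0 = facet_interior u h k.
Proof.
by apply/seteqP; split=> x [xk xj]; split=> // j jk; have := xj j jk; rewrite addr0.
Qed.

Let near_facet_bounded k : exists M, forall t, t <= 2 ->
  forall x, near_facet k t x -> enorm x <= M.
Proof.
have [M HM] := polyhedron_bounded_by spanning (fun j => h j + 2).
exists M => t t2 x [xk xj]; apply: HM => j; have [->|jk] := eqVneq j k.
  by rewrite xk lerDl.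
by apply: le_trans (ltW (xj j jk)) _; rewrite lerD2l.
Qed.

Let near_facet_fin k t : t <= 2 -> hausdorff d (near_facet k t) \is a fin_num.
Proof.
move=> t2; have [M HM] := near_facet_bounded k.
rewrite ge0_fin_numE ?hausdorff_ge0//.
exact: hausdorff_section_fin (u1 k) (HM t t2).
Qed.

Let area k t : R := fine (hausdorff d (near_facet k t)).

Let mnear k t :
  measurable (near_facet k t : set (caratheodory_type (@hausdorff R d.+1 d))).
Proof. by rewrite near_facetE; exact: measurable_facet_interior. Qed.

Let le_near k t t' : t <= t' -> near_facet k t `<=` near_facet k t'.
Proof.
move=> tt' x [xk xj]; split=> // j jk; apply: lt_le_trans (xj j jk) _.
by rewrite lerD2l.
Qed.

Let harmonic_le (m m' : nat) : (m <= m')%N -> m'.+1%:R^-1 <= m.+1%:R^-1 :> R.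
Proof. by move=> mm'; rewrite lef_pV2 ?posrE ?ltr0n// ler_nat. Qed.

Let harmonic_small (e : R) : 0 < e -> exists m : nat, m.+1%:R^-1 < e.
Proof.
move=> e0; exists (Num.bound e^-1).
rewrite -[ltRHS]invrK ltf_pV2 ?posrE ?invr_gt0 ?ltr0n//.
apply: lt_trans (archi_boundP _) _; first by rewrite invr_ge0 ltW.
by rewrite ltr_nat.
Qed.

Let area_inner_cvg k : area k (- (m.+1%:R^-1)) @[m --> \oo] --> area k 0.
Proof.
apply: fine_cvg; rewrite fineK; last exact: near_facet_fin.
have -> : near_facet k 0 = \bigcup_m near_facet k (- (m.+1%:R^-1)).
  apply/seteqP; split=> [x [xk xj]|x [m _]]; last by apply: le_near; rewrite oppr_le0 invr_ge0.
  have gap j : 0 < if j == k then 1 else h j - dot x (u j).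
    by have [//|jk] := eqVneq j k; rewrite subr_gt0; have := xj j jk; rewrite addr0.
  have [e e0 eP] := finite_family_min gap.
  have [m me] := harmonic_small e0; exists m => //; split=> // j jk.
  have := eP j; rewrite (negbTE jk); move: (m.+1%:R^-1) me => t te et.
  by rewrite /=; lra.
apply: (@nondecreasing_cvg_mu _ _ _ (@hausdorff_measure R d.+1 d)).
- by move=> m; exact: mnear.
- by apply: bigcupT_measurable => m; exact: mnear.
- by move=> m m' mm'; apply/subsetPset/le_near; rewrite lerN2; exact: harmonic_le.
Qed.

(** The relative boundary of a facet lies in finitely many flats of smaller
    dimension, which are null sets. *)
Let hausdorff_closed_facet k :
  hausdorff d (\bigcap_m near_facet k (2 * m.+1%:R^-1)) = hausdorff d (near_facet k 0).
Proof.
have [M HM] := near_facet_bounded k.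
pose E j := [set x | [/\ dot x (u k) = h k, dot x (u j) = h j & enorm x <= M]].
have E0 j : j != k -> hausdorff d (E j) = 0%E.
  move=> jk; have [jNk|jNk] := eqVneq (u j) (- u k); last first.
    by apply: hausdorff_flat_null => //; rewrite (inj_eq uI).
  rewrite (_ : E j = set0) ?hausdorff0//; apply/seteqP; split=> // x [xk xj _].
  by have := h0 j; rewrite -xj jNk dotNr xk oppr_gt0 ltNge ltW.
have U0 : hausdorff d (\big[setU/set0]_(j < N | j != k) E j) = 0%E.
  elim/big_ind: _ => [|A B A0 B0|j jk]; [exact: hausdorff0| |exact: E0].
  apply/eqP; rewrite eq_le hausdorff_ge0 andbT.
  by apply: le_trans (outer_measureU2 _ _ _) _; rewrite [X in (X + _)%E]A0 [X in (_ + X)%E]B0 adde0.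
apply/eqP; rewrite eq_le; apply/andP; split; last first.
  by apply: le_hausdorff => x x0 m _; apply: le_near x0; rewrite mulr_ge0 ?invr_ge0.
rewrite -[leRHS]adde0 -[X in (_ + X)%E]U0; apply: le_trans (outer_measureU2 _ _ _).
apply: le_hausdorff => x xm.
have [xk _] := xm 0%N I.
have xle j : j != k -> dot x (u j) <= h j.
  move=> jk; rewrite leNgt; apply/negP => xj.
  have [m me] : exists m : nat, m.+1%:R^-1 < (dot x (u j) - h j) / 2.
    by apply: harmonic_small; rewrite divr_gt0// subr_gt0.
  have [_ /(_ j jk)] := xm m I; rewrite /=; move: (m.+1%:R^-1) me => t.
  by lra.
have [[j jk xj]|nj] := pselect (exists2 j, j != k & dot x (u j) = h j).
  right; rewrite (bigD1 j)//=; left; split=> //.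
  by apply: (HM 2) => //; have := xm 0%N I; rewrite invr1 mulr1.
left; split=> // j jk; rewrite addr0 lt_neqAle xle// andbT.
by apply/eqP => xj; apply: nj; exists j.
Qed.

Let area_outer_cvg k : area k (2 * m.+1%:R^-1) @[m --> \oo] --> area k 0.
Proof.
apply: fine_cvg; rewrite fineK; last exact: near_facet_fin.
rewrite -hausdorff_closed_facet.
apply: (@nonincreasing_cvg_mu _ _ _ (@hausdorff_measure R d.+1 d)).
- rewrite invr1 mulr1 -ge0_fin_numE ?hausdorff_ge0//; exact: near_facet_fin.
- by move=> m; exact: mnear.
- by apply: bigcapT_measurable => m; exact: mnear.
- by move=> m m' mm'; apply/subsetPset/le_near; rewrite ler_pM2l//; exact: harmonic_le.
Qed.

Section Slabs.
Variable c : R.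
Hypothesis cylinderE : forall v O (M a b : R) m, dot v v = 1 -> open O ->
    (forall x, section v a O x -> enorm x <= M) ->
  hausdorff d.+1 (cylinder v a b m.+1%:R^-1 O) =
    ((c / m.+1%:R)%:E * hausdorff d (section v a O))%E.

Let cylinder_area k t b m : t <= 2 ->
  hausdorff d.+1 (cylinder (u k) (h k) b m.+1%:R^-1
    [set x | forall j, [pred j | j != k] j -> dot x (u j) < h j + t]) =
  (c / m.+1%:R * area k t)%:E.
Proof.
move=> t2; have [M HM] := near_facet_bounded k.
rewrite (cylinderE _ _ (u1 k) (@open_near k t) (HM t t2)) [RHS]EFinM.
by rewrite /area fineK// near_facet_fin.
Qed.

(** As the normals are unit vectors, moving by at most [m.+1%:R^-1] along [u k]
    changes the other constraints by at most [m.+1%:R^-1]: the cylinder of this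
    height on the facet shrunk by as much lies in the shifted body. *)
Let volume_bump_up k m :
  volume h + c / m.+1%:R * area k (- (m.+1%:R^-1)) <= volume (bump k m.+1%:R^-1).
Proof.
have t0 : 0 < m.+1%:R^-1 :> R by rewrite invr_gt0 ltr0n.
have t2 : - m.+1%:R^-1 <= 2 :> R by rewrite (@le_trans _ _ 0)// oppr_le0 ltW.
rewrite -lee_fin EFinD -(cylinder_area k (h k) m t2).
rewrite !volumeE//; set t := m.+1%:R^-1 in t0 *; set O := [set x | _].
have mP : measurable (polyhedron u h : set (caratheodory_type (@hausdorff R d.+1 d.+1))).
  rewrite -[X in measurable X]setCK; apply: measurableC; apply: caratheodory_open.
  exact/closed_openC/polyhedron_closed.
rewrite (mP (polyhedron u (bump k t))); apply: leeD; apply: le_hausdorff => x.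
  move=> xP; split=> // j; apply: le_trans (xP j) _.
  by rewrite /bump; case: ifP => // _; rewrite lerDl ltW.
move=> [/andP[xk1 xk2] xO]; split; last by move=> /(_ k); rewrite leNgt xk1.
move=> j; rewrite /bump; have [->//|jk] := eqVneq j k.
have := xO j jk; rewrite !dotE; have := dot_uu k j; rewrite ler_norml => /andP[_ uu].
have s0 : 0 <= dot x (u k) - h k by rewrite subr_ge0 ltW.
by have := ler_wpM2l s0 uu; lra.
Qed.

(** Likewise, the slab that is cut off lies in a cylinder on an enlarged facet;
    the factor 2 makes its constraints hold strictly. *)
Let volume_bump_down k m :
  volume h <= volume (bump k (- m.+1%:R^-1)) + c / m.+1%:R * area k (2 * m.+1%:R^-1).
Proof.
have t0 : 0 < m.+1%:R^-1 :> R by rewrite invr_gt0 ltr0n.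
have t2 : 2 * m.+1%:R^-1 <= 2 :> R.
  by rewrite ler_piMr// invf_le1 ?ltr0n// ler1n.
rewrite -lee_fin EFinD -(cylinder_area k (h k - m.+1%:R^-1) m t2).
rewrite !volumeE//; set t := m.+1%:R^-1 in t0 *; set O := [set x | _].
apply: le_trans (outer_measureU2 _ _ _); apply: le_hausdorff => x xP.
have [xk|xk] := leP (dot x (u k)) (h k - t); [left|right].
  by move=> j; rewrite /bump; case: ifP => [/eqP ->//|_]; exact: xP.
split; first by rewrite xk subrK xP.
move=> j jk; rewrite !dotE; have := xP j; have := xP k.
have := dot_uu k j; rewrite ler_norml => /andP[_ uu] xk' xj.
have s0 : 0 <= h k - dot x (u k) by rewrite subr_ge0.
by have := ler_wpM2l s0 uu; lra.
Qed.

Hypothesis h_min : forall y, (forall k, 0 < recenter h y k) -> Phi h <= Phi (recenter h y).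
Hypothesis h_max : forall h' z, (forall k, 0 < recenter h' z k) -> exists y,
  (forall k, 0 < recenter h' y k) /\
  Phi (recenter h' y) * volume h' `^ (- p / d.+1%:R) <=
  Phi h * volume h `^ (- p / d.+1%:R).

Let q := - p / d.+1%:R.
Let q0 : 0 < q. Proof. by rewrite divr_gt0 ?oppr_gt0// ltr0n. Qed.

Let V0 : 0 < volume h. Proof. exact: volume_gt0. Qed.

(** The extremality of [h], compared at the shifted body with the lower bound of
    [Phi] by its tangent at [h]; the terms due to the recentering vanish by
    [Phi_min_critical]. *)
Let perturb k (t : R) : 0 < h k + t ->
  (Phi h + p * t * (alpha k * h k `^ (p - 1))) * volume (bump k t) `^ q <=
  Phi h * volume h `^ q.
Proof.
move=> hk; have b0 j : 0 < recenter (bump k t) 0 j.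
  by rewrite /recenter dot0l subr0 /bump; case: ifP => [/eqP ->|].
have [y [y0 yP]] := h_max b0; apply: le_trans yP; rewrite -/q.
apply: ler_wpM2r; first exact: powR_ge0.
apply: le_trans (Phi_tangent alpha0 p0 h0 y0); rewrite lerD2l.
rewrite le_eqVlt; apply/orP; left; apply/eqP; rewrite -mulrA; congr (p * _).
transitivity (t * (alpha k * h k `^ (p - 1)) -
  \sum_j alpha j * h j `^ (p - 1) * dot y (u j)).
  by rewrite (Phi_min_critical u1 alpha0 p0 h0 h_min) subr0.
rewrite (bigD1 k)//= [RHS](bigD1 k)//= opprD addrA; congr (_ + _).
  by rewrite /recenter /bump eqxx; ring.
rewrite -sumrN; apply: eq_bigr => j jk.
by rewrite /recenter /bump (negbTE jk); ring.
Qed.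

Let G0 (k : 'I_N) : 0 < Phi h.
Proof. by apply: Phi_gt0 => //; case: k => i; exact: leq_ltn_trans. Qed.

Let bump_gt0 k t : 0 < h k + t -> 0 < volume (bump k t).
Proof.
by move=> hk; apply: volume_gt0 => // j; rewrite /bump; case: ifP => [/eqP ->|].
Qed.

(** Minus the logarithmic derivative of [Phi] in the variable [h k]. *)
Let rate k : R := - p * (alpha k * h k `^ (p - 1)) / Phi h.

Let rate_gt0 k : 0 < rate k.
Proof.
by rewrite /rate divr_gt0 ?(G0 k)// mulr_gt0 ?oppr_gt0// mulr_gt0// powR_gt0.
Qed.

(** [perturb] for an outward shift, divided by the length of the shift; the
    factors that tend to 1 come from replacing logarithms by linear terms and
    the volume of the shifted body by that of a dilate of the body. *)
Let up_bound k m : rate k * m.+1%:R^-1 < 1 ->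
  q * (c * area k (- m.+1%:R^-1)) * (1 - rate k * m.+1%:R^-1) <=
  rate k * ((1 + m.+1%:R^-1 / h k) ^+ d.+1 * volume h).
Proof.
move=> small; have := volume_bump_up k m; have Gk := G0 k; have hk := h0 k.
rewrite mulrAC -mulrA; set t := m.+1%:R^-1; set a := area _ _ => slab.
have t0 : 0 < t by rewrite invr_gt0 ltr0n.
have hkt : 0 < h k + t by rewrite addr_gt0.
have W0 := bump_gt0 hkt; set W := volume (bump k t) in slab W0.
have AE : Phi h + p * t * (alpha k * h k `^ (p - 1)) = Phi h * (1 - rate k * t).
  by rewrite /rate; field; exact: lt0r_neq0.
have y1 : 0 < 1 - rate k * t by rewrite subr_gt0.
have A0 : 0 < Phi h * (1 - rate k * t) by rewrite mulr_gt0.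
have := perturb hkt; rewrite -/W AE => /(powR_compare q0 A0 Gk V0 W0) cmp.
have l1 := ln_sub_le Gk A0; have l2 := ln_sub_le V0 W0.
have E1 : Phi h / (Phi h * (1 - rate k * t)) = (1 - rate k * t)^-1.
  by field; rewrite !lt0r_neq0.
have key : q * (1 - volume h / W) <= (1 - rate k * t)^-1 - 1.
  rewrite -E1; apply: le_trans _ l1; apply: le_trans _ cmp.
  by rewrite ler_pM2l//; lra.
have {key} : q * (W - volume h) * (1 - rate k * t) <= rate k * t * W.
  have WV : q * (W - volume h) = q * (1 - volume h / W) * W.
    by field; exact: lt0r_neq0.
  have yE : rate k * t * W = ((1 - rate k * t)^-1 - 1) * W * (1 - rate k * t).
    by field; exact: lt0r_neq0.
  by rewrite WV yE ler_pM2r// ler_pM2r.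
have Wle : W <= (1 + t / h k) ^+ d.+1 * volume h.
  rewrite -volume_scale//; last by rewrite addr_gt0// divr_gt0.
  apply: le_volume => //; apply: polyhedron_mono => j; rewrite /bump.
  have th : 0 < t / h k by rewrite divr_gt0.
  case: ifP => [/eqP ->|_]; last by rewrite mulrDl mul1r lerDl mulr_ge0 ?ltW.
  by rewrite mulrDl mul1r divfK ?lt0r_neq0.
move=> key; rewrite -(ler_pM2l t0).
apply: (@le_trans _ _ (rate k * t * W)); last first.
  by rewrite mulrCA mulrA ler_pM2l// mulr_gt0.
apply: le_trans key; rewrite mulrA mulrA ler_pM2r//.
by rewrite -mulrA mulrCA ler_pM2l//; lra.
Qed.

Let down_bound k m : m.+1%:R^-1 < h k ->
  rate k * ((1 - m.+1%:R^-1 / h k) ^+ d.+1 * volume h) <=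
  q * (c * area k (2 * m.+1%:R^-1)) * (1 + rate k * m.+1%:R^-1).
Proof.
move=> small; have := volume_bump_down k m; have Gk := G0 k; have hk := h0 k.
set t := m.+1%:R^-1 in small *; set a := area _ _ => slab.
have t0 : 0 < t by rewrite invr_gt0 ltr0n.
have hkt : 0 < h k - t by rewrite subr_gt0.
have W0 := bump_gt0 hkt; set W := volume (bump k (- t)) in slab W0.
have AE : Phi h + p * - t * (alpha k * h k `^ (p - 1)) = Phi h * (1 + rate k * t).
  by rewrite /rate; field; exact: lt0r_neq0.
have rt : 0 < rate k * t by rewrite mulr_gt0.
have y1 : 0 < 1 + rate k * t by rewrite addr_gt0.
have A0 : 0 < Phi h * (1 + rate k * t) by rewrite mulr_gt0.
have := perturb hkt; rewrite -/W AE => /(powR_compare q0 A0 Gk V0 W0) cmp.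
have l1 := ln_sub_le Gk A0; have l2 := ln_sub_le V0 W0.
have E1 : Phi h / (Phi h * (1 + rate k * t)) = (1 + rate k * t)^-1.
  by field; rewrite !lt0r_neq0.
have key : 1 - (1 + rate k * t)^-1 <= q * (volume h / W - 1).
  have : q * (ln (volume h) - ln W) <= q * (volume h / W - 1) by rewrite ler_pM2l.
  by rewrite -E1; lra.
have {}key : rate k * t * W <= q * (volume h - W) * (1 + rate k * t).
  have WV : q * (volume h - W) = q * (volume h / W - 1) * W.
    by field; exact: lt0r_neq0.
  have yE : rate k * t * W = (1 - (1 + rate k * t)^-1) * W * (1 + rate k * t).
    by field; exact: lt0r_neq0.
  by rewrite WV yE ler_pM2r// ler_pM2r.
have Wge : (1 - t / h k) ^+ d.+1 * volume h <= W.
  have th : 0 < t / h k by rewrite divr_gt0.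
  rewrite -volume_scale//; last by rewrite subr_gt0 ltr_pdivrMr// mul1r.
  apply: le_volume => //; apply: polyhedron_mono => j; rewrite /bump.
  case: ifP => [/eqP ->|_]; last by rewrite mulrBl mul1r gerBl mulr_ge0 ?ltW.
  by rewrite mulrBl mul1r divfK ?lt0r_neq0.
apply: (@le_trans _ _ (rate k * W)); first by rewrite ler_pM2l.
rewrite -(ler_pM2l t0) mulrCA mulrA; apply: le_trans key _.
rewrite mulrA ler_pM2r// mulrCA ler_pM2l//.
by lra.
Qed.

Let facet_areaE k : q * (c * area k 0) = rate k * volume h.
Proof.
have t_cvg : (fun m : nat => m.+1%:R^-1 : R) @ \oo --> 0 by exact: cvg_harmonic.
have lin_cvg (a b : R) : (fun m : nat => a + b * m.+1%:R^-1) @ \oo --> a.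
  rewrite -[X in _ --> X]addr0 -(mulr0 b); apply: cvgD; first exact: cvg_cst.
  by apply: cvgM => //; exact: cvg_cst.
have pow_cvg (b : R) (j : nat) : (fun m : nat => (1 + b * m.+1%:R^-1) ^+ j) @ \oo --> (1 : R).
  elim: j => [|j IH]; first by under eq_fun do rewrite expr0; exact: cvg_cst.
  have -> : (fun m : nat => (1 + b * m.+1%:R^-1) ^+ j.+1) =
      (fun m => (1 + b * m.+1%:R^-1) * (1 + b * m.+1%:R^-1) ^+ j).
    by apply/funext => m; rewrite exprS.
  by rewrite -[X in _ --> X](mulr1 (1 : R)); exact: cvgM (lin_cvg 1 b) IH.
have near_small (e : R) : 0 < e -> \forall m \near \oo, m.+1%:R^-1 < e.
  move=> e0; have [m0 m0e] := harmonic_small e0; exists m0 => // m /= mm.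
  by apply: le_lt_trans m0e; exact: harmonic_le.
have up1 : (fun m => q * (c * area k (- m.+1%:R^-1)) * (1 - rate k * m.+1%:R^-1))
    @ \oo --> q * (c * area k 0).
  rewrite -[X in _ --> X]mulr1; apply: cvgM.
    apply: cvgM; first exact: cvg_cst.
    by apply: cvgM; [exact: cvg_cst|exact: area_inner_cvg].
  under eq_fun do rewrite -mulNr.
  exact: lin_cvg.
have up2 : (fun m => rate k * ((1 + m.+1%:R^-1 / h k) ^+ d.+1 * volume h))
    @ \oo --> rate k * volume h.
  apply: cvgM; first exact: cvg_cst.
  rewrite -[X in _ --> X](mul1r (volume h)); apply: cvgM; last exact: cvg_cst.
  have -> : (fun m : nat => (1 + m.+1%:R^-1 / h k) ^+ d.+1) =
      (fun m => (1 + (h k)^-1 * m.+1%:R^-1) ^+ d.+1).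
    by apply/funext => m; rewrite (mulrC _ (h k)^-1).
  exact: pow_cvg.
have down1 : (fun m => rate k * ((1 - m.+1%:R^-1 / h k) ^+ d.+1 * volume h))
    @ \oo --> rate k * volume h.
  apply: cvgM; first exact: cvg_cst.
  rewrite -[X in _ --> X](mul1r (volume h)); apply: cvgM; last exact: cvg_cst.
  have -> : (fun m : nat => (1 - m.+1%:R^-1 / h k) ^+ d.+1) =
      (fun m => (1 + (- (h k)^-1) * m.+1%:R^-1) ^+ d.+1).
    by apply/funext => m; rewrite mulNr (mulrC _ (h k)^-1).
  exact: pow_cvg.
have down2 : (fun m => q * (c * area k (2 * m.+1%:R^-1)) * (1 + rate k * m.+1%:R^-1))
    @ \oo --> q * (c * area k 0).
  rewrite -[X in _ --> X]mulr1; apply: cvgM; last exact: lin_cvg.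
  apply: cvgM; first exact: cvg_cst.
  by apply: cvgM; [exact: cvg_cst|exact: area_outer_cvg].
apply/eqP; rewrite eq_le; apply/andP; split.
- apply: ler_cvg_to up1 up2 _.
  near=> m; apply: up_bound; rewrite mulrC -ltr_pdivlMr//.
  by near: m; apply: near_small; rewrite divr_gt0.
- apply: ler_cvg_to down1 down2 _.
  near=> m; apply: down_bound.
  by near: m; exact: near_small.
Unshelve. all: by end_near. Qed.

(** At an extremal body the relative growth of the power of the volume under a
    shift of the [k]-th facet balances the relative decrease of [Phi].  The
    one-sided bounds for outward and inward shifts have the same limit, because
    the areas of the shrunk and of the enlarged facets tend to that of the
    facet. *)
Lemma euler_lagrange k :
  - p / d.+1%:R * (c * fine (hausdorff d (facet_interior u h k))) =
  - p * (alpha k * h k `^ (p - 1)) / Phi h * volume h.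
Proof. by rewrite -near_facet0; exact: facet_areaE. Qed.

End Slabs.

Lemma facet_interior_fin k : hausdorff d (facet_interior u h k) \is a fin_num.
Proof. by rewrite -near_facet0; exact: near_facet_fin. Qed.

End EulerLagrange.

(** * The Minkowski problem for given facet normals *)

Section Minkowski.
Context {R : realType} {d N : nat}.
Variables (u : 'I_N -> 'rV[R]_d.+1) (alpha : 'I_N -> R) (p : R).
Hypothesis u1 : forall k, dot (u k) (u k) = 1.
Hypothesis uI : injective u.
Hypothesis alpha0 : forall k, 0 < alpha k.
Hypothesis p0 : p < 0.
Hypothesis spanning : forall w, w != 0 -> exists k, 0 < dot w (u k).
Hypothesis nondegenerate : forall h x y, polyhedron u h x -> polyhedron u h y ->
  x != y -> exists z, forall k, 0 < recenter u h z k.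

Lemma facet_interior_scale (h : 'I_N -> R) (l : R) k : 0 < l ->
  facet_interior u (fun k => l * h k) k = [set l *: x | x in facet_interior u h k].
Proof.
move=> l0; apply/seteqP; split=> [x [xk xj]|_ [x [xk xj] <-]].
  exists (l^-1 *: x); last by rewrite scalerA mulfV ?scale1r// gt_eqF.
  split; first by rewrite dotZl xk mulKf// gt_eqF.
  by move=> j jk; rewrite dotZl mulrC ltr_pdivrMr// mulrC; exact: xj.
by split=> [|j jk]; rewrite dotZl ?xk// ltr_pM2l//; exact: xj.
Qed.

(** The Euler-Lagrange equations give the weights up to a common factor
    [kappa]; a dilation by [l] multiplies them by [l `^ e], where
    [e = d.+1 - p] is positive. *)
Lemma minkowski_problem : exists h : 'I_N -> R, (forall k, 0 < h k) /\
  forall k, ((h k `^ (1 - p))%:E * hausdorff d (facet_interior u h k) = (alpha k)%:E)%E.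
Proof.
have [h [h0 hmin hmax]] :=
  extremal_polytope (ltn0Sn d) u1 alpha0 p0 spanning nondegenerate.
have [c c0 cylE] := @hausdorff_cylinder R d.
have [N0|N0] := posnP N.
  by exists h; split=> // k; have := ltn_ord k; rewrite [X in (_ < X)%N]N0.
have G0 : 0 < Phi alpha p h by exact: Phi_gt0.
have V0 : 0 < volume u h by exact: volume_gt0.
pose area k := fine (hausdorff d (facet_interior u h k)).
have areaE k : hausdorff d (facet_interior u h k) = (area k)%:E.
  by rewrite fineK//; exact: facet_interior_fin.
have EL k : - p / d.+1%:R * (c * area k) =
    - p * (alpha k * h k `^ (p - 1)) / Phi alpha p h * volume u h.
  exact: (euler_lagrange u1 uI alpha0 p0 spanning h0 cylE hmin hmax k).
pose kappa := d.+1%:R * volume u h / (Phi alpha p h * c).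
have kappa0 : 0 < kappa by rewrite divr_gt0 ?mulr_gt0// ltr0n.
have pN0 : - p != 0 by rewrite oppr_eq0 lt_eqF.
have area_kappa k : h k `^ (1 - p) * area k = kappa * alpha k.
  have hp : h k `^ (p - 1) * h k `^ (1 - p) = 1.
    rewrite -powRD; last by rewrite (gt_eqF (h0 k)) implybT.
    by rewrite addrC subrKA subrr powRr0.
  have n0 : d.+1%:R != 0 :> R by rewrite pnatr_eq0.
  have -> : area k = kappa * alpha k * h k `^ (p - 1).
    have pc : - p / d.+1%:R * c != 0 by rewrite !mulf_neq0 ?invr_eq0// lt0r_neq0.
    apply: (mulfI pc); rewrite -[LHS]mulrA EL /kappa; field.
    by rewrite !lt0r_neq0// ltr0n.
  by rewrite mulrCA (mulrC (h k `^ _)) hp mulr1.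
pose e : R := 1 - p + d%:R.
have e0 : e != 0.
  by rewrite gt_eqF// ltr_wpDr ?ler0n// subr_gt0 (lt_trans p0).
pose l := kappa `^ (- e^-1).
have l0 : 0 < l by rewrite powR_gt0.
exists (fun k => l * h k); split=> [k|k]; first by rewrite mulr_gt0.
rewrite facet_interior_scale// hausdorff_scale// areaE -!EFinM; congr _%:E.
rewrite powRM ?ltW// -(powR_mulrn _ (ltW l0)) mulrACA -powRD; last first.
  by rewrite (gt_eqF l0) implybT.
rewrite area_kappa -/e /l -powRrM mulNr mulVf// mulrA.
by rewrite powRN powRr1 ?(ltW kappa0)// mulVf ?mul1r// gt_eqF.
Qed.

End Minkowski.

(** * Discrete measures, their supports and essential subspaces *)

Section Supports.
Context {R : realType} {n : nat}.
Implicit Types (mu nu : set 'rV[R]_n -> \bar R).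

Lemma sphereP (x : 'rV[R]_n) : sphere R n x <-> dot x x = 1.
Proof.
split=> [|x1]; first by rewrite /sphere /= => x1; rewrite -enorm_sqr x1 expr1n.
by rewrite /sphere /= /enorm x1 sqrtr1.
Qed.

Lemma measurable_open_sphere (U : set 'rV[R]_n) : open U ->
  measurable (U `&` sphere R n : set (borel R n)).
Proof.
move=> oU; apply: measurableI; first exact: sub_sigma_algebra.
rewrite -[X in measurable X]setCK; apply: measurableC; apply: sub_sigma_algebra.
apply: closed_openC; rewrite (_ : sphere R n = @enorm R n @^-1` [set t | t = 1])//.
by apply: preimage_closed (@closed_eq _ 1) => x _; exact: enorm_continuous.
Qed.

Lemma eq_measure_support mu nu :
  (forall omega : set (borel R n), measurable omega -> omega `<=` sphere R n ->
     mu omega = nu omega) ->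
  measure_support mu = measure_support nu.
Proof.
move=> munu; apply/seteqP; split=> x [x1 xU]; split=> // U oU Ux.
  by rewrite -munu; [exact: xU|exact: measurable_open_sphere|move=> y []].
by rewrite munu; [exact: xU|exact: measurable_open_sphere|move=> y []].
Qed.

Lemma eq_no_essential_subspace mu nu : measure_support mu = measure_support nu ->
  no_essential_subspace mu -> no_essential_subspace nu.
Proof. by move=> munu ness X; rewrite /essential -munu; exact: ness. Qed.

Lemma atoms_support {N} mu (c : 'I_N -> R) (u : 'I_N -> 'rV[R]_n) :
  (forall k, 0 < c k) -> (forall k, dot (u k) (u k) = 1) ->
  (forall omega : set (borel R n), measurable omega -> omega `<=` sphere R n ->
    mu omega = (\sum_(k < N) (c k)%:E * \d_(u k : borel R n) omega)%E) ->
  measure_support mu = range u.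
Proof.
move=> c0 u1 muE; apply/seteqP; split=> [x [x1 xU]|_ [k _ <-]]; last first.
  split=> [|U oU Uk]; first exact/sphereP.
  rewrite muE; [|exact: measurable_open_sphere|by move=> y []].
  rewrite (bigD1 k)//=; apply: (@lt_le_trans _ _ ((c k)%:E * \d_(u k : borel R n) (U `&` sphere R n))%E).
    rewrite diracE mem_set; first by rewrite mule1 lte_fin.
    by split=> //; exact/sphereP.
  rewrite leeDl//; apply: sume_ge0 => j _; apply: mule_ge0 => //.
  by rewrite lee_fin ltW.
apply: contrapT => nx; pose U := ~` range u.
have oU : open U.
  apply: closed_openC; have := @accessible_finite_set_closed 'rV[R]_n.
  move=> [+ _]; apply; first exact/hausdorff_accessible/norm_hausdorff.
  by apply: finite_image; exact: finite_finset.
have := xU U oU nx; rewrite muE; [|exact: measurable_open_sphere|by move=> y []].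
rewrite big1 ?ltxx// => k _; rewrite diracE memNset ?mule0//.
by move=> [+ _]; apply; exists k.
Qed.

(** Atoms at the same point are merged, so that the normals are distinct. *)
Lemma discrete_measure_atoms (mu : set 'rV[R]_n -> \bar R) : discrete_measure mu ->
  exists (N : nat) (alpha : 'I_N -> R) (u : 'I_N -> 'rV[R]_n),
    [/\ forall k, 0 < alpha k, forall k, dot (u k) (u k) = 1, injective u &
        forall omega : set (borel R n), measurable omega ->
          mu omega = (\sum_(k < N) (alpha k)%:E * \d_(u k : borel R n) omega)%E].
Proof.
move=> [N [alpha [u [a0 u1 muE]]]].
pose s := undup [seq u k | k <- enum 'I_N].
have us k : u k \in s by rewrite mem_undup map_f ?mem_enum.
have idx_lt k : (index (u k) s < size s)%N by rewrite index_mem.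
pose idx k := Ordinal (idx_lt k).
pose v (j : 'I_(size s)) := s`_j.
have vidx k : v (idx k) = u k by rewrite /v /= nth_index.
have idxE j : exists k, idx k = j.
  have : v j \in s by exact: mem_nth.
  rewrite mem_undup => /mapP[k _ vk]; exists k; apply: val_inj => /=.
  by rewrite -vk index_uniq ?undup_uniq.
exists (size s), (fun j => \sum_(k | idx k == j) alpha k), v; split.
- move=> j; have [k kj] := idxE j; rewrite (bigD1 k) ?kj//= ltr_pwDl// sumr_ge0// => i _.
  exact: ltW.
- by move=> j; have [k <-] := idxE j; rewrite vidx; exact/sphereP.
- move=> i j vij; apply: val_inj; apply/eqP.
  by rewrite -(nth_uniq 0 (ltn_ord i) (ltn_ord j) (undup_uniq _)); apply/eqP.
- move=> omega mo; rewrite muE// (partition_big idx xpredT)//=.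
  apply: eq_bigr => j _; rewrite -sumEFin ge0_sume_distrl; last first.
    by move=> k _; rewrite lee_fin ltW.
  by apply: eq_bigr => k /eqP <-; rewrite vidx.
Qed.

Lemma spanning_of_support {N} mu (u : 'I_N -> 'rV[R]_n) :
  measure_support mu = range u -> (forall k, dot (u k) (u k) = 1) ->
  ~ concentrated_on_hemisphere fullv (measure_support mu) ->
  forall w, w != 0 -> exists k, 0 < dot w (u k).
Proof.
move=> suppE u1 nconc w w0; apply: contrapT => nk; apply: nconc; exists (- w).
split; [exact: memvf|by rewrite oppr_eq0|].
rewrite suppE => _ [k _ <-]; split; [exact: memvf|exact/sphereP|].
rewrite dotNr oppr_ge0 dotC leNgt; apply/negP => kw; apply: nk; by exists k.
Qed.

Lemma span_orthogonal (s : seq 'rV[R]_n) w x :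
  (forall y, y \in s -> dot y w = 0) -> x \in << s >>%VS -> dot x w = 0.
Proof.
move=> sw /(@coord_span _ _ _ (in_tuple s)) ->; rewrite dot_suml big1// => i _.
by rewrite dotZl sw ?mulr0//; exact: mem_nth.
Qed.

(** If a polyhedron has empty interior, the normals of the constraints active
    at all its points span an essential subspace, unless it is a point. *)
Lemma nondegenerate_of_no_essential {N} mu (u : 'I_N -> 'rV[R]_n) :
  measure_support mu = range u -> (forall k, dot (u k) (u k) = 1) ->
  no_essential_subspace mu ->
  forall h x y, polyhedron u h x -> polyhedron u h y -> x != y ->
  exists z, forall k, 0 < recenter u h z k.
Proof.
move=> suppE u1 ness h x y xP yP xy; apply: contrapT => nz.
pose active z := [set k | dot z (u k) == h k]%SET.
(* A point with the fewest active constraints: by convexity these are active at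
   every point of the polyhedron. *)
have [x0 x0P x0min] : exists2 z, polyhedron u h z &
    forall z', polyhedron u h z' -> (#|active z| <= #|active z'|)%N.
  pose Q m := `[< exists2 z, polyhedron u h z & #|active z| = m >].
  have exQ : exists m, Q m by exists #|active x|; apply/asboolP; exists x.
  case: (ex_minnP exQ) => m /asboolP[z zP zm] mmin; exists z => // z' z'P.
  by rewrite zm; apply: mmin; apply/asboolP; exists z'.
have activeP z : polyhedron u h z -> active x0 \subset active z.
  move=> zP; pose w := 2^-1 *: x0 + 2^-1 *: z.
  have wP : polyhedron u h w.
    by move=> k; rewrite !dotE; have := x0P k; have := zP k; lra.
  have wx : active w \subset active x0 :&: active z.
    apply/fintype.subsetP => k; rewrite !inE !dotE => /eqP wk.
    by have := x0P k; have := zP k => zk xk; apply/andP; split; apply/eqP; lra.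
  have : active w == active x0 :&: active z.
    rewrite eqEcard wx/=; apply: leq_trans (x0min _ wP).
    by apply: subset_leq_card; exact: finset.subsetIl.
  move=> /eqP wE; have := x0min _ wP; rewrite wE => le0.
  have : active x0 :&: active z == active x0 by rewrite eqEcard finset.subsetIl.
  by move/eqP/finset.setIidPl.
pose s := [seq u k | k <- enum (active x0)].
have us k : k \in active x0 -> u k \in s by move=> kx; rewrite map_f ?mem_enum.
have perp z z' : polyhedron u h z -> polyhedron u h z' -> forall w, w \in s ->
    dot w (z - z') = 0.
  move=> zP z'P _ /mapP[k + ->]; rewrite mem_enum => kx.
  have := fintype.subsetP (activeP z zP) k kx; have := fintype.subsetP (activeP z' z'P) k kx.
  by rewrite !inE => /eqP z'k /eqP zk; rewrite dotC dotBl zk z'k subrr.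
have [k0 k0x] : exists k, k \in active x0.
  apply: contrapT => nk; apply: nz; exists x0 => k; rewrite /recenter subr_gt0.
  by rewrite lt_neqAle x0P andbT; apply/negP => kx; apply: nk; exists k; rewrite inE.
apply: (ness << s >>%VS); split.
  apply/andP; split.
    rewrite lt0n dimv_eq0; apply/negP => /eqP s0.
    have : u k0 \in << s >>%VS by apply: memv_span; exact: us.
    by rewrite s0 memv0 -dot_eq0 u1 oner_eq0.
  rewrite ltnNge; apply/negP => dims.
  have sT : << s >>%VS = fullv.
    apply/eqP; rewrite eqEdim subvf dimvf /dim/= mul1n//.
  have : dot (x - y) (x - y) = 0.
    by apply: span_orthogonal (perp x y xP yP) _; rewrite sT memvf.
  by move/eqP; rewrite dot_eq0 subr_eq0 (negbTE xy).
move=> [v [vs v0 hemi]].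
(* Hence [x0] can be moved a little in the direction [- v]; but [v] is in the
   span of the active normals, to which all displacements within the polyhedron
   are orthogonal. *)
have vk k : k \in active x0 -> 0 <= dot (u k) v.
  move=> kx; have [|//] := hemi (u k); split; first by apply: memv_span; exact: us.
  by rewrite suppE; exists k.
have oO := @open_dot_lt_family R n N u [pred k | k \notin active x0] h.
have x0O : [set z | forall k, [pred k | k \notin active x0] k -> dot z (u k) < h k] x0.
  by move=> k /=; rewrite inE => kx; rewrite lt_neqAle kx x0P.
have [e e0 eO] := open_step (- v) oO x0O.
have eP : polyhedron u h (x0 + e *: - v).
  move=> k; have [kx|kx] := boolP (k \in active x0); last exact/ltW/eO.
  rewrite !dotE (dotC v); have := mulr_ge0 (ltW e0) (vk k kx); have := x0P k; lra.
have : dot v v = 0.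
  apply: span_orthogonal vs => w ws; have := perp _ _ eP x0P w ws.
  rewrite addrC addKr dotZr dotNr => /eqP; rewrite mulf_eq0 (gt_eqF e0)/= oppr_eq0.
  by move/eqP.
by move/eqP; rewrite dot_eq0 (negbTE v0).
Qed.

End Supports.

(** If no normal had a positive product with [w], the polytope would contain the
    ray from the origin in the direction [w]. *)
Lemma polytope_support (R : realType) (d : nat) (p : R) (P : set 'rV[R]_d.+1) :
  polytope P -> interior P 0 ->
  exists (N : nat) (u : 'I_N -> 'rV[R]_d.+1),
    measure_support (surface_area_measure p P) = range u /\
    forall w, w != 0 -> exists k, 0 < dot w (u k).
Proof.
move=> [[V finV PV] _] P0; rewrite PV in P0.
have [N [u [h [u1 h0 PE wit]]]] := polytope_facets finV P0.
have uI : injective u.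
  move=> i j uij; apply/eqP/negP => /negP ij.
  have [x [xi xj]] := wit i; have [y [yj yi]] := wit j.
  have := xj j; rewrite eq_sym ij -uij xi => /(_ isT).
  by have := yi i ij; rewrite uij yj => h1 /(lt_trans h1); rewrite ltxx.
have [M PM] : exists M, forall x, P x -> enorm x <= M.
  have /compact_bounded[M [_ HM]] := compact_conv_hull finV.
  exists (d.+1%:R * (M + 1)) => x; rewrite PV => Px; apply: le_trans (enorm_le_norm x) _.
  by rewrite ler_pM2l ?ltr0n//; apply: HM => //; rewrite ltrDl.
have finD k : hausdorff d (facet_interior u h k) \is a fin_num.
  rewrite ge0_fin_numE ?hausdorff_ge0//; apply: (hausdorff_section_fin (u1 k) (M := M)) => x Dx.
  by apply: PM; rewrite PV PE; exact: facet_interior_sub Dx.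
have posD k : 0 < fine (hausdorff d (facet_interior u h k)).
  rewrite fine_gt0// -ge0_fin_numE ?hausdorff_ge0// finD andbT.
  have [x Dx] := wit k.
  apply: (hausdorff_section_gt0 (u1 k) (@open_dot_lt_family _ _ _ u [pred j | j != k] h) (x := x)).
  exact: Dx.
exists N, u; split.
  apply: (@atoms_support _ _ _ _ (fun k => h k `^ (1 - p) * fine (hausdorff d (facet_interior u h k)))) => //.
    by move=> k; rewrite mulr_gt0 ?powR_gt0.
  move=> omega _ _; rewrite PV PE surface_area_polyhedron//.
  by apply: eq_bigr => k _; rewrite EFinM fineK.
move=> w w0; apply: contrapT => nk.
have wk k : dot w (u k) <= 0 by rewrite leNgt; apply/negP => kw; apply: nk; exists k.
have ew := enorm_gt0 w0.
have M0 : 0 <= M.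
  apply: le_trans (enorm_ge0 0) (PM 0 _); rewrite PV; exact: interior_subset P0.
have : P ((M + 1) / enorm w *: w).
  rewrite PV PE => k; rewrite dotZl; apply: le_trans (ltW (h0 k)).
  by apply: mulr_ge0_le0 => //; rewrite divr_ge0 ?addr_ge0 ?(ltW ew).
move=> /PM; rewrite enormZ ger0_norm ?divr_ge0 ?addr_ge0 ?(ltW ew)// divfK ?gt_eqF//.
by rewrite gerDl ler10.
Qed.

Theorem theorem1p1 (R : realType) (n : nat) (n_ge2 : (2 <= n)%N)
    (p : R) (p_lt0 : p < 0) (mu : {measure set (borel R n) -> \bar R})
    (mu_discrete : discrete_measure mu) :
  (exists P : set 'rV[R]_n,
    [/\ polytope P,
        interior P 0,
        forall omega : set (borel R n), measurable omega ->
          omega `<=` sphere R n -> surface_area_measure p P omega = mu omega &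
        no_essential_subspace (surface_area_measure p P)]) <->
  (no_essential_subspace mu /\
   ~ concentrated_on_hemisphere fullv (measure_support mu)).
Proof.
case: n n_ge2 mu mu_discrete => // d _ mu mu_discrete; split.
  move=> [P [polyP P0 SP ness]]; have suppE := eq_measure_support SP.
  split; first exact: eq_no_essential_subspace suppE ness.
  have [N [u [uE spanning]]] := polytope_support p polyP P0.
  rewrite -suppE uE => -[v [_ v0 hemi]].
  have [|k] := spanning (- v); first by rewrite oppr_eq0.
  rewrite dotNl oppr_gt0 dotC ltNge.
  by have [|_ _ ->] := hemi (u k); first by exists k.
move=> [ness nconc].
have [N [alpha [u [a0 u1 uI muE]]]] := discrete_measure_atoms mu_discrete.
have suppE : measure_support mu = range u.
  by apply: (atoms_support a0 u1) => omega mo _; exact: muE.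
have spanning := spanning_of_support suppE u1 nconc.
have nondeg := nondegenerate_of_no_essential suppE u1 ness.
have [h [h0 hE]] := minkowski_problem u1 uI a0 p_lt0 spanning nondeg.
exists (polyhedron u h).
have SE (omega : set (borel R d.+1)) : measurable omega -> omega `<=` sphere R d.+1 ->
    surface_area_measure p (polyhedron u h) omega = mu omega.
  move=> mo _; rewrite surface_area_polyhedron// muE//.
  by apply: eq_bigr => k _; congr (_ * _)%E; exact: hE.
split.
- split; last by have := volume_gt0 u1 spanning h0; rewrite -lte_fin volumeE.
  have [M HM] := polyhedron_bounded_by spanning h.
  exact: polyhedron_conv_hull HM.
- by apply/interior_polyhedron => // k; rewrite dot0l.
- exact: SE.
- by apply: eq_no_essential_subspace ness; apply/esym/eq_measure_support.
Qed.
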